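(* Let $\mathcal F\in T_1$ admit a meromorphic first integral which vanishes with multiplicity one along the unique separatrix of $\mathcal F$ that is tangent (after blowing up the origin) to the exceptional divisor. Then $\mathcal F$ is holomorphically equivalent to a germ of foliation defined by polynomial equations, i.e. by a $1$-form $P(x,y)\,dx+Q(x,y)\,dy$ with $P,Q\in\mathbb C[x,y]$.
   Context: $T_1$ denotes the set of germs at $0\in\mathbb C^2$ of holomorphic foliations defined by a $1$-form $\sum_{j\ge2}b_j(x,y)\,dx-\sum_{j\ge2}a_j(x,y)\,dy=0$, where $a_j,b_j$ are homogeneous polynomials of degree $j$ (the series converging near $0$), $a_2(x,y)=xy$, $b_2(x,y)=y^2$, and $x\,b_3(x,y)-y\,a_3(x,y)=\beta x^4$ for some $\beta\neq0$. After one blow-up $(x,t)\mapsto(x,tx)$ such a foliation becomes regular near the exceptional divisor $E$, with exactly one tangency point with $E$, of order $1$, at $t=0$; the leaf through this tangency point blows down to a separatrix of $\mathcal F$ (a germ of invariant curve through $0$), the unique one tangent to $E$. A meromorphic first integral is a germ of meromorphic function $f/g$ ($f,g$ coprime holomorphic germs) whose level sets are unions of leaves. Holomorphic equivalence means conjugation by a germ of holomorphic diffeomorphism of $(\mathbb C^2,0)$. *)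

(* Defs.v *)
(* complex numbers as pairs of Stdlib reals, germs of
   holomorphic functions at 0 in C^2 as convergent double power series. *)
From Stdlib Require Import Reals Arith.
Open Scope R_scope.

Definition C : Type := (R * R)%type.
Definition C0 : C := (0, 0).
Definition C1 : C := (1, 0).
Definition Cplus (z w : C) : C := (fst z + fst w, snd z + snd w).
Definition Copp (z : C) : C := (- fst z, - snd z).
Definition Cminus (z w : C) : C := Cplus z (Copp w).
Definition Cmult (z w : C) : C :=
  (fst z * fst w - snd z * snd w, fst z * snd w + snd z * fst w).
Definition Cnorm (z : C) : R := sqrt (fst z ^ 2 + snd z ^ 2).
Definition INC (n : nat) : C := (INR n, 0).

Fixpoint sumC (n : nat) (F : nat -> C) : C :=
  match n with
  | O => C0
  | S m => Cplus (sumC m F) (F m)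
  end.

(* ---------- double power series: g i j = coefficient of x^i y^j ---------- *)
Definition germ : Type := nat -> nat -> C.

(* convergence near 0: Cauchy-type estimate |c_ij| <= M / r^(i+j), r > 0 *)
Definition convergent (f : germ) : Prop :=
  exists M r : R, 0 < r /\ forall i j : nat, Cnorm (f i j) <= M / r ^ (i + j).

Definition gadd (f g : germ) : germ := fun i j => Cplus (f i j) (g i j).
Definition gopp (f : germ) : germ := fun i j => Copp (f i j).
Definition gsub (f g : germ) : germ := gadd f (gopp g).
Definition gscal (c : C) (f : germ) : germ := fun i j => Cmult c (f i j).
Definition gmul (f g : germ) : germ := fun i j =>
  sumC (S i) (fun a => sumC (S j) (fun b => Cmult (f a b) (g (i - a)%nat (j - b)%nat))).
Definition gone : germ := fun i j =>
  if andb (Nat.eqb i 0) (Nat.eqb j 0) then C1 else C0.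
Fixpoint gpow (f : germ) (n : nat) : germ :=
  match n with
  | O => gone
  | S m => gmul f (gpow f m)
  end.
Definition gdx (f : germ) : germ := fun i j => Cmult (INC (S i)) (f (S i) j).
Definition gdy (f : germ) : germ := fun i j => Cmult (INC (S j)) (f i (S j)).

Definition germ_eq (f g : germ) : Prop := forall i j, f i j = g i j.
Definition germ_nonzero (f : germ) : Prop := exists i j, f i j <> C0.

Definition is_unit (f : germ) : Prop := f 0%nat 0%nat <> C0.
Definition divides (d f : germ) : Prop :=
  exists q, convergent q /\ germ_eq f (gmul d q).
Definition coprime (f g : germ) : Prop :=
  forall d, convergent d -> divides d f -> divides d g -> is_unit d.
Definition irreducible (h : germ) : Prop :=
  convergent h /\ germ_nonzero h /\ ~ is_unit h /\
  forall a b, convergent a -> convergent b -> germ_eq h (gmul a b) ->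
    is_unit a \/ is_unit b.

(* ---------- foliations  B dx - A dy = 0,  tangent vector field A d/dx + B d/dy ---------- *)
Definition vf (A B f : germ) : germ := gadd (gmul A (gdx f)) (gmul B (gdy f)).

(* membership in T_1 (A = sum a_j, B = sum b_j) *)
Definition in_T1 (A B : germ) : Prop :=
  convergent A /\ convergent B /\
  (forall i j : nat, (i + j <= 1)%nat -> A i j = C0 /\ B i j = C0) /\
  A 2%nat 0%nat = C0 /\ A 1%nat 1%nat = C1 /\ A 0%nat 2%nat = C0 /\
  B 2%nat 0%nat = C0 /\ B 1%nat 1%nat = C0 /\ B 0%nat 2%nat = C1 /\
  (* x b_3 - y a_3 = beta x^4, beta <> 0 *)
  exists beta : C, beta <> C0 /\
    forall i j : nat, (i + j = 4)%nat ->
      Cminus (match i with O => C0 | S i' => B i' j end)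
             (match j with O => C0 | S j' => A i j' end)
      = (if Nat.eqb i 4 then beta else C0).

(* f/g (f, g coprime convergent germs, g <> 0) is a non-constant meromorphic
   first integral: d(f/g) /\ omega = 0, i.e. g v(f) - f v(g) = 0 *)
Definition mero_first_integral (A B f g : germ) : Prop :=
  convergent f /\ convergent g /\ germ_nonzero g /\ coprime f g /\
  ~ (exists c : C, germ_eq f (gscal c g)) /\
  germ_eq (gsub (gmul g (vf A B f)) (gmul f (vf A B g))) (fun _ _ => C0).

(* {h = 0} is a separatrix: h irreducible and invariant (h divides v(h)) *)
Definition separatrix (A B h : germ) : Prop :=
  irreducible h /\ divides h (vf A B h).

(* tangent cone of {h=0} is {y = 0}: lowest homogeneous part of h is c y^m.
   Equivalently the strict transform meets E at t = 0. *)
Definition tangent_cone_y (h : germ) : Prop :=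
  exists (m : nat) (c : C), c <> C0 /\
    (forall i j : nat, (i + j < m)%nat -> h i j = C0) /\
    (forall i j : nat, (i + j = m)%nat -> h i j = (if Nat.eqb i 0 then c else C0)).

Definition poly_bounded (N : nat) (P : germ) : Prop :=
  forall i j : nat, (N < i)%nat \/ (N < j)%nat -> P i j = C0.

(* P(phi1, phi2), for P supported in [0..N]^2 *)
Definition peval (N : nat) (P phi1 phi2 : germ) : germ := fun i j =>
  sumC (S N) (fun a => sumC (S N) (fun b =>
    gscal (P a b) (gmul (gpow phi1 a) (gpow phi2 b)) i j)).

(* Main.v *)
Require Import Defs.
From HB Require Import structures.
From mathcomp Require Import all_boot all_order all_algebra.
From mathcomp Require Import boolp complex Rstruct.
From mathcomp Require Import ring lra zify.
Set Implicit Arguments.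
Unset Strict Implicit.
Unset Printing Implicit Defensive.
Import Order.TTheory GRing.Theory Num.Theory.
Local Open Scope ring_scope.

(* Write the foliation as B dx - A dy = 0 and let f/g be the first integral. Blowing up, the
   members of the pencil f - c g have no common tangent, and the simple vanishing of f along
   the cuspidal separatrix forces the Wronskian of the initial forms of f and g to have full
   degree. Hence g df - f dg = e prod_s l_s^(m_s) (B dx - A dy) with e a unit and l_s = 0 smooth
   leaves x = nu_s(y) with distinct tangents, along which f - c_s g vanishes to order m_s + 1.
   Truncating and interpolating gives polynomials F, G, close to rho f and rho g for some rho(y),
   such that F - c_s G vanishes to order m_s + 1 along polynomial curves x = mu_s(y) close to
   l_s = 0. One then looks for Phi, a perturbation of the identity sending l_s = 0 to these
   curves, with g F(Phi) = f G(Phi). After division by prod_s l_s^(m_s + 1) the linear part of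
   this equation is B eta_1 - A eta_2 up to a unit and higher order; since x^4 belongs to the
   ideal (A, B) modulo higher order, it is solved by a contraction argument on convergent
   series. The form (G dF - F dG) / prod_s (x - mu_s)^(m_s) is polynomial and its pull-back by
   Phi is a unit times B dx - A dy. *)

(** * Formal power series *)

(** Plain truncation of f and g does not suffice: the multiple factors l_s^(m_s + 1) split, G dF - F
    dG keeps no common factor, and its order at the origin stays too high for the form B dx - A dy
    of order 2. The critical curves have to be kept exactly. They exhaust the zeros of g df - f dg
    because L, its quotient by B dx - A dy, has the Wronskian as initial form: the order of L is the
    number of finite roots precisely when no root escapes to the direction y = 0. The factor rho
    comes from Chinese remaindering: interpolation divides by polynomials in y that are nonzero at
    0, units as series only, so the pencil is multiplied by them instead. The unknown has the shape
    Phi = Phi_0 + (prod l_s) eta, where Phi_0 already sends the leaves to the model curves;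
    divisibility by prod l_s^(m_s + 1) then holds identically in eta. Solvability rests on y^2, xy
    and x^4 lying in (A, B) up to higher order: every germ of high order is reached by the linear
    part at the cost of three orders, while quadratic terms double the order. *)

Definition fps (A : Type) := nat -> A.

HB.instance Definition _ (A : Type) := gen_eqMixin (fps A).
HB.instance Definition _ (A : Type) := gen_choiceMixin (fps A).

Lemma fpsP (A : Type) (f g : fps A) : f =1 g -> f = g.
Proof. exact: funext. Qed.

(** A coefficient of [T f] depends on strictly earlier ones of [f], so the iterates stabilize one
    coefficient at a time whatever the starting point; the fixed point is their diagonal. *)
Lemma fps_fixpoint (A : Type) (a0 : A) (T : fps A -> fps A) :
  (forall n f g, (forall i, (i < n)%N -> f i = g i) -> T f n = T g n) ->
  exists f, f = T f.
Proof.
move=> cT; pose u n := iter n T (fun=> a0).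
have st n i : (i < n)%N -> u n i = u i.+1 i.
  elim/ltn_ind: i n => i IH [//|n] ltin; rewrite /u !iterS; apply: cT => j ltji.
  by rewrite -/(u n) -/(u i) !IH // (leq_trans ltji).
exists (fun i => u i.+1 i); apply: fpsP => i.
by rewrite {1}/u iterS; apply: cT => j ltji; rewrite -/(u i) st.
Qed.

Section FpsZmod.
Variable A : zmodType.
Implicit Types f g h : fps A.

Definition fps_add f g : fps A := fun i => f i + g i.
Definition fps_opp f : fps A := fun i => - f i.
Definition fps_zero : fps A := fun=> 0.

Fact fps_addA : associative fps_add.
Proof. by move=> f g h; apply: fpsP => i; apply: addrA. Qed.
Fact fps_addC : commutative fps_add.
Proof. by move=> f g; apply: fpsP => i; apply: addrC. Qed.
Fact fps_add0 : left_id fps_zero fps_add.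
Proof. by move=> f; apply: fpsP => i; apply: add0r. Qed.
Fact fps_addN : left_inverse fps_zero fps_opp fps_add.
Proof. by move=> f; apply: fpsP => i; apply: addNr. Qed.
HB.instance Definition _ :=
  GRing.isZmodule.Build (fps A) fps_addA fps_addC fps_add0 fps_addN.

Lemma fpsD f g i : (f + g) i = f i + g i. Proof. by []. Qed.
Lemma fpsN f i : (- f) i = - f i. Proof. by []. Qed.
Lemma fpsB f g i : (f - g) i = f i - g i. Proof. by []. Qed.
Lemma fps0 i : (0 : fps A) i = 0. Proof. by []. Qed.
Lemma fps_sum (I : Type) (s : seq I) (P : pred I) (F : I -> fps A) i :
  (\sum_(k <- s | P k) F k) i = \sum_(k <- s | P k) F k i.
Proof. by elim/big_rec2: _ => // k y1 y2 _ <-. Qed.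
Lemma fpsMn f n i : (f *+ n) i = f i *+ n.
Proof. by elim: n => // n IH; rewrite !mulrS fpsD IH. Qed.
End FpsZmod.

Section FpsRing.
Variable A : comNzRingType.
Implicit Types f g h : fps A.

Definition fps_mul f g : fps A := fun n => \sum_(i < n.+1) f i * g (n - i)%N.
Definition fps_one : fps A := fun n => (n == 0%N)%:R.

Fact fps_mulC : commutative fps_mul.
Proof.
move=> f g; apply: fpsP => n; rewrite /fps_mul (reindex_inj rev_ord_inj) /=.
by apply: eq_bigr => i _; rewrite mulrC subSS subKn // -ltnS.
Qed.

(** A coefficient of a product only sees truncations, so the ring laws are inherited from
    polynomials. *)
Lemma fps_mul_poly f g n N : (n < N)%N ->
  fps_mul f g n = ((\poly_(i < N) f i) * (\poly_(i < N) g i))`_n.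
Proof.
move=> ltnN; rewrite coefM; apply: eq_bigr => i _.
have lei : (i <= n)%N by rewrite -ltnS.
by rewrite !coef_poly (leq_ltn_trans lei ltnN) (leq_ltn_trans (leq_subr i n) ltnN).
Qed.

Lemma coefM_eq (p p' q : {poly A}) N n : (n < N)%N ->
  (forall i, (i < N)%N -> p`_i = p'`_i) -> (p * q)`_n = (p' * q)`_n.
Proof.
move=> ltnN e; rewrite !coefM; apply: eq_bigr => i _; rewrite e //.
by apply: leq_ltn_trans ltnN; rewrite -ltnS.
Qed.

Fact fps_mulA : associative fps_mul.
Proof.
move=> f g h; apply: fpsP => n.
rewrite (@fps_mul_poly f _ n n.+1) // (@fps_mul_poly _ h n n.+1) //.
pose P f := \poly_(i < n.+1) f i : {poly A}.
rewrite (@coefM_eq (P (fps_mul f g)) (P f * P g) (P h) n.+1) //; last first.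
  by move=> i lti; rewrite coef_poly lti -fps_mul_poly.
rewrite mulrC (@coefM_eq (P (fps_mul g h)) (P g * P h) (P f) n.+1) //; last first.
  by move=> i lti; rewrite coef_poly lti -fps_mul_poly.
by rewrite mulrC mulrA.
Qed.

Fact fps_mul1 : left_id fps_one fps_mul.
Proof.
move=> f; apply: fpsP => n; rewrite /fps_mul big_ord_recl /= mul1r subn0.
by rewrite big1 ?addr0 // => i _; rewrite mul0r.
Qed.
Fact fps_mulDl : left_distributive fps_mul +%R.
Proof.
move=> f g h; apply: fpsP => n; rewrite fpsD /fps_mul -big_split /=.
by apply: eq_bigr => i _; rewrite mulrDl.
Qed.
Fact fps_one_neq0 : fps_one != 0.
Proof. by apply/eqP => /(congr1 (fun f => f 0%N)) /eqP; rewrite /fps_one oner_eq0. Qed.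
HB.instance Definition _ := GRing.Zmodule_isComNzRing.Build (fps A)
  fps_mulA fps_mulC fps_mul1 fps_mulDl fps_one_neq0.

Lemma fpsM f g n : (f * g) n = \sum_(i < n.+1) f i * g (n - i)%N.
Proof. by []. Qed.
Lemma fps1 n : (1 : fps A) n = (n == 0%N)%:R. Proof. by []. Qed.
Lemma fpsM0 f g : (f * g) 0%N = f 0%N * g 0%N.
Proof. by rewrite fpsM big_ord1. Qed.
End FpsRing.

Section FpsUnit.
Variable A : comUnitRingType.
Implicit Types f g h : fps A.

Lemma fps_inv_exists f : f 0%N \is a GRing.unit -> exists g, g * f = 1.
Proof.
move=> uf.
have [|g gE] := @fps_fixpoint A 0 (fun g n =>
   (f 0%N)^-1 * ((n == 0%N)%:R - \sum_(i < n) f i.+1 * g (n - i.+1)%N)).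
  move=> n g h e; congr (_ * (_ - _)); apply: eq_bigr => i _; rewrite e //.
  by case: n i {e} => [[]//|n] i; rewrite subSS ltnS leq_subr.
exists g; rewrite mulrC; apply: fpsP => n; rewrite fpsM big_ord_recl /= subn0 {1}gE.
by rewrite mulrA divrr // mul1r fps1 subrK.
Qed.

Definition fps_unit : {pred fps A} := fun f => f 0%N \is a GRing.unit.
(** The inverse is selected by classical choice; on non-units it is the identity, as the unit ring
    structure demands. *)
Definition fps_inv f : fps A :=
  match pselect (exists g, g * f = 1) with
  | left e => sval (cid e) | right _ => f end.

Fact fps_mulVr : {in fps_unit, left_inverse 1 fps_inv *%R}.
Proof.
move=> f uf; rewrite /fps_inv; case: pselect => [e|[]]; last exact: fps_inv_exists.
exact: svalP (cid e).
Qed.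
Fact fps_unitPl f g : g * f = 1 -> fps_unit f.
Proof.
move=> /(congr1 (fun h => h 0%N)); rewrite fpsM0 fps1 /= => e.
by apply/unitrPr; exists (g 0%N); rewrite mulrC.
Qed.
Fact fps_invr_out : {in [predC fps_unit], fps_inv =1 id}.
Proof.
move=> f; rewrite inE /fps_inv => nuf; case: pselect => // e.
by case/negP: nuf; case: e => g /fps_unitPl.
Qed.
HB.instance Definition _ := GRing.ComNzRing_hasMulInverse.Build (fps A)
  fps_mulVr fps_unitPl fps_invr_out.

Lemma fps_unitE f : (f \is a GRing.unit) = (f 0%N \is a GRing.unit).
Proof. by []. Qed.
End FpsUnit.

Section FpsDomain.
Variable A : idomainType.
Implicit Types f g h : fps A.

Lemma fps_neq0P f : f != 0 -> exists n, f n != 0 /\ forall i, (i < n)%N -> f i = 0.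
Proof.
move=> f0; have ex : exists n, f n != 0.
  apply: contrapT => /forallNP e; move/eqP: f0; apply; apply: fpsP => n.
  by apply/eqP; apply: contrapT => /negP; apply: e.
case: (ex_minnP ex) => n fn mn; exists n; split=> // i lti; apply/eqP/negPn/negP => /mn.
by rewrite leqNgt lti.
Qed.

Fact fps_integral : GRing.integral_domain_axiom (fps A).
Proof.
move=> f g /eqP; apply: contraTT; rewrite negb_or => /andP[/fps_neq0P[n [fn f0]] /fps_neq0P[m [gm g0]]].
apply/eqP => /(congr1 (fun h => h (n + m)%N)); rewrite fps0 fpsM => /eqP.
have ltn : (n < (n + m).+1)%N by rewrite ltnS leq_addr.
rewrite (bigD1 (Ordinal ltn)) //= addKn big1 ?addr0; first by rewrite mulf_eq0 (negPf fn) (negPf gm).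
move=> i; rewrite -val_eqE /= neq_ltn => /orP[/f0 ->|lt]; first by rewrite mul0r.
by rewrite g0 ?mulr0 //; have := ltn_ord i; lia.
Qed.
HB.instance Definition _ := GRing.ComUnitRing_isIntegral.Build (fps A) fps_integral.
End FpsDomain.

Section FpsBasics.
Variable A : comNzRingType.
Implicit Types f g h : fps A.

Definition fpsC (c : A) : fps A := fun n => if n is 0 then c else 0.
Definition fpsX : fps A := fun n => (n == 1%N)%:R.

Fact fpsC_is_zmod_morphism : zmod_morphism fpsC.
Proof. by move=> a b; apply: fpsP => -[|n] //; rewrite fpsB subr0. Qed.
Fact fpsC_is_monoid_morphism : monoid_morphism fpsC.
Proof.
split; first by apply: fpsP => -[].
move=> a b; apply: fpsP => n; rewrite fpsM big_ord_recl subn0 big1 ?addr0; last first.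
  by move=> i _; rewrite mul0r.
by case: n => //= n; rewrite mulr0.
Qed.
HB.instance Definition _ := GRing.isZmodMorphism.Build A (fps A) fpsC fpsC_is_zmod_morphism.
HB.instance Definition _ := GRing.isMonoidMorphism.Build A (fps A) fpsC fpsC_is_monoid_morphism.

Lemma fpsCM c f n : (fpsC c * f) n = c * f n.
Proof. by rewrite fpsM big_ord_recl subn0 big1 ?addr0 // => i _; rewrite mul0r. Qed.

Lemma fpsXM f n : (fpsX * f) n = if n is m.+1 then f m else 0.
Proof.
case: n => [|n]; first by rewrite fpsM0 mul0r.
rewrite fpsM big_ord_recl mul0r add0r big_ord_recl /= mul1r big1 ?addr0 //=.
  by rewrite /bump /= subSS subn0.
by move=> i _; rewrite mul0r.
Qed.

Lemma fpsXnM k f n : (fpsX ^+ k * f) n = if (n < k)%N then 0 else f (n - k)%N.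
Proof.
elim: k n => [|k IH] n; first by rewrite mul1r subn0.
by rewrite exprS -mulrA fpsXM; case: n => // n; rewrite IH ltnS subSS.
Qed.

Definition fps_deriv f : fps A := fun n => f n.+1 *+ n.+1.

Lemma fps_derivD f g : fps_deriv (f + g) = fps_deriv f + fps_deriv g.
Proof. by apply: fpsP => n; rewrite /fps_deriv !fpsD mulrnDl. Qed.

Lemma fps_derivM f g : fps_deriv (f * g) = fps_deriv f * g + f * fps_deriv g.
Proof.
apply: fpsP => n; rewrite fpsD {1}/fps_deriv.
pose P (f : fps A) := \poly_(i < n.+2) f i.
have dP h i : (i < n.+1)%N -> (P h)^`()`_i = fps_deriv h i.
  by move=> lti; rewrite coef_deriv coef_poly ltnS lti.
rewrite -[(f * g) _]/(fps_mul f g _) (@fps_mul_poly _ f g _ n.+2) // -/(P f) -/(P g) -coef_deriv derivM coefD !coefM !fpsM.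
have P0 (h : fps A) i : (i < n.+2)%N -> (P h)`_i = h i by move=> lti; rewrite coef_poly lti.
by congr (_ + _); apply: eq_bigr => i _; have lti := ltn_ord i; rewrite dP ?P0 //; lia.
Qed.

End FpsBasics.

Notation series2 K := (fps (fps K)).

(** * Formal series in two variables *)

Section Germ.
Variable K : comNzRingType.
Implicit Types f g h : series2 K.

Lemma germP f g : (forall i j, f i j = g i j) -> f = g.
Proof. by move=> e; apply: fpsP => i; apply: fpsP => j. Qed.

Lemma germM f g i j :
  (f * g) i j = \sum_(a < i.+1) \sum_(b < j.+1) f a b * g (i - a)%N (j - b)%N.
Proof. by rewrite fpsM fps_sum; apply: eq_bigr => a _; rewrite fpsM. Qed.

Lemma germD f g i j : (f + g) i j = f i j + g i j. Proof. by []. Qed.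
Lemma germN f i j : (- f) i j = - f i j. Proof. by []. Qed.
Lemma germB f g i j : (f - g) i j = f i j - g i j. Proof. by []. Qed.

Definition gC (c : K) : series2 K := fpsC (fpsC c).
Definition gX : series2 K := fpsX _.
Definition gY : series2 K := fpsC (fpsX _).
HB.instance Definition _ := GRing.RMorphism.copy gC (@fpsC (fps K) \o @fpsC K).

Lemma gCE c i j : gC c i j = if (i == 0%N) && (j == 0%N) then c else 0.
Proof. by rewrite /gC; case: i => [|i]; case: j. Qed.
Lemma gCM c f i j : (gC c * f) i j = c * f i j.
Proof. by rewrite /gC fpsCM fpsCM. Qed.
Lemma gXE i j : gX i j = ((i == 1%N) && (j == 0%N))%:R.
Proof. by rewrite /gX /fpsX; case: i => [|[|i]] //=; case: j. Qed.
Lemma gYE i j : gY i j = ((i == 0%N) && (j == 1%N))%:R.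
Proof. by rewrite /gY /fpsX; case: i => [|i] //=. Qed.

Lemma gXnM k f i j : (gX ^+ k * f) i j = if (i < k)%N then 0 else f (i - k)%N j.
Proof. by rewrite fpsXnM; case: ifP. Qed.
Lemma gYnM k f i j : (gY ^+ k * f) i j = if (j < k)%N then 0 else f i (j - k)%N.
Proof. by rewrite -rmorphXn fpsCM fpsXnM. Qed.
Lemma gXM f i j : (gX * f) i j = if i is k.+1 then f k j else 0.
Proof. by rewrite fpsXM; case: i. Qed.
Lemma gYM f i j : (gY * f) i j = if j is k.+1 then f i k else 0.
Proof. by rewrite fpsCM fpsXM; case: j. Qed.

Lemma germ1E i j : (1 : series2 K) i j = ((i == 0%N) && (j == 0%N))%:R.
Proof. by case: i => [|i]; [rewrite -[LHS]/((1 : fps K) j) fps1|]. Qed.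

Definition shx k f : series2 K := fun i j => f (i + k)%N j.
Definition shy k f : series2 K := fun i j => f i (j + k)%N.

Lemma shxK k f : (forall i j, (i < k)%N -> f i j = 0) -> gX ^+ k * shx k f = f.
Proof.
move=> f0; apply: germP => i j; rewrite gXnM /shx.
by case: ltnP => [/f0 //|/subnK ->].
Qed.
Lemma shyK k f : (forall i j, (j < k)%N -> f i j = 0) -> gY ^+ k * shy k f = f.
Proof.
move=> f0; apply: germP => i j; rewrite gYnM /shy.
by case: ltnP => [/f0 //|/subnK ->].
Qed.

Definition dx f : series2 K := fps_deriv f.
Definition dy f : series2 K := fun i => fps_deriv (f i).

Lemma dxE f i j : dx f i j = f i.+1 j *+ i.+1.
Proof. by rewrite /dx /fps_deriv fpsMn. Qed.
Lemma dyE f i j : dy f i j = f i j.+1 *+ j.+1. Proof. by []. Qed.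
Lemma dxD f g : dx (f + g) = dx f + dx g. Proof. exact: fps_derivD. Qed.
Lemma dyD f g : dy (f + g) = dy f + dy g.
Proof. by apply: fpsP => i; apply: fps_derivD. Qed.
Lemma dxM f g : dx (f * g) = dx f * g + f * dx g. Proof. exact: fps_derivM. Qed.
Lemma dyM f g : dy (f * g) = dy f * g + f * dy g.
Proof.
apply: fpsP => i; rewrite fpsD !fpsM -big_split /= {1}/dy fpsM.
rewrite (big_morph _ (@fps_derivD K) (_ : fps_deriv 0 = 0)).
  by apply: eq_bigr => a _; rewrite fps_derivM.
by apply: fpsP => j; rewrite /fps_deriv fps0 mul0rn.
Qed.

Lemma dxC c : dx (gC c) = 0.
Proof. by apply: germP => i j; rewrite dxE gCE /= mul0rn. Qed.
Lemma dyC c : dy (gC c) = 0.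
Proof. by apply: germP => i j; rewrite dyE gCE /= andbF mul0rn. Qed.
Lemma dxX : dx gX = 1.
Proof.
by apply: germP => i j; rewrite dxE gXE !fps1; case: i => [|i] /=; rewrite ?mul0rn //; case: j.
Qed.
Lemma dyX : dy gX = 0.
Proof. by apply: germP => i j; rewrite dyE gXE andbF mul0rn. Qed.
Lemma dxY : dx gY = 0.
Proof. by apply: germP => i j; rewrite dxE gYE mul0rn. Qed.
Lemma dyY : dy gY = 1.
Proof.
by apply: germP => i j; rewrite dyE gYE !fps1; case: i => [|i] /=; rewrite ?mul0rn //; case: j => [|j]; rewrite ?mul0rn.
Qed.

(** Weighted order of vanishing. Weights 1, 1 give the order at the origin, 1, 0 and 0, 1 the order
    along an axis; unbalanced weights provide topologies in which a given operator contracts. *)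
Definition wo (v w n : nat) f := forall i j, (v * i + w * j < n)%N -> f i j = 0.
Notation ordge := (wo 1 1).

Lemma ordgeP n f : ordge n f <-> forall i j, (i + j < n)%N -> f i j = 0.
Proof. by split=> h i j; have := h i j; rewrite !mul1n. Qed.

Section Weights.
Variables v w : nat.
Lemma wo0 n : wo v w n 0. Proof. by []. Qed.
Lemma wo_0 f : wo v w 0%N f. Proof. by []. Qed.
Lemma woW m n f : (m <= n)%N -> wo v w n f -> wo v w m f.
Proof. by move=> lemn of_ i j lt; apply: of_; apply: leq_trans lemn. Qed.
Lemma woD n f g : wo v w n f -> wo v w n g -> wo v w n (f + g).
Proof. by move=> hf hg i j lt; rewrite !fpsD hf // hg // addr0. Qed.
Lemma woN n f : wo v w n f -> wo v w n (- f).
Proof. by move=> hf i j lt; rewrite !fpsN hf // oppr0. Qed.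
Lemma woB n f g : wo v w n f -> wo v w n g -> wo v w n (f - g).
Proof. by move=> hf hg; apply: woD => //; apply: woN. Qed.
Lemma wo_sum n (I : Type) (s : seq I) (P : pred I) (F : I -> series2 K) :
  (forall i, P i -> wo v w n (F i)) -> wo v w n (\sum_(i <- s | P i) F i).
Proof. by move=> hF; elim/big_rec: _ => // i x Pi hx; apply: woD => //; apply: hF. Qed.
Lemma woM m n f g : wo v w m f -> wo v w n g -> wo v w (m + n) (f * g).
Proof.
move=> hf hg i j lt; rewrite germM big1 // => a _; rewrite big1 // => b _.
case: (ltnP (v * a + w * b) m) => [/hf ->|le]; first by rewrite mul0r.
rewrite hg ?mulr0 // !mulnBr.
have lea : (v * a <= v * i)%N by rewrite leq_mul2l -ltnS ltn_ord orbT.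
have leb : (w * b <= w * j)%N by rewrite leq_mul2l -ltnS ltn_ord orbT.
by lia.
Qed.
Lemma woMl n f g : wo v w n g -> wo v w n (f * g).
Proof. by move=> /(woM (wo_0 f)). Qed.
Lemma woMr n f g : wo v w n f -> wo v w n (f * g).
Proof. by rewrite mulrC; apply: woMl. Qed.
Lemma woX n k f : wo v w n f -> wo v w (n * k) (f ^+ k).
Proof.
move=> hf; elim: k => [|k IH]; first by rewrite muln0.
by rewrite mulnS exprS; apply: woM.
Qed.
Lemma wo_prod_seq (I : eqType) (s : seq I) (e : I -> nat) (F : I -> series2 K) :
  (forall i, i \in s -> wo v w (e i) (F i)) -> wo v w (\sum_(i <- s) e i) (\prod_(i <- s) F i).
Proof.
elim: s => [|x s IH] hF; first by rewrite !big_nil.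
rewrite !big_cons; apply: woM; first by apply: hF; rewrite inE eqxx.
by apply: IH => i si; apply: hF; rewrite inE si orbT.
Qed.
Lemma wo_all f : (forall n, wo v w n f) -> f = 0.
Proof. by move=> hf; apply: germP => i j; rewrite (hf (v * i + w * j).+1). Qed.
End Weights.

Lemma ordge1P f : ordge 1 f <-> f 0%N 0%N = 0.
Proof.
split=> [h|f0]; first by rewrite h.
by move=> i j; rewrite !mul1n ltnS leqn0 addn_eq0 => /andP[/eqP -> /eqP ->].
Qed.
Lemma ordgeX : ordge 1 gX. Proof. by apply/ordge1P; rewrite gXE. Qed.
Lemma ordgeY : ordge 1 gY. Proof. by apply/ordge1P; rewrite gYE. Qed.

Lemma ordge_dx n f : ordge n f -> ordge n.-1 (dx f).
Proof. by move=> hf i j lt; rewrite dxE hf ?mul0rn //; lia. Qed.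
Lemma ordge_dy n f : ordge n f -> ordge n.-1 (dy f).
Proof. by move=> hf i j lt; rewrite dyE hf ?mul0rn //; lia. Qed.

(* The homogeneous part of degree n, dehomogenized at y = 1. *)
Definition ip n f : {poly K} := \poly_(i < n.+1) f i (n - i)%N.

Lemma coef_ip n f i : (ip n f)`_i = if (i <= n)%N then f i (n - i)%N else 0.
Proof. by rewrite coef_poly ltnS. Qed.
Lemma size_ip n f : (size (ip n f) <= n.+1)%N. Proof. exact: size_poly. Qed.
Lemma ipD n f g : ip n (f + g) = ip n f + ip n g.
Proof. by apply/polyP => i; rewrite coefD !coef_ip; case: ifP; rewrite ?addr0. Qed.
Lemma ipN n f : ip n (- f) = - ip n f.
Proof. by apply/polyP => i; rewrite coefN !coef_ip; case: ifP; rewrite ?oppr0. Qed.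
Lemma ipB n f g : ip n (f - g) = ip n f - ip n g.
Proof. by rewrite ipD ipN. Qed.
Lemma ip_sub n f g : ordge n.+1 (f - g) -> ip n f = ip n g.
Proof.
move=> /ordgeP h; apply/polyP => i; rewrite !coef_ip; case: ifP => // lei.
by apply/eqP; rewrite -subr_eq0 -!fpsB h // subnKC.
Qed.
Lemma ip_eq0 n f : ordge n f -> ip n f = 0 -> ordge n.+1 f.
Proof.
move=> /ordgeP h e; apply/ordgeP => i j; rewrite ltnS leq_eqVlt => /orP[/eqP en|/h //].
by move/(congr1 (fun p : {poly K} => p`_i)): e; rewrite coef_ip coef0 -en leq_addr addKn.
Qed.
Lemma ip_ordgeS n f : ordge n.+1 f -> ip n f = 0.
Proof.
move=> h; rewrite (@ip_sub n f 0) ?subr0 //.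
by apply/polyP => i; rewrite coef_ip coef0 if_same.
Qed.
Lemma ipM p q f g : ordge p f -> ordge q g -> ip (p + q) (f * g) = ip p f * ip q g.
Proof.
move=> /ordgeP hf /ordgeP hg; apply/polyP => k; rewrite coefM coef_ip.
case: leqP => [lek|ltk]; last first.
  rewrite big1 // => a _; rewrite !coef_ip; case: leqP => [lea|]; last by rewrite mul0r.
  by case: leqP => [leb|]; rewrite ?mulr0 //; have := ltn_ord a; lia.
rewrite germM; apply: eq_bigr => a _; rewrite !coef_ip; have lta := ltn_ord a.
case: (leqP a p) => [lea|ltpa]; last first.
  rewrite mul0r big1 // => b _; rewrite hg ?mulr0 //; have := ltn_ord b; lia.
case: (leqP (k - a)%N q) => [leb|ltq]; last first.
  rewrite mulr0 big1 // => b _; rewrite hf ?mul0r //; have := ltn_ord b; lia.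
have ltb : (p - a < (p + q - k).+1)%N by lia.
rewrite (bigD1 (Ordinal ltb)) //= big1 ?addr0; last first.
  move=> b; rewrite -val_eqE /= => neb.
  case: (ltnP (a + b) p) => cmp; first by rewrite hf ?mul0r.
  by rewrite hg ?mulr0 //; have := ltn_ord b; lia.
by congr (_ * _); congr (g _ _); lia.
Qed.
Lemma ip_0 f : ip 0%N f = (f 0%N 0%N)%:P.
Proof. by apply/polyP => -[|i]; rewrite coef_ip coefC. Qed.
Lemma ipX p k f : ordge p f -> ip (p * k) (f ^+ k) = ip p f ^+ k.
Proof.
move=> hf; elim: k => [|k IH].
  by rewrite muln0; apply/polyP => -[|i]; rewrite coef_ip coef1 ?fps1.
by rewrite mulnS !exprS ipM ?IH //; apply: woX.
Qed.
Lemma ip_prod_seq (I : eqType) (s : seq I) (e : I -> nat) (F : I -> series2 K) :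
  (forall i, i \in s -> ordge (e i) (F i)) ->
  ip (\sum_(i <- s) e i) (\prod_(i <- s) F i) = \prod_(i <- s) ip (e i) (F i).
Proof.
elim: s => [|x s IH] hF.
  by rewrite !big_nil; apply/polyP => -[|i]; rewrite coef_ip coef1 ?fps1.
have hs i : i \in s -> ordge (e i) (F i) by move=> si; apply: hF; rewrite inE si orbT.
rewrite !big_cons ipM ?IH //; first by apply: hF; rewrite inE eqxx.
exact: wo_prod_seq.
Qed.
Lemma ip_dx n f : ip n (dx f) = (ip n.+1 f)^`().
Proof. by apply/polyP => i; rewrite coef_deriv !coef_ip dxE ltnS subSS; case: ifP; rewrite ?mul0rn. Qed.
End Germ.

Notation ordge := (wo 1 1).
Arguments gX {K}.
Arguments gY {K}.

Section GermDomain.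
Variable K : idomainType.
Implicit Types f g h : series2 K.

Lemma ord_exists f : f != 0 -> exists n, ordge n f /\ ip n f != 0.
Proof.
move=> f0; have ex : exists n, ip n f != 0.
  apply: contrapT => /forallNP e; move/eqP: f0; apply.
  have h n : ordge n f.
    elim: n => [|n IH]; first exact: wo_0.
    by apply: ip_eq0 => //; apply/eqP; apply: contrapT => /negP; apply: e.
  exact: (@wo_all _ 1 1).
case: (ex_minnP ex) => n ne mn; exists n; split => //.
have h m : (m <= n)%N -> ordge m f.
  elim: m => [|m IH] le; first exact: wo_0.
  apply: ip_eq0; first exact/IH/ltnW.
  by apply/eqP; apply: contraT => /mn; rewrite leqNgt le.
exact: h.
Qed.

(** Initial forms over a domain have a nonzero product, so orders add exactly and can be
    subtracted. *)
Lemma ordge_cancel p n f g : ordge p f -> ip p f != 0 -> ordge (p + n) (f * g) -> ordge n g.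
Proof.
move=> hf nf hfg; have [->|/ord_exists[m [hg ng]]] := eqVneq g 0; first exact: wo0.
apply: (woW _ hg); rewrite leqNgt; apply/negP => lt.
have : ip (p + m) (f * g) = 0 by apply: ip_ordgeS; apply: woW hfg; rewrite ltn_add2l.
by move=> e; have := mulf_neq0 nf ng; rewrite -ipM // e eqxx.
Qed.

Lemma ip_neq0 p f : ip p f != 0 -> f != 0.
Proof. by apply: contraNN => /eqP ->; rewrite ip_ordgeS. Qed.
End GermDomain.

(** * Fixed points and weighted norms *)

(** Closedness under coefficientwise limits, through which a norm bound passes from the iterates to
    the fixed point. *)
Definition pointwise_closed (A : Type) (P : series2 A -> Prop) :=
  forall f, (forall N, exists2 g, P g & forall i j, (i < N)%N -> (j < N)%N -> f i j = g i j) -> P f.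

Lemma pointwise_closedI (A : Type) (P Q : series2 A -> Prop) :
  pointwise_closed P -> pointwise_closed Q -> pointwise_closed (fun f => P f /\ Q f).
Proof.
move=> cP cQ f h; split; [apply: cP|apply: cQ] => N; have [g [Pg Qg] e] := h N; by exists g.
Qed.

Lemma pointwise_closed_wo (A : comNzRingType) v w n :
  pointwise_closed (@wo A v w n).
Proof.
move=> f h i j lt; have [g hg e] := h (maxn i j).+1.
by rewrite e ?ltnS ?leq_maxl ?leq_maxr // hg.
Qed.

(* Contraction in a weighted adic topology produces the fixed point coefficient by
   coefficient; the norm is only needed through the closed invariant. *)
Lemma germ_fixpoint (A : comNzRingType) v w (T : series2 A -> series2 A) (P : series2 A -> Prop) :
  (forall n f g, P f -> P g -> wo v w n (f - g) -> wo v w n.+1 (T f - T g)) ->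
  pointwise_closed P -> P 0 -> (forall f, P f -> P (T f)) ->
  exists2 f, P f & f = T f.
Proof.
move=> cT clP P0 PT; pose u n := iter n T 0.
have Pu n : P (u n) by elim: n => //= n /PT.
have st n k : wo v w n (u (n + k)%N - u n).
  elim: n => [|n IH]; first exact: wo_0.
  by rewrite addSn /u !iterS; apply: cT; [apply: Pu|apply: Pu|apply: IH].
have st' m n i j : (v * i + w * j < n)%N -> (n <= m)%N -> u m i j = u n i j.
  by move=> lt le; have := st n (m - n)%N i j lt; rewrite subnKC // !fpsB => e; apply/eqP; rewrite -subr_eq0 e.
pose f : series2 A := fun i j => u (v * i + w * j).+1 i j.
have uf n : wo v w n (u n - f).
  by move=> i j lt; rewrite !fpsB /f (st' n (v * i + w * j).+1) ?subrr.
have Pf : P f.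
  apply: clP => N; exists (u (v * N + w * N).+1) => // i j lti ltj.
  rewrite /f; apply/esym/st' => //; rewrite ltnS; apply: leq_add; rewrite leq_mul2l ltnW ?orbT //.
exists f => //; apply/eqP; rewrite -subr_eq0; apply/eqP; apply: (@wo_all _ v w) => n.
have -> : f - T f = - (u n.+1 - f) + (u n.+1 - T f) by ring.
apply: woD; first by apply: woN; apply: woW (uf _).
apply: (@woW _ _ _ _ n.+1) => //; rewrite /u iterS; apply: cT => //; exact: Pu.
Qed.

(** Stands for the complex numbers with their modulus. Algebraic closedness serves to factor the
    Wronskian; [nrm_nat] yields characteristic zero and the estimates for derivatives. *)
Record absField (R : realFieldType) := AbsField {
  absField_sort :> closedFieldType;
  nrm : absField_sort -> R;
  nrm_ge0 : forall z, 0 <= nrm z;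
  nrm0 : nrm 0 = 0;
  nrmM : forall z w, nrm (z * w) = nrm z * nrm w;
  nrmN : forall z, nrm (- z) = nrm z;
  nrmD : forall z w, nrm (z + w) <= nrm z + nrm w;
  nrm_nat : forall n, nrm n%:R = n%:R }.
Arguments nrm {R K} z : rename.
Arguments nrm_ge0 {R K} z : rename.
Arguments nrm0 {R K} : rename.
Arguments nrmM {R K} z w : rename.
Arguments nrmN {R K} z : rename.
Arguments nrmD {R K} z w : rename.
Arguments nrm_nat {R K} n : rename.

Section Norm.
Variables (R : realFieldType) (K : absField R).
Implicit Types (f g : series2 K) (r M : R).

Lemma natK_neq0 n : n.+1%:R != 0 :> K.
Proof.
by apply/eqP => /(congr1 nrm); rewrite nrm_nat nrm0 => /eqP; rewrite pnatr_eq0.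
Qed.
Lemma nrm1 : nrm (1 : K) = 1. Proof. exact: (nrm_nat 1). Qed.
Lemma nrmV (z : K) : nrm z^-1 = (nrm z)^-1.
Proof.
have [->|z0] := eqVneq z 0; first by rewrite invr0 nrm0 invr0.
have e : nrm z * nrm z^-1 = 1 by rewrite -nrmM divff // nrm1.
have nz : nrm z != 0 by apply/eqP => n0; move/eqP: e; rewrite n0 mul0r eq_sym oner_eq0.
by apply: (mulfI nz); rewrite e divff.
Qed.
Lemma nrm_sum (I : Type) (s : seq I) (P : pred I) (F : I -> K) :
  nrm (\sum_(i <- s | P i) F i) <= \sum_(i <- s | P i) nrm (F i).
Proof.
elim/big_rec2: _ => [|i y x _ le]; first by rewrite nrm0.
by apply: le_trans (nrmD _ _) _; rewrite lerD2l.
Qed.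

Lemma eq_le_of (x y : R) : x = y -> x <= y. Proof. by move->. Qed.

Definition part r1 r2 n f := \sum_(i < n) \sum_(j < n) nrm (f i j) * r1 ^+ i * r2 ^+ j.
(** The weighted l1 norm on the polydisc of radii [r1], [r2] is at most [M], stated through finite
    partial sums. Contrary to coefficientwise estimates, this norm is submultiplicative. *)
Definition bnd r1 r2 M f := forall n, part r1 r2 n f <= M.

Lemma bnd_ge0 r1 r2 M f : bnd r1 r2 M f -> 0 <= M.
Proof. by move/(_ 0%N); rewrite /part big_ord0. Qed.
Lemma bndW r1 r2 M M' f : M <= M' -> bnd r1 r2 M f -> bnd r1 r2 M' f.
Proof. by move=> le h n; apply: le_trans le. Qed.

Lemma pointwise_closed_bnd r1 r2 M : pointwise_closed (fun f : series2 K => bnd r1 r2 M f).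
Proof.
move=> f h n; have [g hg e] := h n; apply: le_trans (hg n).
by apply: ler_sum => i _; apply: ler_sum => j _; rewrite e.
Qed.

Lemma bnd_term r1 r2 s1 s2 M t f g : 0 <= t ->
  (forall i j, nrm (g i j) * r1 ^+ i * r2 ^+ j <= t * (nrm (f i j) * s1 ^+ i * s2 ^+ j)) ->
  bnd s1 s2 M f -> bnd r1 r2 (t * M) g.
Proof.
move=> t0 le h n; apply: le_trans (ler_wpM2l t0 (h n)).
by rewrite /part mulr_sumr; apply: ler_sum => i _; rewrite mulr_sumr; apply: ler_sum => j _.
Qed.

Section Radii.
Variables r1 r2 : R.
Hypotheses (r1_ge0 : 0 <= r1) (r2_ge0 : 0 <= r2).

Lemma term_ge0 (z : K) i j : 0 <= nrm z * r1 ^+ i * r2 ^+ j.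
Proof. by rewrite !mulr_ge0 ?nrm_ge0 ?exprn_ge0. Qed.
Hint Resolve term_ge0 : core.

Lemma bnd0 : bnd r1 r2 0 (0 : series2 K).
Proof. by move=> n; rewrite /part big1 // => i _; rewrite big1 // => j _; rewrite !fps0 nrm0 !mul0r. Qed.
Lemma bndD M N f g : bnd r1 r2 M f -> bnd r1 r2 N g -> bnd r1 r2 (M + N) (f + g).
Proof.
move=> hf hg n; apply: le_trans (lerD (hf n) (hg n)).
rewrite /part -big_split; apply: ler_sum => i _; rewrite -big_split; apply: ler_sum => j _ /=.
by rewrite -!mulrDl !ler_wpM2r ?exprn_ge0 ?nrmD.
Qed.
Lemma bndN M f : bnd r1 r2 M f -> bnd r1 r2 M (- f).
Proof.
move=> hf n; apply: le_trans (hf n); apply: ler_sum => i _; apply: ler_sum => j _.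
by rewrite !fpsN nrmN.
Qed.
Lemma bndB M N f g : bnd r1 r2 M f -> bnd r1 r2 N g -> bnd r1 r2 (M + N) (f - g).
Proof. by move=> hf hg; apply: bndD => //; apply: bndN. Qed.
Lemma bnd_sum (I : Type) (s : seq I) (F : I -> series2 K) (M : I -> R) :
  (forall i, bnd r1 r2 (M i) (F i)) -> bnd r1 r2 (\sum_(i <- s) M i) (\sum_(i <- s) F i).
Proof.
move=> h; elim: s => [|x s IH]; first by rewrite !big_nil; apply: bnd0.
by rewrite !big_cons; apply: bndD.
Qed.

(** The triangle of indices of a Cauchy product lies in the square, so nonnegative partial sums of a
    product are bounded by products of partial sums. *)
Lemma conv_sum_le (H : nat -> nat -> R) n : (forall a c, 0 <= H a c) ->
  \sum_(i < n) \sum_(a < i.+1) H a (i - a)%N <= \sum_(a < n) \sum_(c < n) H a c.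
Proof.
move=> H0.
have -> : \sum_(i < n) \sum_(a < i.+1) H a (i - a)%N
        = \sum_(a < n) \sum_(i < n | (a <= i)%N) H a (i - a)%N.
  rewrite (exchange_big_dep xpredT) //=; apply: eq_bigr => i _.
  by rewrite (big_ord_widen n (fun a => H a (i - a)%N)) //; apply: eq_bigl => a; rewrite ltnS.
apply: ler_sum => a _.
rewrite -(big_mkord (fun i => (a <= i)%N) (fun i => H a (i - a)%N)) -(big_mkord xpredT (fun c => H a c)).
rewrite (big_cat_nat (n := a)) //=; last exact/ltnW.
rewrite big_nat_cond big1 ?add0r; last by move=> i /andP[/andP[_ lt] le]; move: lt; rewrite ltnNge le.
rewrite big_nat_cond (eq_bigl (fun i => (a <= i < n)%N)); last first.
  by move=> i; case: (a <= i)%N; rewrite ?andbF ?andbT.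
rewrite -big_nat -{1}[val a]add0n big_addn.
rewrite [leRHS](big_cat_nat (n := (n - a)%N)) ?leq_subr //=.
rewrite (eq_bigr (fun c => H a c)); last by move=> c _; rewrite addnK.
by rewrite lerDl sumr_ge0.
Qed.

Lemma bndM M N f g : bnd r1 r2 M f -> bnd r1 r2 N g -> bnd r1 r2 (M * N) (f * g).
Proof.
move=> hf hg n; have M0 := bnd_ge0 hf.
pose F (f : series2 K) i j := nrm (f i j) * r1 ^+ i * r2 ^+ j.
have F0 h i j : 0 <= F h i j by exact: term_ge0.
apply: (@le_trans _ _ (part r1 r2 n f * part r1 r2 n g)); last first.
  apply: ler_pM; rewrite ?hf ?hg //; by apply: sumr_ge0 => i _; apply: sumr_ge0.
apply: (@le_trans _ _ (\sum_(i < n) \sum_(a < i.+1) \sum_(j < n) \sum_(b < j.+1)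
    F f a b * F g (i - a)%N (j - b)%N)).
  apply: ler_sum => i _; rewrite exchange_big /=; apply: ler_sum => j _.
  rewrite germM -mulrA.
  apply: le_trans (ler_wpM2r _ (nrm_sum _ _ _)) _; first by rewrite mulr_ge0 ?exprn_ge0.
  rewrite mulr_suml; apply: ler_sum => a _.
  apply: le_trans (ler_wpM2r _ (nrm_sum _ _ _)) _; first by rewrite mulr_ge0 ?exprn_ge0.
  rewrite mulr_suml; apply: ler_sum => b _; rewrite nrmM /F.
  have -> : r1 ^+ i = r1 ^+ a * r1 ^+ (i - a) by rewrite -exprD subnKC // -ltnS.
  have -> : r2 ^+ j = r2 ^+ b * r2 ^+ (j - b) by rewrite -exprD subnKC // -ltnS.
  by apply: eq_le_of; ring.
pose H a c := \sum_(j < n) \sum_(b < j.+1) F f a b * F g c (j - b)%N.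
apply: le_trans (_ : _ <= \sum_(a < n) \sum_(c < n) H a c) _.
  apply: (@conv_sum_le H) => a c; apply: sumr_ge0 => j _; apply: sumr_ge0 => b _; exact: mulr_ge0.
rewrite /part mulr_suml; apply: ler_sum => a _; rewrite mulr_sumr; apply: ler_sum => c _.
apply: le_trans (@conv_sum_le (fun b d => F f a b * F g c d) n _) _.
  by move=> b d; apply: mulr_ge0.
by rewrite mulr_suml; apply: ler_sum => b _; rewrite mulr_sumr.
Qed.

Lemma bndC (c : K) : bnd r1 r2 (nrm c) (gC c).
Proof.
move=> [|n]; first by rewrite /part big_ord0 nrm_ge0.
rewrite /part (eq_bigr (fun i : 'I_n.+1 => if (i == 0 :> nat)%N then nrm c else 0)).
  by rewrite big_ord_recl /= big1 ?addr0.
move=> i _; rewrite big_ord_recl !gCE andbT expr0 mulr1 big1 ?addr0.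
  by case: eqP => [->|_]; rewrite ?expr0 ?mulr1 // nrm0 mul0r.
by move=> j _; rewrite gCE andbF nrm0 !mul0r.
Qed.
Lemma bndXn M k f : bnd r1 r2 M f -> bnd r1 r2 (M ^+ k) (f ^+ k).
Proof.
move=> hf; elim: k => [|k IH]; first by rewrite !expr0 -nrm1 -(rmorph1 (@gC K)); apply: bndC.
by rewrite !exprS; apply: bndM.
Qed.
Lemma bnd_shx M k f : 0 < r1 -> bnd r1 r2 M f -> bnd r1 r2 (M / r1 ^+ k) (shx k f).
Proof.
move=> r1_gt0 hf n; rewrite ler_pdivlMr ?exprn_gt0 //.
apply: le_trans (hf (k + n)%N); rewrite /part big_split_ord /= mulr_suml.
rewrite -[leLHS]add0r lerD //; first by apply: sumr_ge0 => i _; apply: sumr_ge0.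
apply: ler_sum => i _; rewrite mulr_suml (addnC k n) big_split_ord /=.
rewrite -[leLHS]addr0 lerD //; last by apply: sumr_ge0.
by apply: ler_sum => j _; rewrite /shx addnC exprD; apply: eq_le_of; ring.
Qed.
Lemma bnd_shy M k f : 0 < r2 -> bnd r1 r2 M f -> bnd r1 r2 (M / r2 ^+ k) (shy k f).
Proof.
move=> r2_gt0 hf n; rewrite ler_pdivlMr ?exprn_gt0 //.
apply: le_trans (hf (n + k)%N); rewrite /part [leRHS]big_split_ord /= mulr_suml.
rewrite -[leLHS]addr0 lerD //; last by apply: sumr_ge0 => i _; apply: sumr_ge0.
apply: ler_sum => i _; rewrite mulr_suml (addnC n k) big_split_ord /=.
rewrite -[leLHS]add0r lerD //; first by apply: sumr_ge0.
by apply: ler_sum => j _; rewrite /shy addnC exprD; apply: eq_le_of; ring.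
Qed.
Lemma bnd_coef M f i j : bnd r1 r2 M f -> nrm (f i j) * r1 ^+ i * r2 ^+ j <= M.
Proof.
move=> hf; apply: le_trans (hf (i + j).+1); rewrite /part.
have lti : (i < (i + j).+1)%N by rewrite ltnS leq_addr.
have ltj : (j < (i + j).+1)%N by rewrite ltnS leq_addl.
rewrite (bigD1 (Ordinal lti)) //= (bigD1 (Ordinal ltj)) //= -addrA lerDl.
by rewrite addr_ge0 ?sumr_ge0 // => a _; rewrite sumr_ge0.
Qed.
End Radii.

Lemma bnd_radii r1 r2 s1 s2 M f : 0 <= r1 <= s1 -> 0 <= r2 <= s2 ->
  bnd s1 s2 M f -> bnd r1 r2 M f.
Proof.
move=> /andP[r1_0 le1] /andP[r2_0 le2] h; rewrite -[M]mul1r; apply: bnd_term h => // i j.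
rewrite mul1r -!mulrA; apply: ler_wpM2l; first exact: nrm_ge0.
have s1_0 := le_trans r1_0 le1; have s2_0 := le_trans r2_0 le2.
by apply: ler_pM; rewrite ?exprn_ge0 // lerXn2r ?nnegrE.
Qed.

Definition converges f := exists M r, 0 < r /\ forall i j, nrm (f i j) <= M / r ^+ (i + j).

Lemma geom_half_le n : \sum_(i < n) (2^-1 : R) ^+ i <= 2.
Proof.
suff -> : \sum_(i < n) (2^-1 : R) ^+ i = 2 - 2 * 2^-1 ^+ n.
  have h : 0 <= (2^-1 : R) ^+ n by rewrite exprn_ge0 // invr_ge0.
  by lra.
elim: n => [|n IH]; first by rewrite big_ord0 expr0; lra.
by rewrite big_ord_recr /= IH exprS; lra.
Qed.

Lemma convergentP f : converges f <-> exists M r, 0 < r /\ bnd r r M f.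
Proof.
split=> [[M [r [r0 h]]]|[M [r [r0 h]]]].
  have M0 : 0 <= M by have := h 0%N 0%N; rewrite expr0 divr1; apply: le_trans; apply: nrm_ge0.
  (* Halving the radius turns the Cauchy estimates into two geometric series, each of sum at most
     2. *)
  exists (M * (2 * 2)), (r / 2); split; first by rewrite divr_gt0.
  move=> n; apply: (@le_trans _ _ (M * ((\sum_(i < n) (2^-1) ^+ i) * (\sum_(j < n) (2^-1) ^+ j)))).
    rewrite mulr_suml mulr_sumr; apply: ler_sum => i _; rewrite mulr_sumr mulr_sumr.
    apply: ler_sum => j _; rewrite -mulrA -exprD.
    apply: le_trans (ler_wpM2r _ (h i j)) _; first by rewrite exprn_ge0 // divr_ge0 // ltW.
    by rewrite exprMn mulrA divfK ?expf_neq0 ?gt_eqF // -exprD.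
  rewrite ler_wpM2l //; apply: ler_pM; rewrite ?geom_half_le // sumr_ge0 // => i _.
    by rewrite exprn_ge0 // invr_ge0.
  by rewrite exprn_ge0 // invr_ge0.
exists M, r; split=> // i j; rewrite ler_pdivlMr ?exprn_gt0 // exprD mulrA.
by apply: bnd_coef h; apply: ltW.
Qed.

Lemma bnd_convergent r1 r2 M f : 0 < r1 -> 0 < r2 -> bnd r1 r2 M f -> converges f.
Proof.
move=> r1_0 r2_0 h; apply/convergentP; exists M, (Num.min r1 r2); split.
  by rewrite lt_min r1_0.
by apply: bnd_radii h; rewrite ?ge_min ?le_min ?lexx ?orbT ?(ltW r1_0) ?(ltW r2_0).
Qed.

(** A Schwarz lemma: each monomial has degree at least [n], so shrinking the radius from [r] to [s]
    gains [(s / r)^n]. All smallness arguments at the origin come from here. *)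
Lemma bnd_ordge M r n f : 0 < r -> bnd r r M f -> ordge n f ->
  forall s, 0 < s <= r -> bnd s s (M / r ^+ n * s ^+ n) f.
Proof.
move=> r0 h /ordgeP of_ s /andP[s0 le].
rewrite (_ : _ * s ^+ n = (s / r) ^+ n * M); last by rewrite expr_div_n; field; rewrite expf_neq0 ?gt_eqF.
have sr0 : 0 <= s / r by rewrite divr_ge0 // ltW.
apply: bnd_term h => [|i j]; first by rewrite exprn_ge0.
have [lt|le_n] := ltnP (i + j) n; first by rewrite of_ // nrm0 !mul0r mulr0.
rewrite -!mulrA -!exprD mulrCA ler_wpM2l ?nrm_ge0 //.
have -> : s ^+ (i + j) = (s / r) ^+ (i + j) * r ^+ (i + j) by rewrite -exprMn divfK ?gt_eqF.
rewrite ler_wpM2r ?exprn_ge0 ?(ltW r0) //; apply: ler_wiXn2l le_n => //.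
by rewrite ler_pdivrMr // mul1r.
Qed.

(** Only the radius in y shrinks: a series divisible by y is small on a thin polydisc, the domain on
    which Weierstrass division contracts. *)
Lemma bnd_divY M r f : 0 < r -> bnd r r M f -> (forall i, f i 0%N = 0) ->
  forall s, 0 < s <= r -> bnd r s (M / r * s) f.
Proof.
move=> r0 h f0 s /andP[s0 le].
rewrite (_ : _ * s = (s / r) * M); last by field; rewrite gt_eqF.
apply: bnd_term h => [|i [|j]]; first by rewrite divr_ge0 ?ltW.
  by rewrite f0 nrm0 !mul0r mulr0.
rewrite mulrCA; apply: ler_wpM2l; first by rewrite mulr_ge0 ?nrm_ge0 ?exprn_ge0 ?(ltW r0).
have -> : s / r * r ^+ j.+1 = s * r ^+ j by rewrite exprS; field; rewrite gt_eqF.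
rewrite exprS; apply: ler_wpM2l; first exact: ltW.
by rewrite lerXn2r ?nnegrE ?(ltW s0) ?(ltW r0).
Qed.

Lemma small_radius (C e r0 : R) : 0 <= C -> 0 < e -> 0 < r0 ->
  exists2 r, 0 < r <= r0 & C * r <= e.
Proof.
move=> C0 e0 r00; exists (Num.min r0 (e / (C + 1))).
  by rewrite lt_min r00 divr_gt0 ?ge_min ?lexx //; lra.
have le : C * Num.min r0 (e / (C + 1)) <= C * (e / (C + 1)) by rewrite ler_wpM2l // ge_min lexx orbT.
apply: le_trans le _; rewrite mulrA ler_pdivrMr; last by lra.
by rewrite mulrC ler_wpM2l ?(ltW e0) //; lra.
Qed.

Lemma convergentC (c : K) : converges (gC c).
Proof. by apply: (@bnd_convergent 1 1 (nrm c)) => //; apply: bndC. Qed.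
Lemma convergent2 f g : converges f -> converges g ->
  exists M N r, [/\ 0 < r, bnd r r M f & bnd r r N g].
Proof.
move=> /convergentP[M [r [r0 hf]]] /convergentP[N [s [s0 hg]]].
exists M, N, (Num.min r s); split; first by rewrite lt_min r0.
  by apply: bnd_radii hf; rewrite ?ge_min ?le_min ?lexx ?orbT ?(ltW r0) ?(ltW s0).
by apply: bnd_radii hg; rewrite ?ge_min ?le_min ?lexx ?orbT ?(ltW r0) ?(ltW s0).
Qed.
Lemma convergentB f g : converges f -> converges g -> converges (f - g).
Proof.
move=> cf cg; have [M [N [r [r0 hf hg]]]] := convergent2 cf cg.
by apply: (@bnd_convergent r r (M + N)) => //; apply: bndB => //; apply: ltW.
Qed.
Lemma convergentM f g : converges f -> converges g -> converges (f * g).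
Proof.
move=> cf cg; have [M [N [r [r0 hf hg]]]] := convergent2 cf cg.
by apply: (@bnd_convergent r r (M * N)) => //; apply: bndM => //; apply: ltW.
Qed.

(** Neumann series: with [w = 1 - f / f(0)], of norm at most 1/2 on a small polydisc, the inverse
    solves [g = 1 / f(0) + w g]. *)
Lemma convergentV f : f 0%N 0%N != 0 -> converges f -> exists2 g, converges g & f * g = 1.
Proof.
move=> f0 cf; pose c := (f 0%N 0%N)^-1; pose w := 1 - gC c * f.
have cw : converges w.
  by apply: convergentB; [rewrite -(rmorph1 (@gC K)); apply: convergentC|apply: convergentM => //; apply: convergentC].
have ow : ordge 1 w by apply/ordge1P; rewrite /w !fpsB gCM !fps1 /= mulVf // subrr.
have [M [r [r0 hM]]] := (convergentP _).1 cw.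
have hw s : 0 < s <= r -> bnd s s (M / r * s) w.
  by move=> hs; have := bnd_ordge r0 hM ow hs; rewrite !expr1.
have M0 : 0 <= M / r by rewrite divr_ge0 ?(ltW r0) ?(bnd_ge0 hM).
have [s /andP[s0 les] hs] := small_radius M0 (ltac:(lra) : 0 < (2^-1 : R)) r0.
have {}hw := hw s; rewrite s0 les in hw; have {}hw := bndW hs (hw isT).
have [||||g hg gE] := @germ_fixpoint K 1 1 (fun g => gC c + w * g) (fun g => bnd s s (2 * nrm c) g).
- move=> n g h _ _ hgh; rewrite (_ : _ - _ = w * (g - h)); last by ring.
  exact: (woM ow).
- exact: pointwise_closed_bnd.
- apply: bndW (bnd0 _ _); by rewrite mulr_ge0 ?nrm_ge0.
- move=> g hg; apply: bndW (bndD (ltW s0) (ltW s0) (bndC _ _ c) (bndM (ltW s0) (ltW s0) hw hg)).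
  by lra.
exists g; first by apply: bnd_convergent hg.
have e : gC c * f * g = gC c.
  have -> : gC c * f * g = g - w * g by rewrite /w; ring.
  by rewrite {1}gE; ring.
apply: (@mulfI _ (gC c)); last by rewrite mulrA e mulr1.
by apply/eqP => /(congr1 (fun h : series2 K => h 0%N 0%N)); rewrite gCE !fps0 /= => /eqP; rewrite invr_eq0 (negPf f0).
Qed.

End Norm.

(** * Polynomials in two variables and substitution *)

Section Ev.
Variables (K S : comNzRingType) (iota : {rmorphism K -> S}).

Definition ev1 (b : S) (q : {poly K}) : S := (map_poly iota q).[b].
HB.instance Definition _ b := GRing.RMorphism.copy (ev1 b) (horner_eval b \o map_poly iota).
(* The outer variable of {poly {poly K}} is x, the inner one is y. *)
Definition ev (a b : S) (p : {poly {poly K}}) : S := (map_poly (ev1 b) p).[a].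
HB.instance Definition _ a b := GRing.RMorphism.copy (ev a b) (horner_eval a \o map_poly (ev1 b)).

Lemma evB a b p q : ev a b (p - q) = ev a b p - ev a b q. Proof. exact: rmorphB. Qed.
Lemma evM a b p q : ev a b (p * q) = ev a b p * ev a b q. Proof. exact: rmorphM. Qed.
Lemma ev1X b : ev1 b 'X = b. Proof. by rewrite /ev1 map_polyX hornerX. Qed.
Lemma ev1C b c : ev1 b c%:P = iota c. Proof. by rewrite /ev1 map_polyC hornerC. Qed.
Lemma evX a b : ev a b 'X = a. Proof. by rewrite /ev map_polyX hornerX. Qed.
Lemma evC a b c : ev a b c%:P = ev1 b c. Proof. by rewrite /ev map_polyC hornerC. Qed.

Lemma ev1_sum b (q : {poly K}) n : (size q <= n)%N -> ev1 b q = \sum_(j < n) iota q`_j * b ^+ j.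
Proof.
move=> le; rewrite /ev1 (@horner_coef_wide _ n); last exact: leq_trans (size_poly _ _) le.
by apply: eq_bigr => j _; rewrite coef_map.
Qed.
Lemma ev_sum a b (p : {poly {poly K}}) n : (size p <= n)%N -> (forall i, (size (p`_i)%R <= n)%N) ->
  ev a b p = \sum_(i < n) \sum_(j < n) iota p`_i`_j * (a ^+ i * b ^+ j).
Proof.
move=> le le'; rewrite /ev (@horner_coef_wide _ n); last exact: leq_trans (size_poly _ _) le.
apply: eq_bigr => i _; rewrite coef_map /= (@ev1_sum _ _ n) // mulr_suml.
by apply: eq_bigr => j _; rewrite -mulrA (mulrC (b ^+ j)).
Qed.

Lemma poly2_ind (P : {poly {poly K}} -> Prop) :
  (forall c, P c%:P%:P) -> P 'X -> P 'X%:P ->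
  (forall p q, P p -> P q -> P (p + q)) -> (forall p q, P p -> P q -> P (p * q)) ->
  forall p, P p.
Proof.
move=> PC PX PY PD PM; elim/poly_ind => [|p c Pp]; first exact: (PC 0).
apply: (PD _ _); first exact: PM.
elim/poly_ind: c => [|c d Pc]; first exact: (PC 0).
by rewrite polyCD polyCM; apply: (PD _ _) => //; apply: PM.
Qed.

(** The chain rule for polynomials, for an abstract derivation [D] killing constants; it serves both
    partial derivatives, on formal series and on convergent germs. *)
Lemma ev_deriv (D : S -> S) a b (p : {poly {poly K}}) :
  {morph D : x y / x + y} -> (forall x y, D (x * y) = D x * y + x * D y) ->
  (forall c, D (iota c) = 0) ->
  D (ev a b p) = ev a b p^`() * D a + ev a b (map_poly (@deriv K) p) * D b.
Proof.
move=> DD DM DC; elim/poly2_ind: p => [c|||p q IHp IHq|p q IHp IHq].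
- by rewrite derivC map_polyC /= derivC polyC0 !rmorph0 evC ev1C DC !mul0r addr0.
- rewrite derivX rmorph1 evX.
  have -> : map_poly (@deriv K) 'X = 0.
    apply/polyP => i; rewrite coef_map_id0 ?deriv0 // coefX coef0.
    by case: (i == 1%N); rewrite ?derivC ?deriv0 // -polyC1 derivC.
  by rewrite rmorph0 mul1r mul0r addr0.
- by rewrite derivC map_polyC /= derivX evC ev1X rmorph0 rmorph1 mul0r mul1r add0r.
- rewrite rmorphD DD IHp IHq derivD rmorphD /=.
  have -> : map_poly (@deriv K) (p + q) = map_poly (@deriv K) p + map_poly (@deriv K) q.
    by apply/polyP => i; rewrite coefD !coef_map_id0 ?deriv0 // coefD derivD.
  by rewrite rmorphD /=; ring.
- rewrite rmorphM DM IHp IHq derivM.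
  have -> : map_poly (@deriv K) (p * q) =
     map_poly (@deriv K) p * q + p * map_poly (@deriv K) q.
    apply/polyP => i; rewrite coefD !coef_map_id0 ?deriv0 // !coefM (raddf_sum (@deriv K)) -big_split /=.
    by apply: eq_bigr => k _; rewrite derivM !coef_map_id0 ?deriv0.
  by rewrite !rmorphD !rmorphM /=; ring.
Qed.

Lemma ev_comp (S' : comNzRingType) (h : {rmorphism S -> S'}) (jota : {rmorphism K -> S'}) a b p :
  (forall c, h (iota c) = jota c) ->
  h (ev a b p) = (map_poly (fun q => (map_poly jota q).[h b]) p).[h a].
Proof.
move=> e; rewrite /ev -horner_map /= -map_poly_comp /=; congr (_.[_]).
apply: eq_map_poly => q /=; rewrite /ev1 -horner_map /= -map_poly_comp /=.
by congr (_.[_]); apply: eq_map_poly => c /=.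
Qed.
End Ev.

(** * Substitution of series into series *)

Section EvGerm.
Variable K : comNzRingType.
Implicit Types (f g p q a b : series2 K) (P Q : {poly {poly K}}).
Notation evG := (ev (@gC K)).

Definition toG P : series2 K := fun i j => P`_i`_j.
Definition trunc n f : {poly {poly K}} := \poly_(i < n) \poly_(j < n) f i j.

Lemma toG_trunc n f i j : toG (trunc n f) i j = if (i < n)%N && (j < n)%N then f i j else 0.
Proof. by rewrite /toG !coef_poly; case: ifP => //=; rewrite ?coef_poly ?coef0. Qed.

Lemma toGD P Q : toG (P + Q) = toG P + toG Q.
Proof. by apply: germP => i j; rewrite /toG !fpsD !coefD. Qed.
Lemma toGN P : toG (- P) = - toG P.
Proof. by apply: germP => i j; rewrite /toG !fpsN !coefN. Qed.
Lemma toGM P Q : toG (P * Q) = toG P * toG Q.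
Proof.
apply: germP => i j; rewrite germM /toG coefM coef_sum.
by apply: eq_bigr => a _; rewrite coefM.
Qed.
Lemma toGE P : toG P = evG gX gY P.
Proof.
elim/poly2_ind: P => [c|||P Q IHP IHQ|P Q IHP IHQ].
- rewrite evC ev1C /=; apply: germP => i j; rewrite /toG gCE coefC.
  by case: i => [|i] /=; rewrite ?coef0 // coefC; case: j.
- rewrite evX; apply: germP => i j; rewrite /toG gXE coefX.
  by case: (i == 1%N); rewrite ?coef0 // coef1.
- rewrite evC ev1X; apply: germP => i j; rewrite /toG gYE coefC.
  by case: (i == 0%N); rewrite ?coef0 // coefX.
- by rewrite rmorphD toGD IHP IHQ.
- by rewrite rmorphM toGM IHP IHQ.
Qed.
Lemma toG_dx P : toG P^`() = dx (toG P).
Proof. by apply: germP => i j; rewrite /toG dxE coef_deriv coefMn. Qed.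
Lemma toG_dy P : toG (map_poly (@deriv K) P) = dy (toG P).
Proof. by apply: germP => i j; rewrite /toG dyE coef_map_id0 ?deriv0 // coef_deriv. Qed.

Lemma ev_wo v w v' w' n a b P : wo v w v' a -> wo v w w' b -> wo v' w' n (toG P) ->
  wo v w n (evG a b P).
Proof.
move=> ha hb hP.
pose m := (size P + \sum_(i < size P) size (P`_i)%R)%N.
have le i : (size (P`_i)%R <= m)%N.
  have [lt|ge] := ltnP i (size P); last by rewrite nth_default // size_poly0.
  by rewrite /m (bigD1 (Ordinal lt)) //= addnCA leq_addr.
rewrite (@ev_sum _ _ _ _ _ _ m) ?leq_addr //; apply: wo_sum => i _; apply: wo_sum => j _.
have [lt|ge] := ltnP (v' * i + w' * j) n; first by have := hP _ _ lt; rewrite /toG => ->; rewrite rmorph0 mul0r.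
by apply: woMl; apply: woW ge _; apply: woM; apply: woX.
Qed.
Lemma ev_congr v w n a b a' b' P : wo v w n (a - a') -> wo v w n (b - b') ->
  wo v w n (evG a b P - evG a' b' P).
Proof.
move=> ha hb; elim/poly2_ind: P => [c|||P Q IHP IHQ|P Q IHP IHQ].
- by rewrite !evC !ev1C subrr.
- by rewrite !evX.
- by rewrite !evC !ev1X.
- by rewrite !rmorphD opprD addrACA; apply: woD.
- rewrite !rmorphM (_ : _ - _ = (evG a b P - evG a' b' P) * evG a b Q
     + evG a' b' P * (evG a b Q - evG a' b' Q)); last by ring.
  by apply: woD; [apply: woMr|apply: woMl].
Qed.

Definition cut f : series2 K := f - gC (f 0%N 0%N).
Lemma cut_ord f : ordge 1 (cut f).
Proof. by apply/ordge1P; rewrite /cut !fpsB gCE /= subrr. Qed.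
Lemma cutE f : f 0%N 0%N = 0 -> cut f = f.
Proof. by rewrite /cut => ->; rewrite rmorph0 subr0. Qed.
Lemma cut_dx f : dx (cut f) = dx f.
Proof. by rewrite /cut -rmorphN dxD dxC addr0. Qed.
Lemma cut_dy f : dy (cut f) = dy f.
Proof. by rewrite /cut -rmorphN dyD dyC addr0. Qed.
Lemma cut_wo v w n f g : wo v w n (f - g) -> wo v w n (cut f - cut g).
Proof.
move=> h; rewrite /cut (_ : _ - _ = (f - g) - gC ((f - g) 0%N 0%N)); last first.
  by rewrite !fpsB rmorphB; ring.
apply: woB => // i j lt; rewrite gCE; case: eqP => // ei; case: eqP => //= ej.
by apply: h; rewrite !muln0; apply: leq_ltn_trans lt.
Qed.

(* The constant terms of the substituted series are discarded, so that substitution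
   is a total ring morphism. *)
Definition gcomp p q f : series2 K :=
  fun i j => evG (cut p) (cut q) (trunc (i + j).+1 f) i j.

(** The substituted series vanish at the origin, so terms of order [n] stay of order [n] and
    substitution agrees with a polynomial evaluation up to order [n]. The laws of substitution
    follow from those of evaluation by letting [n] grow. *)
Lemma comp_ev p q f n P : ordge n (f - toG P) -> ordge n (gcomp p q f - evG (cut p) (cut q) P).
Proof.
move=> h i j; rewrite !mul1n => lt.
pose E := evG (cut p) (cut q); pose Q := trunc (i + j).+1 f.
have -> : (gcomp p q f - E P) i j = (E Q - E P) i j by [].
rewrite /E -evB /Q.
apply: (@ev_wo 1 1 1 1 (i + j).+1); rewrite ?mul1n //; try exact: cut_ord.
move=> k l; rewrite !mul1n => lt'; rewrite toGD toGN !fpsB toG_trunc.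
rewrite (leq_ltn_trans (leq_addr _ _) lt') (leq_ltn_trans (leq_addl _ _) lt') /=.
by rewrite -[LHS]/((f - toG P) k l) h // !mul1n; lia.
Qed.
Lemma trunc_ord n f : ordge n (f - toG (trunc n f)).
Proof.
move=> i j; rewrite !mul1n => lt; rewrite !fpsB toG_trunc.
by rewrite (leq_ltn_trans (leq_addr _ _) lt) (leq_ltn_trans (leq_addl _ _) lt) subrr.
Qed.
Lemma comp_trunc p q f n : ordge n (gcomp p q f - evG (cut p) (cut q) (trunc n f)).
Proof. exact/comp_ev/trunc_ord. Qed.
Lemma eq_ordge f g : (forall n, ordge n (f - g)) -> f = g.
Proof. by move=> h; apply/eqP; rewrite -subr_eq0; apply/eqP; apply: (@wo_all _ 1 1). Qed.

Fact comp_is_zmod_morphism p q : zmod_morphism (gcomp p q).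
Proof.
move=> f g; apply: eq_ordge => n; pose E := evG (cut p) (cut q).
have abel (a b c x y : series2 K) : a - (b - c) = (a - (x - y)) - (b - x) + (c - y) by ring.
rewrite (abel _ _ _ (E (trunc n f)) (E (trunc n g))).
apply: woD; [apply: woB|]; try exact: comp_trunc.
rewrite /E -evB; apply: comp_ev; rewrite toGD toGN (_ : _ - _ = (f - toG (trunc n f)) - (g - toG (trunc n g))); last by ring.
by apply: woB; apply: trunc_ord.
Qed.
Fact comp_is_monoid_morphism p q : monoid_morphism (gcomp p q).
Proof.
split=> [|f g]; apply: eq_ordge => n.
  by rewrite -[X in _ - X](rmorph1 (evG (cut p) (cut q))); apply: comp_ev; rewrite toGE rmorph1 subrr.
pose F := evG (cut p) (cut q) (trunc n f); pose G := evG (cut p) (cut q) (trunc n g).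
have abel (a b c x y : series2 K) : a - b * c = (a - x * y) - ((b - x) * c + x * (c - y)) by ring.
rewrite (abel _ _ _ F G).
apply: woB; last by apply: woD; [apply: woMr|apply: woMl]; apply: comp_trunc.
rewrite /F /G -evM; apply: comp_ev; rewrite toGM.
rewrite (_ : _ - _ = (f - toG (trunc n f)) * g + toG (trunc n f) * (g - toG (trunc n g))); last by ring.
by apply: woD; [apply: woMr|apply: woMl]; apply: trunc_ord.
Qed.
HB.instance Definition _ p q :=
  GRing.isZmodMorphism.Build _ _ (gcomp p q) (comp_is_zmod_morphism p q).
HB.instance Definition _ p q :=
  GRing.isMonoidMorphism.Build _ _ (gcomp p q) (comp_is_monoid_morphism p q).

Lemma comp_toG p q P : gcomp p q (toG P) = evG (cut p) (cut q) P.
Proof. by apply: eq_ordge => n; apply: comp_ev; rewrite subrr. Qed.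
Lemma compX p q : gcomp p q gX = cut p.
Proof. by rewrite -[gX](evX (@gC K) gX gY) -toGE comp_toG evX. Qed.
Lemma compY p q : gcomp p q gY = cut q.
Proof. by rewrite -[gY](ev1X (@gC K) gY) -(evC (@gC K) gX) -toGE comp_toG evC ev1X. Qed.
Lemma compC p q c : gcomp p q (gC c) = gC c.
Proof.
have e : gC c = toG c%:P%:P by rewrite toGE evC ev1C.
by rewrite {1}e comp_toG evC ev1C.
Qed.

Lemma comp_wo v w v' w' n p q f : wo v w v' (cut p) -> wo v w w' (cut q) ->
  wo v' w' n f -> wo v w n (gcomp p q f).
Proof.
move=> hp hq hf i j lt; rewrite /gcomp; apply: (@ev_wo v w v' w' n) lt => //.
by move=> k l lt'; rewrite toG_trunc; case: ifP => // _; apply: hf.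
Qed.
Lemma comp_ordge n p q f : ordge n f -> ordge n (gcomp p q f).
Proof. by apply: comp_wo; apply: cut_ord. Qed.
Lemma comp00 p q f : gcomp p q f 0%N 0%N = f 0%N 0%N.
Proof.
have h : ordge 1 (f - toG (f 0%N 0%N)%:P%:P).
  by apply/ordge1P; rewrite -[LHS]/(f 0%N 0%N - (f 0%N 0%N)%:P%:P`_0`_0) !coefC subrr.
have := comp_ev p q h (i := 0%N) (j := 0%N) isT; rewrite evC ev1C => e.
by apply/eqP; rewrite -subr_eq0; apply/eqP.
Qed.

Lemma comp_congr v w n p q p' q' f :
  wo v w n (p - p') -> wo v w n (q - q') -> wo v w n (gcomp p q f - gcomp p' q' f).
Proof.
move=> /cut_wo hp /cut_wo hq i j lt; pose P := trunc (i + j).+1 f.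
rewrite -[LHS]/((evG (cut p) (cut q) P - evG (cut p') (cut q') P) i j).
by apply: (@ev_congr v w n).
Qed.

Lemma comp_dx p q f : dx (gcomp p q f) = gcomp p q (dx f) * dx p + gcomp p q (dy f) * dx q.
Proof.
apply: eq_ordge => n; pose P := trunc n.+1 f; pose E := evG (cut p) (cut q).
have hE : dx (E P) = E P^`() * dx p + E (map_poly (@deriv K) P) * dx q.
  by rewrite -(cut_dx p) -(cut_dx q); apply: ev_deriv; [exact: dxD|exact: dxM|exact: dxC].
have h1 : ordge n (dx (gcomp p q f) - dx (E P)).
  rewrite -[- dx (E P)]mulN1r -[-1](rmorphN1 (@gC K)).
  have -> : gC (-1) * dx (E P) = dx (- E P).
    by rewrite -[- E P]mulN1r -[-1 in RHS](rmorphN1 (@gC K)) dxM dxC mul0r add0r.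
  by rewrite -dxD; apply: (@ordge_dx _ n.+1); apply: comp_trunc.
have h2 : ordge n (gcomp p q (dx f) - E P^`()).
  apply: comp_ev; rewrite toG_dx => i j; rewrite !mul1n => lt; rewrite !fpsB !dxE toG_trunc.
  by rewrite !ifT ?subrr //; lia.
have h3 : ordge n (gcomp p q (dy f) - E (map_poly (@deriv K) P)).
  apply: comp_ev; rewrite toG_dy => i j; rewrite !mul1n => lt; rewrite !fpsB !dyE toG_trunc.
  by rewrite !ifT ?subrr //; lia.
have -> : dx (gcomp p q f) - (gcomp p q (dx f) * dx p + gcomp p q (dy f) * dx q) =
  (dx (gcomp p q f) - dx (E P)) - (gcomp p q (dx f) - E P^`()) * dx p
   - (gcomp p q (dy f) - E (map_poly (@deriv K) P)) * dx q by rewrite hE; ring.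
by apply: woB; [apply: woB => //|]; apply: woMr.
Qed.
Lemma comp_dy p q f : dy (gcomp p q f) = gcomp p q (dx f) * dy p + gcomp p q (dy f) * dy q.
Proof.
apply: eq_ordge => n; pose P := trunc n.+1 f; pose E := evG (cut p) (cut q).
have hE : dy (E P) = E P^`() * dy p + E (map_poly (@deriv K) P) * dy q.
  by rewrite -(cut_dy p) -(cut_dy q); apply: ev_deriv; [exact: dyD|exact: dyM|exact: dyC].
have h1 : ordge n (dy (gcomp p q f) - dy (E P)).
  rewrite -[- dy (E P)]mulN1r -[-1](rmorphN1 (@gC K)).
  have -> : gC (-1) * dy (E P) = dy (- E P).
    by rewrite -[- E P]mulN1r -[-1 in RHS](rmorphN1 (@gC K)) dyM dyC mul0r add0r.
  by rewrite -dyD; apply: (@ordge_dy _ n.+1); apply: comp_trunc.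
have h2 : ordge n (gcomp p q (dx f) - E P^`()).
  apply: comp_ev; rewrite toG_dx => i j; rewrite !mul1n => lt; rewrite !fpsB !dxE toG_trunc.
  by rewrite !ifT ?subrr //; lia.
have h3 : ordge n (gcomp p q (dy f) - E (map_poly (@deriv K) P)).
  apply: comp_ev; rewrite toG_dy => i j; rewrite !mul1n => lt; rewrite !fpsB !dyE toG_trunc.
  by rewrite !ifT ?subrr //; lia.
have -> : dy (gcomp p q f) - (gcomp p q (dx f) * dy p + gcomp p q (dy f) * dy q) =
  (dy (gcomp p q f) - dy (E P)) - (gcomp p q (dx f) - E P^`()) * dy p
   - (gcomp p q (dy f) - E (map_poly (@deriv K) P)) * dy q by rewrite hE; ring.
by apply: woB; [apply: woB => //|]; apply: woMr.
Qed.

Lemma comp_cut p q f : gcomp p q (cut f) = cut (gcomp p q f).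
Proof. by rewrite /cut rmorphB /= compC comp00. Qed.
Lemma comp_assoc p q p' q' f :
  gcomp p' q' (gcomp p q f) = gcomp (gcomp p' q' p) (gcomp p' q' q) f.
Proof.
apply: eq_ordge => n; pose P := trunc n f.
have -> : gcomp p' q' (gcomp p q f) - gcomp (gcomp p' q' p) (gcomp p' q' q) f =
   gcomp p' q' (gcomp p q f - evG (cut p) (cut q) P)
   - (gcomp (gcomp p' q' p) (gcomp p' q' q) f
      - evG (cut (gcomp p' q' p)) (cut (gcomp p' q' q)) P).
  rewrite rmorphB (@ev_comp _ _ _ _ _ (@gC K)); last by move=> c; apply: compC.
  by rewrite /= !comp_cut /ev; ring.
by apply: woB; [apply: comp_ordge|]; apply: comp_trunc.
Qed.

Definition hompoly d (u : {poly K}) : {poly {poly K}} :=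
  \sum_(i < d.+1) (u`_i)%:P%:P * 'X ^+ i * 'X%:P ^+ (d - i).
Lemma hompoly_ord d f : ordge d f -> ordge d.+1 (f - toG (hompoly d (ip d f))).
Proof.
move=> /ordgeP hf; apply/ordgeP => k l lt.
have -> : toG (hompoly d (ip d f)) = \sum_(i < d.+1) gC (f i (d - i)%N) * (gX ^+ i * gY ^+ (d - i)).
  rewrite toGE rmorph_sum /=; apply: eq_bigr => i _.
  by rewrite !evM !rmorphXn /= evX !evC ev1C ev1X coef_ip -ltnS ltn_ord -mulrA.
rewrite germB fps_sum fps_sum.
have E (i : 'I_d.+1) : (gC (f i (d - i)%N) * (gX ^+ i * gY ^+ (d - i))) k l
     = if (i == k :> nat) && (l == d - i)%N then f i (d - i)%N else 0.
  rewrite gCM gXnM -[gY ^+ _]mulr1 gYnM germ1E.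
  case: ltnP => ki; first by rewrite mulr0 gtn_eqF.
  case: ltnP => lj; first by rewrite mulr0 andbC ltn_eqF.
  rewrite !subn_eq0 [(i == k :> nat)]eqn_leq ki [(l == _)]eqn_leq lj !andbT.
  by case: ifP; rewrite ?mulr1 ?mulr0.
rewrite (eq_bigr _ (fun i _ => E i)) {E}; have [lt'|] := ltnP (k + l) d.
  rewrite hf // sub0r big1 ?oppr0 // => i _; case: ifP => // /andP[/eqP ei /eqP el].
  by have := ltn_ord i; lia.
move=> ge; have kd : (k < d.+1)%N by lia.
rewrite (bigD1 (Ordinal kd)) //= eqxx big1 ?addr0; last first.
  by move=> i; rewrite -val_eqE /= => /negPf ->.
have -> : l = (d - k)%N by lia.
by rewrite eqxx subrr.
Qed.
Lemma ev_hompoly_scale d (u : {poly K}) a b : (size u <= d.+1)%N ->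
  evG (a * b) b (hompoly d u) = b ^+ d * ev1 (@gC K) a u.
Proof.
move=> le; rewrite (@ev1_sum _ _ _ _ _ d.+1) // mulr_sumr rmorph_sum /=; apply: eq_bigr => i _.
rewrite !evM !rmorphXn /= evX !evC ev1C ev1X exprMn.
have -> : b ^+ d = b ^+ i * b ^+ (d - i) by rewrite -exprD subnKC // -ltnS.
by ring.
Qed.
End EvGerm.
Notation evG := (ev (gC (K := _))).

(** * The ring of convergent germs *)

Section Convergence.
Variables (R : realFieldType) (K : absField R).
Implicit Types (f g p q : series2 K) (r M : R).

(** The norms of the substituted series become the radii at which the outer series is measured. *)
Lemma comp_bnd r1 r2 P Q M p q f : 0 <= r1 -> 0 <= r2 ->
  bnd r1 r2 P (cut p) -> bnd r1 r2 Q (cut q) -> bnd P Q M f -> bnd r1 r2 M (gcomp p q f).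
Proof.
move=> r1_0 r2_0 hp hq hf n; pose N := (n + n)%N.
have e i j : (i < n)%N -> (j < n)%N -> gcomp p q f i j = evG (cut p) (cut q) (trunc N f) i j.
  move=> lti ltj; have := @comp_trunc _ p q f N i j; rewrite !mul1n => h.
  by apply/eqP; rewrite -subr_eq0; apply/eqP; apply: h; rewrite /N; lia.
rewrite /part; under eq_bigr => i _ do under eq_bigr => j _ do rewrite e //.
apply: (_ : bnd r1 r2 M (evG (cut p) (cut q) (trunc N f))).
rewrite (@ev_sum _ _ _ _ _ _ N) ?size_poly //; last first.
  by move=> i; rewrite coef_poly; case: ifP => _; rewrite ?size_poly ?size_poly0.
apply: bndW (hf N) _.
apply: bnd_sum => // i; apply: bnd_sum => // j; rewrite !coef_poly !ltn_ord /= coef_poly ltn_ord.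
rewrite -mulrA; apply: bndM => //; first exact: bndC.
by apply: bndM => //; apply: bndXn.
Qed.

Lemma convergent_comp p q f : converges p -> converges q -> converges f -> converges (gcomp p q f).
Proof.
move=> cp cq cf; have [M [r [r0 hf]]] := (convergentP _).1 cf.
have [A [B [s [s0 hp hq]]]] := convergent2 (convergentB cp (convergentC (p 0%N 0%N))) (convergentB cq (convergentC (q 0%N 0%N))).
have A0 : 0 <= A / s by rewrite divr_ge0 ?(bnd_ge0 hp) ?(ltW s0).
have B0 : 0 <= B / s by rewrite divr_ge0 ?(bnd_ge0 hq) ?(ltW s0).
have [t /andP[t0 lt] ht] := small_radius (addr_ge0 A0 B0) r0 s0.
have hs : 0 < t <= s by rewrite t0.
have := bnd_ordge s0 hp (cut_ord p) hs; have := bnd_ordge s0 hq (cut_ord q) hs.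
rewrite !expr1 => hq' hp'; apply: (@bnd_convergent _ _ t t M) => //.
have le1 : A / s * t <= r by apply: le_trans ht; rewrite mulrDl lerDl mulr_ge0 ?(ltW t0).
have le2 : B / s * t <= r by apply: le_trans ht; rewrite mulrDl lerDr mulr_ge0 ?(ltW t0).
apply: (comp_bnd (ltW t0) (ltW t0) hp' hq').
by apply: bnd_radii hf; rewrite ?le1 ?le2 mulr_ge0 ?(ltW t0).
Qed.

Lemma natr_le_exp2 n : n.+1%:R <= (2 : R) ^+ n.
Proof. by rewrite -natrX ler_nat ltn_expl. Qed.

Lemma convergent_dx f : converges f -> converges (dx f).
Proof.
move=> [M [r [r0 h]]]; exists (M / r), (r / 2); split=> [|i j]; first by rewrite divr_gt0.
have M0 : 0 <= M by have := h 0%N 0%N; rewrite expr0 divr1; apply: le_trans; apply: nrm_ge0.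
rewrite dxE -[f i.+1 j *+ _]mulr_natr nrmM nrm_nat.
apply: (@le_trans _ _ (M / r ^+ (i.+1 + j) * 2 ^+ (i + j))).
  apply: ler_pM; rewrite ?nrm_ge0 ?ler0n //.
  by apply: le_trans (natr_le_exp2 i) _; rewrite exprD ler_peMr ?exprn_ge0 // exprn_ege1 // ler1n.
rewrite addSn exprS expr_div_n; apply: eq_le_of; field.
by rewrite ?expf_neq0 ?gt_eqF // ?expf_neq0 ?gt_eqF.
Qed.
Lemma convergent_dy f : converges f -> converges (dy f).
Proof.
move=> [M [r [r0 h]]]; exists (M / r), (r / 2); split=> [|i j]; first by rewrite divr_gt0.
have M0 : 0 <= M by have := h 0%N 0%N; rewrite expr0 divr1; apply: le_trans; apply: nrm_ge0.
rewrite dyE -[f i j.+1 *+ _]mulr_natr nrmM nrm_nat.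
apply: (@le_trans _ _ (M / r ^+ (i + j.+1) * 2 ^+ (i + j))).
  apply: ler_pM; rewrite ?nrm_ge0 ?ler0n //.
  by apply: le_trans (natr_le_exp2 j) _; rewrite exprD ler_peMl ?exprn_ge0 // exprn_ege1 // ler1n.
rewrite addnS exprS expr_div_n; apply: eq_le_of; field.
by rewrite ?expf_neq0 ?gt_eqF // ?expf_neq0 ?gt_eqF.
Qed.
Lemma convergent_shx k f : converges f -> converges (shx k f).
Proof.
move=> /convergentP[M [r [r0 h]]]; apply: (@bnd_convergent _ _ r r (M / r ^+ k)) => //.
by apply: bnd_shx => //; apply: ltW.
Qed.
Lemma convergent_shy k f : converges f -> converges (shy k f).
Proof.
move=> /convergentP[M [r [r0 h]]]; apply: (@bnd_convergent _ _ r r (M / r ^+ k)) => //.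
by apply: bnd_shy => //; apply: ltW.
Qed.
Lemma finite_convergent f n : (forall i j, (n <= i)%N || (n <= j)%N -> f i j = 0) -> converges f.
Proof.
move=> h; apply: (@bnd_convergent _ _ 1 1 (\sum_(i < n) \sum_(j < n) nrm (f i j))) => // m.
rewrite /part; under eq_bigr => i _ do under eq_bigr => j _ do rewrite !expr1n !mulr1.
have nn0 i j : 0 <= nrm (f i j) by exact: nrm_ge0.
rewrite -(big_mkord xpredT (fun i => \sum_(j < m) nrm (f i j))) -(big_mkord xpredT (fun i => \sum_(j < n) nrm (f i j))).
have inner i : \sum_(j < m) nrm (f i j) <= \sum_(j < n) nrm (f i j).
  rewrite -!(big_mkord xpredT (fun j => nrm (f i j))); case: (leqP m n) => [le|/ltnW le].
    by rewrite [leRHS](big_cat_nat (n := m)) //= lerDl sumr_ge0.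
  rewrite (big_cat_nat (n := n)) //= [X in _ + X]big_nat_cond [X in _ + X]big1 ?addr0 // => j /andP[/andP[lej _] _].
  by rewrite h ?nrm0 // lej orbT.
apply: (@le_trans _ _ (\sum_(0 <= i < m) \sum_(j < n) nrm (f i j))); first exact: ler_sum.
case: (leqP m n) => [le|/ltnW le].
  by rewrite [leRHS](big_cat_nat (n := m)) //= lerDl sumr_ge0 // => i _; apply: sumr_ge0.
rewrite (big_cat_nat (n := n)) //= [X in _ + X]big_nat_cond [X in _ + X]big1 ?addr0 // => i /andP[/andP[lei _] _].
by rewrite big1 // => j _; rewrite h ?nrm0 // lei.
Qed.

Definition conv_pred : {pred series2 K} := fun f => `[< converges f >].

Fact conv_divring_closed : divring_closed conv_pred.
Proof.
split; first by apply/asboolP; rewrite -(rmorph1 (@gC K)); apply: convergentC.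
  by move=> f g /asboolP cf /asboolP cg; apply/asboolP; apply: convergentB.
move=> f g /asboolP cf /asboolP cg; apply/asboolP; apply: convergentM => //.
have [ug|nug] := boolP (g \is a GRing.unit); last by rewrite invr_out.
have g0 : g 0%N 0%N != 0 by move: ug; rewrite fps_unitE fps_unitE unitfE.
have [h ch gh] := convergentV g0 cg.
by have -> : g^-1 = h by apply: (mulrI ug); rewrite mulrV.
Qed.
HB.instance Definition _ := GRing.isDivringClosed.Build _ conv_pred conv_divring_closed.
End Convergence.

Record cgerm (R : realFieldType) (K : absField R) :=
  CGerm { cgval : series2 K; cgvalP : cgval \in @conv_pred R K }.
Identity Coercion fps_Funclass : fps >-> Funclass.
Coercion cgval : cgerm >-> fps.

Lemma germM00 (A : comNzRingType) (f g : series2 A) : (f * g) 0%N 0%N = f 0%N 0%N * g 0%N 0%N.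
Proof. by rewrite fpsM0 fpsM0. Qed.
Lemma germ1_00 (A : comNzRingType) : (1 : series2 A) 0%N 0%N = 1. Proof. by []. Qed.

Section CGerm.
Variables (R : realFieldType) (K : absField R).
Local Notation O := (cgerm K).

HB.instance Definition _ := [isSub for @cgval R K].
HB.instance Definition _ := [Choice of O by <:].
HB.instance Definition _ := [SubChoice_isSubComNzRing of O by <:].
HB.instance Definition _ := [SubNzRing_isSubUnitRing of O by <:].
HB.instance Definition _ := [SubComUnitRing_isSubIntegralDomain of O by <:].

Lemma cg_conv (f : O) : converges f. Proof. by case: f => f cf /=; apply/asboolP. Qed.
Definition mkO (f : series2 K) (cf : converges f) : O := CGerm (introT (asboolP _) cf).

Lemma cgP (f g : O) : cgval f = cgval g -> f = g. Proof. exact: val_inj. Qed.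
Lemma cgD (f g : O) : (f + g : O) = cgval f + cgval g :> series2 K. Proof. by []. Qed.
Lemma cgN (f : O) : (- f : O) = - cgval f :> series2 K. Proof. by []. Qed.
Lemma cgB (f g : O) : (f - g : O) = cgval f - cgval g :> series2 K. Proof. by []. Qed.
Lemma cgM (f g : O) : (f * g : O) = cgval f * cgval g :> series2 K. Proof. by []. Qed.
Lemma cg0 : (0 : O) = 0 :> series2 K. Proof. by []. Qed.
Lemma cg1 : (1 : O) = 1 :> series2 K. Proof. by []. Qed.
Lemma cgX (f : O) n : (f ^+ n : O) = cgval f ^+ n :> series2 K.
Proof. by elim: n => // n IH; rewrite !exprS cgM IH. Qed.
Lemma cg_sum (I : Type) (s : seq I) (P : pred I) (F : I -> O) :
  (\sum_(i <- s | P i) F i : O) = \sum_(i <- s | P i) cgval (F i) :> series2 K.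
Proof. by elim/big_rec2: _ => // i y1 y2 _ <-. Qed.
Lemma cg_prod (I : Type) (s : seq I) (P : pred I) (F : I -> O) :
  (\prod_(i <- s | P i) F i : O) = \prod_(i <- s | P i) cgval (F i) :> series2 K.
Proof. by elim/big_rec2: _ => // i y1 y2 _ <-. Qed.

Definition oC (c : K) : O := mkO (convergentC c).
Fact oC_is_zmod_morphism : zmod_morphism oC.
Proof. by move=> a b; apply: cgP; rewrite cgB /= rmorphB. Qed.
Fact oC_is_monoid_morphism : monoid_morphism oC.
Proof. by split=> [|a b]; apply: cgP; rewrite ?cgM ?cg1 /= ?rmorph1 ?rmorphM. Qed.
HB.instance Definition _ := GRing.isZmodMorphism.Build K O oC oC_is_zmod_morphism.
HB.instance Definition _ := GRing.isMonoidMorphism.Build K O oC oC_is_monoid_morphism.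

Lemma convergent_X : converges (@gX K).
Proof. by apply: (@finite_convergent _ _ _ 2) => i j; rewrite gXE; case: i => [|[|i]] //; case: j. Qed.
Lemma convergent_Y : converges (@gY K).
Proof. by apply: (@finite_convergent _ _ _ 2) => i j; rewrite gYE; case: i => [|[|i]] //; case: j => [|[|j]]. Qed.
Definition oX : O := mkO convergent_X.
Definition oY : O := mkO convergent_Y.
Definition odx (f : O) : O := mkO (convergent_dx (cg_conv f)).
Definition ody (f : O) : O := mkO (convergent_dy (cg_conv f)).
Definition oshx k (f : O) : O := mkO (convergent_shx k (cg_conv f)).
Definition oshy k (f : O) : O := mkO (convergent_shy k (cg_conv f)).
Definition ocmp (p q f : O) : O := mkO (convergent_comp (cg_conv p) (cg_conv q) (cg_conv f)).

Fact ocmp_is_zmod_morphism p q : zmod_morphism (ocmp p q).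
Proof. by move=> f g; apply: cgP; rewrite cgB /= rmorphB. Qed.
Fact ocmp_is_monoid_morphism p q : monoid_morphism (ocmp p q).
Proof. by split=> [|f g]; apply: cgP; rewrite ?cgM ?cg1 /= ?rmorph1 ?rmorphM. Qed.
HB.instance Definition _ p q := GRing.isZmodMorphism.Build O O (ocmp p q) (ocmp_is_zmod_morphism p q).
HB.instance Definition _ p q := GRing.isMonoidMorphism.Build O O (ocmp p q) (ocmp_is_monoid_morphism p q).

Lemma odxE (f : O) : odx f = dx f :> series2 K. Proof. by []. Qed.
Lemma odyE (f : O) : ody f = dy f :> series2 K. Proof. by []. Qed.
Lemma odxD f g : odx (f + g) = odx f + odx g.
Proof. by apply: cgP; rewrite odxE !cgD !odxE dxD. Qed.
Lemma odyD f g : ody (f + g) = ody f + ody g.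
Proof. by apply: cgP; rewrite odyE !cgD !odyE dyD. Qed.
Lemma odxM f g : odx (f * g) = odx f * g + f * odx g.
Proof. by apply: cgP; rewrite odxE cgD !cgM !odxE dxM. Qed.
Lemma odyM f g : ody (f * g) = ody f * g + f * ody g.
Proof. by apply: cgP; rewrite odyE cgD !cgM !odyE dyM. Qed.
Lemma odxC c : odx (oC c) = 0. Proof. by apply: cgP; apply: dxC. Qed.
Lemma odyC c : ody (oC c) = 0. Proof. by apply: cgP; apply: dyC. Qed.
Lemma odxX : odx oX = 1. Proof. by apply: cgP; apply: dxX. Qed.
Lemma odyX : ody oX = 0. Proof. by apply: cgP; apply: dyX. Qed.
Lemma odxY : odx oY = 0. Proof. by apply: cgP; apply: dxY. Qed.
Lemma odyY : ody oY = 1. Proof. by apply: cgP; apply: dyY. Qed.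
Lemma odxN f : odx (- f) = - odx f.
Proof. by rewrite -mulN1r -(rmorphN1 oC) odxM odxC mul0r add0r rmorphN1 mulN1r. Qed.
Lemma odyN f : ody (- f) = - ody f.
Proof. by rewrite -mulN1r -(rmorphN1 oC) odyM odyC mul0r add0r rmorphN1 mulN1r. Qed.
Lemma odxXn f n : odx (f ^+ n.+1) = n.+1%:R * f ^+ n * odx f.
Proof.
elim: n => [|n IH]; first by rewrite expr1 expr0 !mul1r.
by rewrite exprS odxM IH -[n.+2]addn1 natrD exprS; ring.
Qed.
Lemma odyXn f n : ody (f ^+ n.+1) = n.+1%:R * f ^+ n * ody f.
Proof.
elim: n => [|n IH]; first by rewrite expr1 expr0 !mul1r.
by rewrite exprS odyM IH -[n.+2]addn1 natrD exprS; ring.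
Qed.
Lemma ocmp_dx p q f :
  odx (ocmp p q f) = ocmp p q (odx f) * odx p + ocmp p q (ody f) * odx q.
Proof. by apply: cgP; rewrite odxE cgD !cgM -comp_dx. Qed.
Lemma ocmp_dy p q f :
  ody (ocmp p q f) = ocmp p q (odx f) * ody p + ocmp p q (ody f) * ody q.
Proof. by apply: cgP; rewrite odyE cgD !cgM -comp_dy. Qed.
Lemma ocmpX (p q : O) : p 0%N 0%N = 0 -> ocmp p q oX = p.
Proof. by move=> p0; apply: cgP; rewrite /= compX cutE. Qed.
Lemma ocmpY (p q : O) : q 0%N 0%N = 0 -> ocmp p q oY = q.
Proof. by move=> q0; apply: cgP; rewrite /= compY cutE. Qed.
Lemma ocmpC p q c : ocmp p q (oC c) = oC c.
Proof. by apply: cgP; apply: compC. Qed.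
Lemma ocmp_assoc p q p' q' f :
  ocmp p' q' (ocmp p q f) = ocmp (ocmp p' q' p) (ocmp p' q' q) f.
Proof. by apply: cgP; apply: comp_assoc. Qed.
Lemma ounitE (f : O) : (f \is a GRing.unit) = (f 0%N 0%N != 0).
Proof.
apply/idP/idP => [/unitrP[g [_ /(congr1 (fun h : O => h 0%N 0%N))]]|f0].
  by rewrite cgM cg1 germM00 germ1_00; apply: contra_eq_neq => ->; rewrite mul0r eq_sym oner_eq0.
have [g cg fg] := convergentV f0 (cg_conv f).
by apply/unitrPr; exists (mkO cg); apply: cgP.
Qed.

(** Write [D = L + X^k U] with [U] a unit and [L] divisible by y, and put [Z = L / U]. The quotient
    times [U] is the fixed point [Q] for which [X^k Q] is the part of [e - Q Z] divisible by [X^k];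
    the remainder is the rest. *)
Lemma weierstrass_division (D e : O) k :
  (forall i, (i < k)%N -> D i 0%N = 0) -> D k 0%N != 0 ->
  exists q r : O, e = q * D + r /\ forall i j, (k <= i)%N -> r i j = 0.
Proof.
move=> D0 Dk.
pose U := oshx k D; pose L := D - oX ^+ k * U.
have uU : U \is a GRing.unit by rewrite ounitE /U /= /shx add0n.
have LE i j : L i j = if (i < k)%N then D i j else 0.
  rewrite /L cgB cgM cgX !fpsB gXnM /= /shx; case: ltnP => [_|le]; first by rewrite subr0.
  by rewrite subnK // subrr.
have L0 i : L i 0%N = 0 by rewrite LE; case: ifP => // /D0.
pose Z := L / U.
have Z0 i : Z i 0%N = 0.
  rewrite /Z cgM germM big1 // => a _; rewrite big_ord1 L0 mul0r //.
have [M [N [r [r0 hZ he]]]] := convergent2 (cg_conv Z) (cg_conv e).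
have M0 : 0 <= M / r by rewrite divr_ge0 ?(bnd_ge0 hZ) ?(ltW r0).
have rk0 : 0 < r ^+ k / 2 by rewrite divr_gt0 ?exprn_gt0.
have [s /andP[s0 les] hs] := small_radius M0 rk0 r0.
have {}hZ : bnd r s (r ^+ k / 2) Z.
  by apply: (bndW hs); apply: bnd_divY => //; rewrite s0.
have {}he : bnd r s N e by apply: bnd_radii he; rewrite ?lexx ?(ltW r0) ?(ltW s0).
pose B := 2 * N / r ^+ k.
have N0 := bnd_ge0 he.
(* Multiplication by [Z], divisible by y, gains [k + 1] for these weights, and the shift loses only
   [k]. As [Z] has norm at most [r^k / 2], the ball of radius [2 N / r^k] is preserved. *)
have [||||Q hQ QE] := @germ_fixpoint K 1 k.+1 (fun Q => shx k (cgval e - Q * cgval Z)) (fun f => bnd r s B f).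
- move=> n f g _ _ hfg i j lt.
  rewrite -[LHS]/((cgval e - f * cgval Z - (cgval e - g * cgval Z)) (i + k)%N j).
  rewrite (_ : _ - _ = (g - f) * cgval Z); last by ring.
  apply: (@woM _ 1 k.+1 n k.+1); rewrite -1?opprB; first exact: woN.
    move=> a [|b] lt'; first exact: Z0.
    by move: lt'; rewrite mulnS addnCA ltnNge leq_addr.
  by rewrite mul1n in lt *; rewrite mul1n; lia.
- exact: pointwise_closed_bnd.
- by apply: bndW (bnd0 _ _ _); rewrite /B divr_ge0 ?mulr_ge0 ?exprn_ge0 ?(ltW r0).
- move=> f hf.
  have := bnd_shx (ltW r0) (ltW s0) k r0 (bndB (ltW r0) (ltW s0) he (bndM (ltW r0) (ltW s0) hf hZ)).
  apply: bndW; rewrite /B; apply: eq_le_of; field; rewrite expf_neq0 // gt_eqF //.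
have cQ : converges Q by apply: bnd_convergent hQ.
exists (mkO cQ / U), (e - mkO cQ / U * D); split; first by rewrite addrC subrK.
move=> i j le.
have -> : e - mkO cQ / U * D = e - mkO cQ * Z - oX ^+ k * mkO cQ.
  have DE : D = L + oX ^+ k * U by rewrite subrK.
  have -> : mkO cQ / U * D = mkO cQ * Z + oX ^+ k * mkO cQ * (U^-1 * U) by rewrite {1}DE /Z; ring.
  by rewrite mulVr // mulr1 opprD addrA.
have Qij : Q (i - k)%N j = (cgval e - Q * cgval Z) i j by rewrite {1}QE /shx subnK.
by rewrite cgB cgB !cgM cgX germB -[cgval oX]/gX gXnM ltnNge le /= Qij subrr.
Qed.

(** * Series in the first variable and ordinary differential equations *)

Definition onlyX (f : series2 K) := forall i j, (0 < j)%N -> f i j = 0.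
Lemma onlyXD f g : onlyX f -> onlyX g -> onlyX (f + g).
Proof. by move=> hf hg i j lt; rewrite !fpsD hf // hg // addr0. Qed.
Lemma onlyXM f g : onlyX f -> onlyX g -> onlyX (f * g).
Proof.
move=> hf hg i j lt; rewrite germM big1 // => a _; rewrite big1 // => b _.
case: (posnP b) => [->|/hf ->]; last by rewrite mul0r.
by rewrite hg ?mulr0 // subn0.
Qed.
Lemma onlyXC c : onlyX (gC c). Proof. by move=> i [|j] //; rewrite gCE andbF. Qed.
Lemma onlyX_X : onlyX gX. Proof. by move=> i [|j] //; rewrite gXE andbF. Qed.
Lemma onlyX_cut f : onlyX f -> onlyX (cut f).
Proof. by move=> hf; rewrite /cut -rmorphN; apply: onlyXD => //; apply: onlyXC. Qed.
Lemma onlyX_ev a b P : onlyX a -> onlyX b -> onlyX (evG a b P).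
Proof.
move=> ha hb; elim/poly2_ind: P => [c|||P Q IHP IHQ|P Q IHP IHQ].
- by rewrite evC ev1C; apply: onlyXC.
- by rewrite evX.
- by rewrite evC ev1X.
- by rewrite rmorphD; apply: onlyXD.
- by rewrite rmorphM; apply: onlyXM.
Qed.
Lemma onlyX_comp p q f : onlyX p -> onlyX q -> onlyX (gcomp p q f).
Proof. by move=> /onlyX_cut hp /onlyX_cut hq i j lt; apply: onlyX_ev. Qed.
Lemma onlyX_closed : pointwise_closed onlyX.
Proof.
move=> f h i j lt; have [g hg e] := h (maxn i j).+1.
by rewrite e ?ltnS ?leq_maxl ?leq_maxr // hg.
Qed.
Lemma comp_onlyX p q q' f : onlyX f -> gcomp p q f = gcomp p q' f.
Proof.
move=> hf; apply: eq_ordge => n; pose P := trunc n f.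
have e : evG (cut p) (cut q) P = evG (cut p) (cut q') P.
  have S1 : (size P <= n)%N by exact: size_poly.
  have S2 i : (size (P`_i)%R <= n)%N.
    by rewrite coef_poly; case: ifP => _; rewrite ?size_poly ?size_poly0.
  rewrite (@ev_sum _ _ _ _ (cut q) _ _ S1 S2) (@ev_sum _ _ _ _ (cut q') _ _ S1 S2).
  apply: eq_bigr => i _; apply: eq_bigr => -[[|j] ltj] _; first by rewrite !expr0.
  have cP : P`_i`_j.+1 = 0 by rewrite -[LHS]/(toG P i j.+1) toG_trunc hf // if_same.
  rewrite -[val (Ordinal ltj)]/j.+1 cP.
  have z (u : series2 K) : gC 0 * u = 0 by apply: germP => a b; rewrite gCM mul0r.
  by rewrite [LHS]z [RHS]z.
have abel (a b x : series2 K) : a - b = (a - x) - (b - x) by ring.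
rewrite (abel _ _ (evG (cut p) (cut q) P)); apply: woB; first exact: comp_trunc.
by rewrite e; apply: comp_trunc.
Qed.

Definition intx (f : series2 K) : series2 K := fun i j => if i is k.+1 then f k j / k.+1%:R else 0.
Lemma dx_intx f : dx (intx f) = f.
Proof. by apply: germP => i j; rewrite dxE /= -[X in X = _]mulr_natr divfK // natK_neq0. Qed.
Lemma bnd_intx r1 r2 M f : 0 <= r1 -> 0 <= r2 -> bnd r1 r2 M f -> bnd r1 r2 (r1 * M) (intx f).
Proof.
move=> r1_0 r2_0 hf [|n]; first by rewrite /part big_ord0 mulr_ge0 ?(bnd_ge0 hf).
apply: le_trans (ler_wpM2l r1_0 (hf n.+1)); rewrite /part big_ord_recl big1 ?add0r; last first.
  by move=> j _; rewrite nrm0 !mul0r.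
rewrite mulr_sumr [leRHS]big_ord_recr /= -[leLHS]addr0.
apply: lerD; last first.
  by rewrite mulr_ge0 // sumr_ge0 // => j _; rewrite !mulr_ge0 ?nrm_ge0 ?exprn_ge0.
apply: ler_sum => i _; rewrite mulr_sumr; apply: ler_sum => j _.
rewrite /= nrmM nrmV nrm_nat exprS.
rewrite [leRHS](_ : _ = nrm (f i j) * (r1 * r1 ^+ i) * r2 ^+ j); last by ring.
rewrite !ler_wpM2r ?mulr_ge0 ?exprn_ge0 // ler_piMr ?nrm_ge0 // invf_le1 ?ltr0n // ler1n //.
Qed.

(** Picard iteration: on a disc of radius [t] with [M t <= r] the iterates stay in the range where
    [s] is bounded by [M]. *)
Lemma ode_solution (s : O) : exists c : O,
  [/\ c 0%N 0%N = 0, onlyX c & odx c = ocmp oX c s].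
Proof.
have [M [r [r0 hs]]] := (convergentP _).1 (cg_conv s).
have M0 := bnd_ge0 hs.
have [t /andP[t0 let_] ht] := small_radius M0 r0 r0.
have [||||c [hc [oc c0]] cE] := @germ_fixpoint K 1 1 (fun c => intx (gcomp gX c s))
   (fun c => bnd t r r c /\ (onlyX c /\ ordge 1 c)).
- move=> n f g _ _ hfg [|i] j; first by rewrite !fpsB /= subrr.
  rewrite !mul1n => lt; rewrite -[LHS]/(gcomp gX f s i j / i.+1%:R - gcomp gX g s i j / i.+1%:R) -mulrBl.
  rewrite -[X in X / _]/((gcomp gX f s - gcomp gX g s) i j).
  have h : ordge n (gcomp gX f s - gcomp gX g s).
    by apply: comp_congr => //; rewrite subrr; apply: wo0.
  by rewrite h ?mul0r // !mul1n; lia.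
- apply: pointwise_closedI; first exact: pointwise_closed_bnd.
  by apply: pointwise_closedI; [exact: onlyX_closed|exact: pointwise_closed_wo].
- split; first by apply: bndW (bnd0 _ _ _); apply: ltW.
  by split=> //; apply: wo0.
- move=> f [hf [of_ f0]]; split; last first.
    split; first by move=> [|i] j lt //=; rewrite onlyX_comp ?mul0r //; apply: onlyX_X.
    exact/ordge1P.
  have hX : bnd t r t (cut (@gX K)).
    rewrite (cutE (gXE K 0%N 0%N)) -[X in bnd _ _ X _]mulr1 -[gX]mulr1.
    have -> : gX * 1 = intx 1 :> series2 K.
      by apply: germP => i j; rewrite gXM; case: i => //= i; rewrite !fps1; case: i => [|i] /=; rewrite ?divr1 ?fps0 ?mul0r.
    apply: bnd_intx; rewrite ?ltW // -(rmorph1 (@gC K)) -(nrm1 K); exact: bndC.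
  have hf' : bnd t r r (cut f) by rewrite cutE //; apply/ordge1P.
  have hs' : bnd t r M s by apply: bnd_radii hs; rewrite ?(ltW t0) ?let_ ?lexx ?(ltW r0).
  apply: bndW (bnd_intx (ltW t0) (ltW r0) (comp_bnd (ltW t0) (ltW r0) hX hf' hs')).
  by rewrite mulrC.
have cc : converges c by apply: bnd_convergent hc.
exists (mkO cc); split => //; first exact/ordge1P.
by apply: cgP; rewrite /= {1}cE dx_intx.
Qed.
End CGerm.

(** * Divisibility *)

Section Divisibility.
Variables (R : realFieldType) (K : absField R).
Local Notation O := (cgerm K).

Definition ocoprime (f g : O) := forall D : O,
  (exists q, f = D * q) -> (exists q, g = D * q) -> D 0%N 0%N != 0.
Definition oirreducible (h : O) := [/\ h != 0, h 0%N 0%N = 0 &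
  forall a b : O, h = a * b -> a 0%N 0%N != 0 \/ b 0%N 0%N != 0].

Lemma oneq0P (r : O) : r != 0 -> exists i j, r i j != 0.
Proof.
move=> r0; apply: contrapT => h; move/eqP: r0; apply; apply: cgP; apply: germP => i j.
by apply/eqP; apply: contrapT => /negP ne; apply: h; exists i, j.
Qed.

Lemma oY_factor (r : O) : r != 0 -> exists j (s : O),
  [/\ r = oY K ^+ j * s, exists i, s i 0%N != 0 & forall i, s i 0%N = r i j].
Proof.
move=> /oneq0P[i [j rij]].
have ex : exists j, `[< exists i, r i j != 0 >] by exists j; apply/asboolP; exists i.
case: (ex_minnP ex) => {rij i}{}j /asboolP[i rij] mj.
exists j, (oshy j r); split; last by [].
  apply: cgP; rewrite cgM cgX; apply/esym/shyK => a b lt; apply/eqP/negPn/negP => ne.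
  by have : (j <= b)%N by [apply: mj; apply/asboolP; exists a]; rewrite leqNgt lt.
by exists i.
Qed.

(* Weierstrass division by an element of smallest order on y = 0 leaves a remainder divisible by y. *)
Lemma saturated_ideal_generator (P : O -> Prop) (f0 : O) :
  P f0 -> f0 != 0 -> (forall q f g, P f -> P g -> P (f - q * g)) ->
  (forall f n, P (oY K ^+ n * f) -> P f) ->
  exists D k, [/\ P D, forall i, (i < k)%N -> D i 0%N = 0, D k 0%N != 0 &
    forall f, P f -> exists q, f = D * q].
Proof.
move=> Pf0 f0_neq0 PB PY.
pose S k := `[< exists D, [/\ P D, forall i, (i < k)%N -> D i 0%N = 0 & D k 0%N != 0] >].
have SP (r : O) : P r -> r != 0 ->
    exists2 k, S k & (forall n, (forall i j, (n <= i)%N -> r i j = 0) -> (k < n)%N).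
  move=> Pr /oY_factor[j [s [rE ex sr]]].
  case: (ex_minnP ex) => k sk mk; exists k.
    apply/asboolP; exists s; split=> //; first by apply: (PY s j); rewrite -rE.
    by move=> i lt; apply/eqP/negPn/negP => /mk; rewrite leqNgt lt.
  by move=> n h; rewrite ltnNge; apply/negP => le; move/eqP: sk; apply; rewrite sr h.
have exS : exists k, S k by have [k] := SP f0 Pf0 f0_neq0; exists k.
case: (ex_minnP exS) => k /asboolP[D [PD D0 Dk]] mk; exists D, k; split=> // f Pf.
have [q [r [fE hr]]] := weierstrass_division f D0 Dk.
have Pr : P r by have -> : r = f - q * D by [rewrite fE addrC addKr]; apply: PB.
have [r0|r_neq0] := eqVneq r 0; first by exists q; rewrite fE r0 addr0 mulrC.
have [k' Sk' lt] := SP r Pr r_neq0.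
by have := mk _ Sk'; rewrite leqNgt (lt k hr).
Qed.

(** The ideal [(f, g)] saturated by y is principal; its generator divides both germs, so it is a
    unit and a power of y lies in [(f, g)]. This is the form in which coprimality survives a
    blow-up. *)
Lemma coprime_Ypow (f g : O) : g != 0 -> ocoprime f g ->
  exists N (a b : O), oY K ^+ N = a * f + b * g.
Proof.
move=> g0 cop.
have [|||D [k [[n [a [b E]]] D0 Dk div]]] :=
  @saturated_ideal_generator (fun u => exists n (a b : O), oY K ^+ n * u = a * f + b * g) g _ g0.
- by exists 0%N, 0, 1; rewrite mul0r add0r.
- move=> q u v [n [a [b Eu]]] [m [c [e Ev]]].
  exists (n + m)%N, (oY K ^+ m * a - q * oY K ^+ n * c), (oY K ^+ m * b - q * oY K ^+ n * e).
  have -> : oY K ^+ (n + m) * (u - q * v) = oY K ^+ m * (oY K ^+ n * u) - q * oY K ^+ n * (oY K ^+ m * v).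
    by rewrite exprD; ring.
  by rewrite Eu Ev; ring.
- by move=> u n [m [a [b E]]]; exists (m + n)%N, a, b; rewrite exprD -mulrA.
have uD : D 0%N 0%N != 0.
  apply: cop; apply: div.
    by exists 0%N, 1, 0; rewrite expr0; ring.
  by exists 0%N, 0, 1; rewrite expr0; ring.
rewrite -ounitE in uD; exists n, (a / D), (b / D).
by rewrite -[LHS](mulrK uD) E; ring.
Qed.

(** Here [phi] restricts to a parametrized curve on which y is not identically zero, so its kernel
    is saturated by y, hence principal; an irreducible [h] in it must be a generator. *)
Lemma kernel_generator (phi : {rmorphism O -> O}) (h : O) :
  phi (oY K) != 0 -> phi h = 0 -> oirreducible h ->
  forall f, phi f = 0 -> exists q, f = h * q.
Proof.
move=> phiY phih [h0 _ irr].
have [|||D [k [PD D0 Dk div]]] := @saturated_ideal_generator (fun u => phi u = 0) h _ h0.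
- by [].
- by move=> q u v eu ev; rewrite rmorphB rmorphM eu ev mulr0 subr0.
- by move=> u n; rewrite rmorphM rmorphXn => /eqP; rewrite mulf_eq0 expf_eq0 (negPf phiY) andbF => /eqP.
have [q hE] := div h phih.
have nD : ~ (D 0%N 0%N != 0).
  rewrite -ounitE => uD; have := congr1 phi (mulrV uD); rewrite rmorphM PD mul0r rmorph1 => /esym/eqP.
  by rewrite oner_eq0.
case: (irr _ _ hE) => // uq; rewrite -ounitE in uq.
by move=> f /div[p ->]; exists (p / q); rewrite hE mulrACA mulrV // mulr1.
Qed.
End Divisibility.

(** * Formal first integrals of a nonsingular vector field *)

Section Theta.
Variables (R : realFieldType) (K : absField R).
Implicit Types f g s T : series2 K.

(** The quotient [f / g] is constant along the field [dx + s dy], hence determined by its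
    restriction to the transversal x = 0. There it exists by comparing orders, and transport along
    the field extends it. *)
Lemma first_integral_division f g s b :
  g * (dx f + s * dy f) = f * (dx g + s * dy g) ->
  (forall j, (j < b)%N -> f 0%N j = 0) -> (forall j, (j < b)%N -> g 0%N j = 0) ->
  g 0%N b != 0 -> exists T, f = g * T.
Proof.
move=> E f0 g0 gb.
have shE (u : fps K) : (forall j, (j < b)%N -> u j = 0) -> u = fpsX K ^+ b * (fun j => u (j + b)%N : K).
  by move=> h; apply: fpsP => j; rewrite fpsXnM; case: ltnP => [/h //|/subnK ->].
pose w : fps K := fun j => f 0%N (j + b)%N; pose u : fps K := fun j => g 0%N (j + b)%N.
have uu : u \is a GRing.unit by rewrite fps_unitE unitfE /u add0n.
pose F0 := w / u.
have fF : f 0%N = g 0%N * F0.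
  by rewrite (shE _ f0) (shE _ g0) -/u -/w /F0 -mulrA; congr (_ * _); rewrite mulrCA mulrV // mulr1.
(* For the weights 2, 1 the primitive gains two and the y-derivative loses one, so transport
   contracts. *)
have [||||T _ TE] := @germ_fixpoint K 2 1 (fun T => fpsC F0 - intx (s * dy T)) (fun=> True) => //.
  move=> n T T' _ _ h [|i] j lt; first by rewrite !germB subrr.
  rewrite (_ : _ - _ - _ = intx (s * dy T') - intx (s * dy T)); last by ring.
  rewrite germB /= -mulrBl -germB -mulrBr.
  have hd : wo 2 1 n.-1 (dy T' - dy T).
    move=> k l lt'; rewrite germB !dyE -mulrnBl -germB -opprB germN h ?oppr0 ?mul0rn //; lia.
  by rewrite (woMl _ hd) ?mul0r //; lia.
have T0 : T 0%N = F0.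
  by rewrite TE; apply: fpsP => j; rewrite -[LHS]/(F0 j - 0) subr0.
have dT : dx T = - (s * dy T).
  rewrite -[s * dy T]dx_intx {1}TE; apply: germP => i j.
  by rewrite germN !dxE -mulNrn; congr (_ *+ _); rewrite germB sub0r.
(* The difference [f - g T] satisfies the same equation and vanishes on the transversal. Its first
   nonzero coefficient in x, of positive index, would be annihilated by that index times [g 0]. *)
exists T; apply/eqP; rewrite -subr_eq0; apply: contraT => /fps_neq0P[n [en ez]].
set e := f - g * T in en ez.
have e0 : e 0%N = 0 by rewrite /e fpsB fpsM0 fF T0 subrr.
case: n en ez => [|n] en ez; first by rewrite e0 eqxx in en.
have dNM (D : series2 K -> series2 K) a c : (forall x y, D (x + y) = D x + D y) ->
    (forall x y, D (x * y) = D x * y + x * D y) -> D (- (a * c)) = - (D a * c + a * D c).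
  move=> DD DM; rewrite -DM; apply/eqP; rewrite -addr_eq0 -DD addNr; apply/eqP.
  by have := DD 0 0; rewrite addr0 -{1}[D 0]addr0 => /addrI.
have Ee : g * (dx e + s * dy e) = e * (dx g + s * dy g).
  rewrite /e dxD dyD (dNM _ _ _ (@dxD K) (@dxM K)) (dNM _ _ _ (@dyD K) (@dyM K)) dT.
  have -> : g * (dx f - (dx g * T + g * - (s * dy T)) + s * (dy f - (dy g * T + g * dy T)))
    = g * (dx f + s * dy f) - g * T * (dx g + s * dy g) by ring.
  by rewrite E; ring.
have := congr1 (fun u : series2 K => u n) Ee; rewrite mulrDr fpsD.
have zl (a c : series2 K) : (forall i, (i < n.+1)%N -> a i = 0) -> (a * c) n = 0.
  by move=> h; rewrite fpsM big1 // => i _; rewrite h ?mul0r.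
rewrite [RHS]zl // (_ : g * (s * dy e) = dy e * (g * s)); last by ring.
rewrite [X in _ + X]zl; last first.
  by move=> i lt; rewrite /dy ez //; apply: fpsP => j; rewrite /fps_deriv fps0 mul0rn.
rewrite addr0 fpsM big_ord_recl subn0 big1 ?addr0; last first.
  move=> i _; rewrite /dx /fps_deriv ez ?mul0rn ?mulr0 //; have := ltn_ord i; rewrite /= /bump /=; lia.
move=> /eqP; rewrite mulf_eq0 => /orP[/eqP z|/eqP z].
  by rewrite /= z fps0 eqxx in gb.
case/negP: en; apply/eqP; apply: fpsP => j; have := congr1 (fun u : fps K => u j) z.
rewrite /dx /fps_deriv fpsMn fps0 => /eqP; rewrite -mulr_natr mulf_eq0 (negPf (natK_neq0 _ _)) orbF.
by move/eqP.
Qed.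

Lemma gX_divides_cofactor (g Q Z : series2 K) m : g 0%N != 0 -> g * Q = gX ^+ m * Z ->
  exists Q', Q = gX ^+ m * Q' /\ g * Q' = Z.
Proof.
move=> g0; elim: m Q => [|m IH] Q E; first by exists Q; rewrite mul1r E mul1r.
have Q0 : Q 0%N = 0.
  have := congr1 (fun u : series2 K => u 0%N) E; rewrite fpsM0 exprS -mulrA fpsXM => /eqP.
  by rewrite mulf_eq0 (negPf g0) => /eqP.
have QE : Q = gX * shx 1 Q by rewrite -[gX]expr1 shxK // => -[|i] j //; rewrite Q0.
have X0 : (gX : series2 K) != 0.
  by apply/eqP => /(congr1 (fun u : series2 K => u 1%N 0%N)); rewrite gXE /= => /eqP; rewrite oner_eq0.
have [|Q' [e1 e2]] := IH (shx 1 Q).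
  by apply: (mulfI X0); rewrite mulrCA -QE E exprS mulrA.
by exists Q'; rewrite QE e1 exprS mulrA.
Qed.
Lemma gY_divides_cofactor (g Q Z : series2 K) i m : g i 0%N != 0 -> g * Q = gY ^+ m * Z ->
  exists Q', Q = gY ^+ m * Q' /\ g * Q' = Z.
Proof.
move=> gi; pose ev0 (u : series2 K) : fps K := fun i => u i 0%N.
have evM (a c : series2 K) : ev0 (a * c) = ev0 a * ev0 c.
  by apply: fpsP => k; rewrite /ev0 germM fpsM; apply: eq_bigr => a' _; rewrite big_ord1.
have g0 : ev0 g != 0 by apply/eqP => /(congr1 (fun u : fps K => u i)) /eqP; rewrite (negPf gi).
elim: m Q => [|m IH] Q E; first by exists Q; rewrite mul1r E mul1r.
have Q0 k : Q k 0%N = 0.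
  have : ev0 (g * Q) = 0 by rewrite E; apply: fpsP => l; rewrite /ev0 gYnM.
  by rewrite evM => /eqP; rewrite mulf_eq0 (negPf g0) => /eqP /(congr1 (fun u : fps K => u k)).
have QE : Q = gY * shy 1 Q by rewrite -[gY]expr1 shyK // => a [|b].
have Y0 : (gY : series2 K) != 0.
  by apply/eqP => /(congr1 (fun u : series2 K => u 0%N 1%N)); rewrite gYE /= => /eqP; rewrite oner_eq0.
have [|Q' [e1 e2]] := IH (shy 1 Q).
  by apply: (mulfI Y0); rewrite mulrCA -QE E exprS mulrA.
by exists Q'; rewrite QE e1 exprS mulrA.
Qed.

(* At a point where the foliation is nonsingular the two members of the pencil
   cannot both vanish, since one is a multiple of the other. *)
Lemma chart_no_base_point f g s (a b : series2 K) m n :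
  g * (dx f + s * dy f) = f * (dx g + s * dy g) ->
  a * f + b * g = gX ^+ m * gY ^+ n ->
  (f 0%N != 0) || (g 0%N != 0) ->
  (n = 0%N \/ (exists i, f i 0%N != 0) /\ (exists i, g i 0%N != 0)) ->
  f 0%N 0%N != 0 \/ g 0%N 0%N != 0.
Proof.
(* The case where [f'] vanishes on the transversal at least as much as [g']: then [f' = g' T], the
   relation reads [g'] times a cofactor equal to [X^m Y^n], and cancelling the coordinates makes
   [g'] a unit. *)
have main f' g' a' b' : g' * (dx f' + s * dy f') = f' * (dx g' + s * dy g') ->
    a' * f' + b' * g' = gX ^+ m * gY ^+ n -> g' 0%N != 0 ->
    (n = 0%N \/ exists i, g' i 0%N != 0) ->
    (forall j, (forall l, (l < j)%N -> g' 0%N l = 0) -> forall l, (l < j)%N -> f' 0%N l = 0) ->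
    g' 0%N 0%N != 0.
  move=> E ab g0 hn hle; have [k [gk gz]] := fps_neq0P g0.
  have [T fT] := first_integral_division E (hle _ gz) gz gk.
  have [|Q [_ QE]] := @gX_divides_cofactor g' (a' * T + b') (gY ^+ n) m g0.
    by rewrite -ab fT; ring.
  have [Q' e] : exists Q', g' * Q' = 1.
    case: hn => [n0|[i gi]]; first by exists Q; rewrite QE n0.
    have [|Q' [_ e]] := @gY_divides_cofactor g' Q 1 i n gi; first by rewrite QE mulr1.
    by exists Q'.
  have := congr1 (fun u : series2 K => u 0%N 0%N) e; rewrite germM00 germ1_00.
  by apply: contra_eq_neq => ->; rewrite mul0r eq_sym oner_eq0.
move=> E ab fg hn.
have hnf : n = 0%N \/ exists i, f i 0%N != 0 by case: hn => [|[]]; [left|right].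
have hng : n = 0%N \/ exists i, g i 0%N != 0 by case: hn => [|[]]; [left|right].
have [g0|g0] := eqVneq (g 0%N) 0.
  left; rewrite g0 eqxx orbF in fg; apply: (main g f b a) => //; first by rewrite addrC.
  by move=> j _ l _; rewrite g0.
have [k [gk gz]] := fps_neq0P g0.
have [[l [ltl fl]]|/forallNP h] := pselect (exists l, (l < k)%N /\ f 0%N l != 0).
  left; apply: (main g f b a) => //; first by rewrite addrC.
    by apply: contraNneq fl => ->.
  move=> j hj i lti; apply: gz; rewrite ltnNge; apply/negP => le.
  by rewrite hj ?eqxx // (leq_trans ltl) // (leq_trans le) // ltnW in fl.
right; apply: (main f g a b) => // j hj l ltl.
have lk : (l < k)%N.
  rewrite ltnNge; apply/negP => le; rewrite hj ?eqxx // in gk.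
  exact: leq_ltn_trans ltl.
by apply/eqP; apply: contrapT => /negP ne; apply: (h l).
Qed.
End Theta.

(** * Foliations of type T1 *)

Section Foliation.
Variables (R : realFieldType) (K : absField R).
Local Notation O := (cgerm K).
Local Notation X := (oX K).
Local Notation Y := (oY K).
Implicit Types A B f g : O.

Definition vfield A B f := A * odx f + B * ody f.
Definition Del A B : O := X * B - Y * A.
Definition T1 A B := [/\ ordge 2 A, ordge 2 B, ip 2 A = 'X, ip 2 B = 1 &
  exists2 beta : K, beta != 0 & ordge 4 (Del A B) /\ ip 4 (Del A B) = beta *: 'X^4].
Definition FI A B f g := g * vfield A B f = f * vfield A B g.

Lemma oX_neq0 : X != 0.
Proof.
apply/eqP => /(congr1 (fun u : O => u 1%N 0%N)); rewrite /= gXE /= => /eqP.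
by rewrite (oner_eq0 K).
Qed.
Lemma oY_neq0 : Y != 0.
Proof.
apply/eqP => /(congr1 (fun u : O => u 0%N 1%N)); rewrite -[cgval Y]/gY gYE /= => /eqP.
by rewrite (oner_eq0 K).
Qed.

(** Exactness of the Koszul relation, by dividing [X U + Y V] by [Del], whose initial form is
    [beta x^4]. The remainder [r] satisfies [r B = Del Z]; as the initial form of [B] is y^2, that
    of [r] would be divisible by x^4, although [r] has degree below 4 in x. *)
Lemma T1_koszul A B (U V : O) : T1 A B -> U * A + V * B = 0 ->
  exists L, U = L * B /\ V = - (L * A).
Proof.
move=> [oA oB iA iB [b b0 [oD iD]]] E; set D := Del A B in oD iD.
have D0 i : (i < 4)%N -> D i 0%N = 0 by move=> lt; apply: oD; lia.
have D4 : D 4 0%N != 0.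
  have := congr1 (fun p : {poly K} => p`_4) iD; rewrite /D coef_ip coefZ coefXn /= mulr1.
  by move=> ->.
pose T := X * U + Y * V.
have [L [r [TE hr]]] := weierstrass_division T D0 D4.
have TB : T * B = U * D.
  have e : V * B = - (U * A) by apply/eqP; rewrite -addr_eq0 addrC E.
  have -> : T * B = X * U * B + Y * (V * B) by rewrite /T; ring.
  by rewrite e /D /Del; ring.
have TA : T * A = - (V * D).
  have e : U * A = - (V * B) by apply/eqP; rewrite -addr_eq0 E.
  have -> : T * A = X * (U * A) + Y * V * A by rewrite /T; ring.
  by rewrite e /D /Del; ring.
have r0 : r = 0.
  apply/eqP; apply: contraT => /eqP rne; pose Z := U - L * B.
  have rB : r * B = D * Z.
    have -> : D * Z = U * D - L * D * B by rewrite /Z; ring.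
    by rewrite -TB TE; ring.
  have rne' : cgval r != 0 by apply/eqP => e; apply: rne; apply: cgP.
  have [n [orn irn]] := ord_exists rne'.
  have e1 : ip (n + 2) (r * B) = ip n r by rewrite cgM ipM // iB mulr1.
  case/negP: irn; apply/eqP.
  have [lt|ge] := ltnP n 2.
    by rewrite -e1 rB ip_ordgeS // cgM; apply: woW (woMr _ oD); lia.
  have oZ : ordge (n - 2) Z.
    apply: (@ordge_cancel _ 4 _ D) => //.
      by rewrite iD scaler_eq0 (negPf b0) /= -size_poly_eq0 size_polyXn.
    rewrite -cgM -rB cgM; apply: woW (woM orn oB); lia.
  have e2 : ip n r = b *: 'X^4 * ip (n - 2) Z.
    rewrite -e1 rB (_ : n + 2 = 4 + (n - 2))%N; last by lia.
    by rewrite cgM ipM // iD.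
  have Z0 : ip (n - 2) Z = 0.
    apply/polyP => i; rewrite coef0.
    have : (ip n r)`_(4 + i) = (b *: 'X^4 * ip (n - 2) Z)`_(4 + i) by rewrite e2.
    rewrite coef_ip hr ?leq_addr // if_same -scalerAl coefZ coefXnM ltnNge leq_addr /= addKn.
    by move=> /esym/eqP; rewrite mulf_eq0 (negPf b0) /= => /eqP.
  by rewrite e2 Z0 mulr0.
have D_neq0 : D != 0.
  by apply/eqP => e; move: D4; rewrite e /= => /eqP.
exists L; rewrite r0 addr0 in TE.
split; apply: (mulIf D_neq0); first by rewrite -TB TE; ring.
by rewrite -[V * D]opprK -TA TE; ring.
Qed.

Lemma euler_coef f i j : (X * odx f + Y * ody f) i j = f i j *+ (i + j).
Proof.
rewrite cgD !cgM germD gXM gYM !odxE !odyE mulrnDr.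
by congr (_ + _); [case: i => [|i]; rewrite ?mulr0n ?dxE|case: j => [|j]; rewrite ?mulr0n ?dyE].
Qed.
Lemma euler_ordge n f : ordge n f -> ordge n (X * odx f + Y * ody f).
Proof. by move=> h i j lt; rewrite euler_coef h // mul0rn. Qed.
Lemma euler_ip n f : ip n (X * odx f + Y * ody f) = n%:R *: ip n f.
Proof.
apply/polyP => i; rewrite coefZ !coef_ip; case: leqP => [le|]; last by rewrite mulr0.
by rewrite euler_coef subnKC // mulr_natl.
Qed.

Lemma FI_factor A B f g : T1 A B -> FI A B f g -> exists L,
  g * odx f - f * odx g = L * B /\ g * ody f - f * ody g = - (L * A).
Proof.
move=> T E; apply: (T1_koszul T).
have -> : (g * odx f - f * odx g) * A + (g * ody f - f * ody g) * B
   = g * vfield A B f - f * vfield A B g by rewrite /vfield; ring.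
by rewrite E subrr.
Qed.

Lemma natK_inj m n : m%:R = n%:R :> K -> m = n.
Proof.
wlog le : m n / (m <= n)%N => [hw|].
  by case/orP: (leq_total m n) => le e; [apply: hw|apply/esym/hw].
move=> e; have : (n - m)%:R = 0 :> K by rewrite natrB // e subrr.
case en : (n - m)%N => [|k]; first by lia.
by move=> /eqP; rewrite (negPf (natK_neq0 _ _)).
Qed.

Lemma ordge_wronskian_x p q f g : ordge p f -> ordge q g ->
  ordge (p + q).-1 (g * odx f - f * odx g).
Proof.
move=> of_ og; rewrite cgB !cgM !odxE; apply: woB.
  by apply: woW (woM og (ordge_dx of_)); lia.
by apply: woW (woM of_ (ordge_dx og)); lia.
Qed.

Lemma FI_factor_ordge A B L n (U : O) : T1 A B -> U = L * B -> ordge n U -> ordge (n - 2) L.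
Proof.
move=> [oA oB iA iB _] E oU.
have [lt|ge] := ltnP n 2; first by rewrite (_ : (n - 2)%N = 0%N) //; lia.
by apply: (@ordge_cancel _ 2 _ B) => //; rewrite ?iB ?oner_eq0 // mulrC -cgM -E subnKC.
Qed.

(** Contraction of [g df - f dg = L (B dx - A dy)] with the Euler field gives [L Del]. Since [Del]
    has order 4 instead of 3, the leading term [(p - q) f_0 g_0] must vanish: this is
    dicriticality. *)
Lemma FI_order A B f g p q : T1 A B -> FI A B f g ->
  ordge p f -> ip p f != 0 -> ordge q g -> ip q g != 0 -> p = q.
Proof.
move=> T E of_ if_ og ig; have [L [EU EV]] := FI_factor T E.
have oL := FI_factor_ordge T EU (ordge_wronskian_x of_ og).
have [oA oB iA iB [b b0 [oD iD]]] := T.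
pose Ef := X * odx f + Y * ody f; pose Eg := X * odx g + Y * ody g.
have TE : g * Ef - f * Eg = L * Del A B.
  have -> : g * Ef - f * Eg = X * (g * odx f - f * odx g) + Y * (g * ody f - f * ody g).
    by rewrite /Ef /Eg; ring.
  by rewrite EU EV /Del; ring.
have : ip (p + q) (g * Ef - f * Eg) = 0.
  by rewrite TE ip_ordgeS // cgM; apply: woW (woM oL oD); lia.
rewrite cgB !cgM ipB (addnC p q) (ipM og (euler_ordge of_)) (addnC q p) (ipM of_ (euler_ordge og)).
rewrite !euler_ip -scalerAr -scalerAr (mulrC (ip q g)) -scalerBl => /eqP.
rewrite scaler_eq0 mulf_eq0 (negPf if_) (negPf ig) !orbF subr_eq0 => /eqP.
exact: natK_inj.
Qed.

(** The initial form y^2 of [B] becomes 1 at y = 1, so the initial form of [L] can be read off the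
    dx component. *)
Lemma FI_wronskian A B f g L d : T1 A B -> ordge d.+2 f -> ordge d.+2 g ->
  g * odx f - f * odx g = L * B ->
  let f0 := ip d.+2 f in let g0 := ip d.+2 g in
  ordge (d + d).+1 L /\ ip (d + d).+1 L = g0 * f0^`() - f0 * g0^`().
Proof.
move=> T of_ og EU f0 g0; have [oA oB iA iB _] := T.
have oL : ordge (d + d).+1 L.
  by apply: woW (FI_factor_ordge T EU (ordge_wronskian_x of_ og)); lia.
split=> //.
have <- : ip ((d + d).+1 + 2) (L * B) = ip (d + d).+1 L by rewrite cgM ipM // iB mulr1.
rewrite -EU cgB !cgM !odxE (_ : (d + d).+1 + 2 = d.+2 + d.+1)%N; last by lia.
by rewrite ipB !ipM ?ip_dx //; apply: (@ordge_dx _ d.+2).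
Qed.

Lemma shiftpolyE (s : K) (u : {poly K}) :
  ev1 (@gC K) (gC s + gY) u = toG (u \Po ('X + s%:P))%:P.
Proof.
rewrite toGE evC /ev1 map_comp_poly horner_comp; congr (_.[_]).
by rewrite rmorphD /= map_polyX map_polyC hornerD hornerX hornerC addrC.
Qed.

(* The two charts of the blow-up; the exceptional divisor is X = 0 in chart2, Y = 0 in chart1. *)
Definition chart2 (s : K) : O -> O := ocmp ((oC s + Y) * X) X.
HB.instance Definition _ s := GRing.RMorphism.copy (chart2 s) (ocmp ((oC s + Y) * X) X).
Definition chart1 : O -> O := ocmp Y (X * Y).
HB.instance Definition _ := GRing.RMorphism.copy chart1 (ocmp Y (X * Y)).

Lemma chart2_p00 s : ((oC s + Y) * X : O) 0%N 0%N = 0.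
Proof. by rewrite cgM germM00 /= gXE mulr0. Qed.
Lemma oX00 : X 0%N 0%N = 0. Proof. by rewrite /= gXE. Qed.
Lemma oY00 : Y 0%N 0%N = 0. Proof. by rewrite -[cgval Y]/gY gYE. Qed.
Lemma oXY00 : (X * Y : O) 0%N 0%N = 0. Proof. by rewrite cgM germM00 oX00 mul0r. Qed.

Lemma wo10_X : wo 1 0 1 X.
Proof. by move=> i j lt; rewrite /= gXE; case: i lt => [|i] //; rewrite mul1n mul0n addn0. Qed.
Lemma wo01_Y : wo 0 1 1 Y.
Proof. by move=> i j lt; rewrite /= gYE; case: j lt => [|j]; rewrite ?andbF // mul1n mul0n. Qed.

Lemma chart2_wo s n f : ordge n f -> wo 1 0 n (chart2 s f).
Proof.
move=> h; apply: (@comp_wo _ 1 0 1 1) => //; rewrite cutE ?chart2_p00 ?oX00 //.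
  by rewrite cgM; apply: woMl; apply: wo10_X.
exact: wo10_X.
Qed.
Lemma chart1_wo n f : ordge n f -> wo 0 1 n (chart1 f).
Proof.
move=> h; apply: (@comp_wo _ 0 1 1 1) => //; rewrite cutE ?oXY00 ?oY00 //; first exact: wo01_Y.
by rewrite cgM; apply: woMl; apply: wo01_Y.
Qed.

Lemma chart2_shift s n f : ordge n f -> chart2 s f = X ^+ n * oshx n (chart2 s f).
Proof.
move=> /(chart2_wo s) h; apply: cgP; rewrite cgM cgX; apply/esym/shxK => i j lt.
by apply: h; rewrite mul1n mul0n addn0.
Qed.
Lemma chart1_shift n f : ordge n f -> chart1 f = Y ^+ n * oshy n (chart1 f).
Proof.
move=> /chart1_wo h; apply: cgP; rewrite cgM cgX; apply/esym/shyK => i j lt.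
by apply: h; rewrite mul1n mul0n.
Qed.

(** On the divisor only the initial form survives, as a polynomial recentred at the direction x = s
    y. *)
Lemma chart2_lead s n f j : ordge n f ->
  oshx n (chart2 s f) 0%N j = (ip n f \Po ('X + s%:P))`_j.
Proof.
move=> h; have hh := hompoly_ord h; set H := hompoly n (ip n f) in hh.
have e : cgval (chart2 s f) = gcomp ((oC s + Y) * X : O) X (cgval f - toG H) + gcomp ((oC s + Y) * X : O) X (toG H).
  by rewrite -rmorphD /= subrK.
rewrite -[LHS]/(cgval (chart2 s f) (0 + n)%N j) add0n e germD.
have -> : gcomp ((oC s + Y) * X : O) X (cgval f - toG H) n j = 0.
  apply: (@comp_wo _ 1 0 1 1 n.+1 _ _ _ _ _ hh); rewrite ?cutE ?chart2_p00 ?oX00 //.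
  - by rewrite cgM; apply: woMl; apply: wo10_X.
  - exact: wo10_X.
  - by rewrite mul1n mul0n addn0.
rewrite add0r comp_toG !cutE ?chart2_p00 ?oX00 // cgM.
rewrite (ev_hompoly_scale _ _ (size_ip _ _)) gXnM ltnn subnn cgD /= shiftpolyE.
by rewrite /toG coefC.
Qed.

(** The chart is centred at the direction y = 0, infinity for the coordinate x/y, so the
    coefficients occur in reverse order. *)
Lemma chart1_lead n f i : ordge n f ->
  oshy n (chart1 f) i 0%N = if (i <= n)%N then (ip n f)`_(n - i) else 0.
Proof.
move=> h; have hh := hompoly_ord h; set H := hompoly n (ip n f) in hh.
have e : cgval (chart1 f) = gcomp Y (X * Y : O) (cgval f - toG H) + gcomp Y (X * Y : O) (toG H).
  by rewrite -rmorphD /= subrK.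
rewrite -[LHS]/(cgval (chart1 f) i (0 + n)%N) add0n e germD.
have -> : gcomp Y (X * Y : O) (cgval f - toG H) i n = 0.
  apply: (@comp_wo _ 0 1 1 1 n.+1 _ _ _ _ _ hh); rewrite ?cutE ?oXY00 ?oY00 //.
  - exact: wo01_Y.
  - by rewrite cgM; apply: woMl; apply: wo01_Y.
  - by rewrite mul1n mul0n.
rewrite add0r comp_toG !cutE ?oXY00 ?oY00 // cgM /H /hompoly rmorph_sum /= fps_sum fps_sum.
have E (k : 'I_n.+1) : evG gY (gX * gY) (((ip n f)`_k)%:P%:P * 'X^k * 'X%:P ^+ (n - k)) i n
    = if (i == n - k)%N then (ip n f)`_k else 0.
  rewrite !evM !rmorphXn /= evX !evC ev1C ev1X exprMn /=.
  have -> : gC (ip n f)`_k * gY ^+ k * (gX ^+ (n - k) * gY ^+ (n - k))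
     = gC (ip n f)`_k * (gX ^+ (n - k) * (gY ^+ n * 1)).
    have -> : gY ^+ n = gY ^+ k * gY ^+ (n - k) :> series2 K by rewrite -exprD subnKC // -ltnS.
    by ring.
  rewrite gCM gXnM gYnM ltnn subnn germ1E eqxx andbT subn_eq0.
  by case: (ltngtP i (n - k)%N); rewrite ?mulr0 ?mulr1.
rewrite (eq_bigr _ (fun k _ => E k)); case: leqP => [le|lt]; last first.
  by rewrite big1 // => k _; case: eqP => // e'; lia.
have lt : (n - i < n.+1)%N by rewrite ltnS leq_subr.
rewrite (bigD1 (Ordinal lt)) //= subKn // eqxx big1 ?addr0 // => k.
rewrite -val_eqE /= => ne; rewrite ifF //; apply/negbTE; apply: contra ne => /eqP e'; apply/eqP.
by have := ltn_ord k; lia.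
Qed.

Lemma gcomp_onlyX_Y (q F : series2 K) i j : onlyX F ->
  gcomp gY q F i j = if i is 0%N then F j 0%N else 0.
Proof.
move=> hF; pose u : {poly K} := \poly_(k < (i + j).+1) F k 0%N.
have h : ordge (i + j).+1 (F - toG (map_poly polyC u)).
  apply/ordgeP => k l lt; rewrite germB /toG coef_map_id0 // coef_poly coefC.
  rewrite (leq_ltn_trans (leq_addr l k) lt).
  by case: l lt => [|l] lt; rewrite ?subrr // hF // subr0.
have := comp_ev gY q h (i := i) (j := j); rewrite !mul1n ltnSn => /(_ isT)/eqP.
rewrite germB subr_eq0 => /eqP ->.
have -> : evG (cut gY) (cut q) (map_poly polyC u) = toG u%:P.
  rewrite toGE evC (cutE (gYE K 0 0)) /ev -map_poly_comp [RHS]/ev1; congr (_.[_]).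
  by apply: eq_map_poly => c /=; rewrite ev1C.
rewrite /toG coefC; case: i {h} @u => [|i] /=; last by rewrite coef0.
by rewrite coef_poly add0n ltnSn.
Qed.
End Foliation.

(** * The blown-up foliation and the initial forms of a first integral *)

Section Charts.
Variables (R : realFieldType) (K : absField R).
Local Notation O := (cgerm K).
Local Notation X := (oX K).
Local Notation Y := (oY K).
Implicit Types A B f g L : O.

Lemma odxXY : odx (X * Y) = Y. Proof. by rewrite odxM odxX odxY mulr0 addr0 mul1r. Qed.
Lemma odyXY : ody (X * Y) = X. Proof. by rewrite odyM odyX odyY mul0r add0r mulr1. Qed.

Lemma odx_chart2 s f : odx (chart2 s f) = chart2 s (odx f) * (oC s + Y) + chart2 s (ody f).
Proof.
rewrite /chart2 ocmp_dx odxX mulr1; congr (_ * _ + _).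
by rewrite odxM odxX odxD odxC odxY addr0 mul0r add0r mulr1.
Qed.
Lemma ody_chart2 s f : ody (chart2 s f) = chart2 s (odx f) * X.
Proof.
rewrite /chart2 ocmp_dy odyX mulr0 addr0; congr (_ * _).
by rewrite odyM odyX odyD odyC odyY add0r mul1r mulr0 addr0.
Qed.
Lemma odx_chart1 f : odx (chart1 f) = chart1 (ody f) * Y.
Proof. by rewrite /chart1 ocmp_dx odxY mulr0 add0r odxXY. Qed.
Lemma ody_chart1 f : ody (chart1 f) = chart1 (odx f) + chart1 (ody f) * X.
Proof. by rewrite /chart1 ocmp_dy odyY mulr1 odyXY. Qed.

Lemma odxX_pow0 n : ody (X ^+ n) = 0.
Proof.
case: n => [|n]; first by rewrite expr0 -(rmorph1 (@oC R K)) odyC.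
by rewrite odyXn odyX mulr0.
Qed.
Lemma odyY_pow0 n : odx (Y ^+ n) = 0.
Proof.
case: n => [|n]; first by rewrite expr0 -(rmorph1 (@oC R K)) odxC.
by rewrite odxXn odxY mulr0.
Qed.

Lemma chart2_X s : chart2 s X = (oC s + Y) * X.
Proof. by rewrite /chart2 ocmpX // chart2_p00. Qed.
Lemma chart2_Y s : chart2 s Y = X.
Proof. by rewrite /chart2 ocmpY // oX00. Qed.
Lemma chart1_X : chart1 X = Y. Proof. by rewrite /chart1 ocmpX // oY00. Qed.
Lemma chart1_Y : chart1 Y = X * Y. Proof. by rewrite /chart1 ocmpY // oXY00. Qed.

(** The form pulls back to [X^3 (Dc dX + Bc dY)], where [Bc] has value 1 at the origin: the
    foliation is regular and transverse to the divisor at every direction x = s y. *)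
Lemma chart2_FI A B f g L s d : T1 A B -> ordge d f -> ordge d g ->
  g * odx f - f * odx g = L * B -> g * ody f - f * ody g = - (L * A) ->
  let fc := oshx d (chart2 s f) in let gc := oshx d (chart2 s g) in
  oshx 2 (chart2 s B) * (gc * odx fc - fc * odx gc)
    = oshx 4 (chart2 s (Del A B)) * (gc * ody fc - fc * ody gc).
Proof.
move=> [oA oB iA iB [b b0 [oD iD]]] of_ og EU EV fc gc; pose P := chart2 s.
set Bc := oshx _ _; set Dc := oshx _ _.
have Pf : P f = X ^+ d * fc by exact: chart2_shift.
have Pg : P g = X ^+ d * gc by exact: chart2_shift.
have PB : P B = X ^+ 2 * Bc by exact: chart2_shift.
have PD : P (Del A B) = X ^+ 4 * Dc by exact: chart2_shift.
have PD' : X * ((oC s + Y) * P B - P A) = P (Del A B).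
  by rewrite /P /Del rmorphB !rmorphM /= chart2_X chart2_Y; ring.
have EX : X * (P g * odx (P f) - P f * odx (P g)) = P L * P (Del A B).
  rewrite -PD' /P !odx_chart2 -/P.
  have -> : P g * (P (odx f) * (oC s + Y) + P (ody f)) - P f * (P (odx g) * (oC s + Y) + P (ody g))
     = P (g * odx f - f * odx g) * (oC s + Y) + P (g * ody f - f * ody g).
    by rewrite /P !rmorphB !rmorphM /=; ring.
  by rewrite EU EV /P rmorphN !rmorphM /=; ring.
have EY : P g * ody (P f) - P f * ody (P g) = P L * P B * X.
  rewrite /P !ody_chart2 -/P.
  have -> : P g * (P (odx f) * X) - P f * (P (odx g) * X) = P (g * odx f - f * odx g) * X.
    by rewrite /P rmorphB !rmorphM /=; ring.
  by rewrite EU /P rmorphM.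
have wX : P g * odx (P f) - P f * odx (P g) = X ^+ d * X ^+ d * (gc * odx fc - fc * odx gc).
  by rewrite Pf Pg !odxM; ring.
have wY : P g * ody (P f) - P f * ody (P g) = X ^+ d * X ^+ d * (gc * ody fc - fc * ody gc).
  by rewrite Pf Pg !odyM odxX_pow0; ring.
have nz : X * (X ^+ d * X ^+ d) != 0 by rewrite !mulf_neq0 ?expf_neq0 ?oX_neq0.
apply: (mulfI nz).
have -> : X * (X ^+ d * X ^+ d) * (Bc * (gc * odx fc - fc * odx gc))
   = Bc * (X * (X ^+ d * X ^+ d * (gc * odx fc - fc * odx gc))) by ring.
have -> : X * (X ^+ d * X ^+ d) * (Dc * (gc * ody fc - fc * ody gc))
   = Dc * X * (X ^+ d * X ^+ d * (gc * ody fc - fc * ody gc)) by ring.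
by rewrite -wX -wY EX EY PB PD; ring.
Qed.

(** The form pulls back to [Y^3 (Dc dY - Ac dX)]. The value of [Dc] at the origin is [beta], so the
    foliation is regular, while [Ac] vanishes there: this is the tangency with the divisor. *)
Lemma chart1_FI A B f g L d : T1 A B -> ordge d f -> ordge d g ->
  g * odx f - f * odx g = L * B -> g * ody f - f * ody g = - (L * A) ->
  let fc := oshy d (chart1 f) in let gc := oshy d (chart1 g) in
  oshy 4 (chart1 (Del A B)) * (gc * odx fc - fc * odx gc)
    = - (oshy 2 (chart1 A) * (gc * ody fc - fc * ody gc)).
Proof.
move=> [oA oB iA iB [b b0 [oD iD]]] of_ og EU EV fc gc; pose P : O -> O := @chart1 R K.
set Dc := oshy _ _; set Ac := oshy _ _.
have Pf : P f = Y ^+ d * fc by exact: chart1_shift.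
have Pg : P g = Y ^+ d * gc by exact: chart1_shift.
have PA : P A = Y ^+ 2 * Ac by exact: chart1_shift.
have PD : P (Del A B) = Y ^+ 4 * Dc by exact: chart1_shift.
have PD' : Y * (P B - X * P A) = P (Del A B).
  by rewrite /P /Del rmorphB !rmorphM /= chart1_X chart1_Y; ring.
have EX : P g * odx (P f) - P f * odx (P g) = - (P L * P A * Y).
  rewrite /P !odx_chart1 -/P.
  have -> : P g * (P (ody f) * Y) - P f * (P (ody g) * Y) = P (g * ody f - f * ody g) * Y.
    by rewrite /P rmorphB !rmorphM /=; ring.
  by rewrite EV /P rmorphN rmorphM /=; ring.
have EY : Y * (P g * ody (P f) - P f * ody (P g)) = P L * P (Del A B).
  rewrite -PD' /P !ody_chart1 -/P.
  have -> : P g * (P (odx f) + P (ody f) * X) - P f * (P (odx g) + P (ody g) * X)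
     = P (g * odx f - f * odx g) + P (g * ody f - f * ody g) * X.
    by rewrite /P !rmorphB !rmorphM /=; ring.
  by rewrite EU EV /P rmorphN !rmorphM /=; ring.
have wX : P g * odx (P f) - P f * odx (P g) = Y ^+ d * Y ^+ d * (gc * odx fc - fc * odx gc).
  by rewrite Pf Pg !odxM odyY_pow0; ring.
have wY : P g * ody (P f) - P f * ody (P g) = Y ^+ d * Y ^+ d * (gc * ody fc - fc * ody gc).
  by rewrite Pf Pg !odyM; ring.
have nz : Y * (Y ^+ d * Y ^+ d) != 0 by rewrite !mulf_neq0 ?expf_neq0 ?oY_neq0.
apply: (mulfI nz).
have -> : Y * (Y ^+ d * Y ^+ d) * (Dc * (gc * odx fc - fc * odx gc))
   = Dc * Y * (Y ^+ d * Y ^+ d * (gc * odx fc - fc * odx gc)) by ring.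
have -> : Y * (Y ^+ d * Y ^+ d) * - (Ac * (gc * ody fc - fc * ody gc))
   = - (Ac * (Y * (Y ^+ d * Y ^+ d * (gc * ody fc - fc * ody gc)))) by ring.
by rewrite -wX -wY EX EY PA PD; ring.
Qed.

Lemma shiftpoly_neq0 (u : {poly K}) s : u != 0 -> exists j, (u \Po ('X + s%:P))`_j != 0.
Proof.
move=> u0; have : u \Po ('X + s%:P) != 0.
  by rewrite -size_poly_eq0 size_comp_poly2 ?size_poly_eq0 // size_XaddC.
by rewrite -lead_coef_eq0 lead_coefE => h; exists (size (u \Po ('X + s%:P))).-1.
Qed.
Lemma shiftpoly_0 (u : {poly K}) s : (u \Po ('X + s%:P))`_0 = u.[s].
Proof. by rewrite -horner_coef0 horner_comp hornerD hornerX hornerC add0r. Qed.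

Lemma chart2_B00 A B s : T1 A B -> oshx 2 (chart2 s B) 0%N 0%N = 1.
Proof. by move=> [oA oB iA iB _]; rewrite chart2_lead // shiftpoly_0 iB hornerC. Qed.
Lemma chart1_D00 A B beta : ordge 4 (Del A B) -> ip 4 (Del A B) = beta *: 'X^4 ->
  oshy 4 (chart1 (Del A B)) 0%N 0%N = beta.
Proof. by move=> oD iD; rewrite chart1_lead //= iD coefZ coefXn eqxx mulr1. Qed.

(** A common root would be a base point of the strict transforms at a regular point of the blown-up
    foliation. Coprimality enters as a power of y in [(f, g)], which pulls back to a power of the
    equation of the divisor. *)
Lemma FI_no_common_root A B f g d s : T1 A B -> FI A B f g -> ocoprime f g ->
  ordge d f -> ordge d g -> ip d f != 0 -> ip d g != 0 ->
  (ip d f).[s] != 0 \/ (ip d g).[s] != 0.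
Proof.
move=> T E cop of_ og if_ ig; have [L [EU EV]] := FI_factor T E.
have g_neq0 : g != 0.
  by apply/eqP => e; move/eqP: ig; apply; rewrite e ip_ordgeS.
have [N [a [b Yab]]] := coprime_Ypow g_neq0 cop.
have := chart2_FI s T of_ og EU EV; set fc := oshx _ _; set gc := oshx _ _; cbv zeta.
set Bc := oshx _ _; set Dc := oshx _ _ => W.
have uB : Bc \is a GRing.unit by rewrite ounitE (chart2_B00 s T) oner_eq0.
pose sg := - (Dc / Bc).
have W' : gc * (odx fc + sg * ody fc) = fc * (odx gc + sg * ody gc).
  apply: (mulrI uB).
  have e1 : Bc * sg = - Dc by rewrite /sg mulrN mulrCA mulrV // mulr1.
  have -> : Bc * (gc * (odx fc + sg * ody fc)) = Bc * (gc * odx fc - fc * odx gc) + Bc * fc * odx gc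
     + Bc * sg * gc * ody fc by ring.
  have -> : Bc * (fc * (odx gc + sg * ody gc)) = Bc * fc * odx gc + Bc * sg * fc * ody gc by ring.
  by rewrite W e1; ring.
have ab : (chart2 s a * X ^+ d) * fc + (chart2 s b * X ^+ d) * gc = X ^+ N * Y ^+ 0.
  have := congr1 (chart2 s) Yab; rewrite rmorphXn rmorphD !rmorphM /= chart2_Y expr0 mulr1 => ->.
  by rewrite (chart2_shift s of_) (chart2_shift s og) -/fc -/gc; ring.
have f0 j : fc 0%N j = (ip d f \Po ('X + s%:P))`_j by exact: chart2_lead.
have g0 j : gc 0%N j = (ip d g \Po ('X + s%:P))`_j by exact: chart2_lead.
rewrite -!shiftpoly_0 -f0 -g0.
have := @chart_no_base_point R K (cgval fc) (cgval gc) (cgval sg)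
   (cgval (chart2 s a * X ^+ d)) (cgval (chart2 s b * X ^+ d)) N 0; apply.
- by have := congr1 (@cgval R K) W'; rewrite !cgM !cgD !cgM !odxE !odyE.
- by have := congr1 (@cgval R K) ab; rewrite cgD !(cgM (_ * _)) !(cgM (X ^+ _)) !cgX.
- apply/orP; left; have [j hj] := shiftpoly_neq0 s if_; apply/eqP => /(congr1 (fun u : fps K => u j)).
  by rewrite f0 => e; rewrite e eqxx in hj.
- by left.
Qed.

(** The direction y = 0 needs its own argument: y pulls back to [X Y], so the relation from
    coprimality also carries a power of [X], the strict transform of y = 0. *)
Lemma FI_no_common_root_y A B f g d : T1 A B -> FI A B f g -> ocoprime f g ->
  ordge d f -> ordge d g -> ip d f != 0 -> ip d g != 0 ->
  (ip d f)`_d != 0 \/ (ip d g)`_d != 0.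
Proof.
move=> T E cop of_ og if_ ig; have [L [EU EV]] := FI_factor T E.
have g_neq0 : g != 0.
  by apply/eqP => e; move/eqP: ig; apply; rewrite e ip_ordgeS.
have [N [a [b Yab]]] := coprime_Ypow g_neq0 cop.
have [oA oB iA iB [be be0 [oD iD]]] := T.
have := chart1_FI T of_ og EU EV; set fc := oshy _ _; set gc := oshy _ _; cbv zeta.
set Dc := oshy _ _; set Ac := oshy _ _ => W.
have uD : Dc \is a GRing.unit by rewrite ounitE (chart1_D00 oD iD).
pose sg := Ac / Dc.
have W' : gc * (odx fc + sg * ody fc) = fc * (odx gc + sg * ody gc).
  apply: (mulrI uD).
  have e1 : Dc * sg = Ac by rewrite /sg mulrCA mulrV // mulr1.
  have -> : Dc * (gc * (odx fc + sg * ody fc)) = Dc * (gc * odx fc - fc * odx gc) + Dc * fc * odx gc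
     + Dc * sg * gc * ody fc by ring.
  have -> : Dc * (fc * (odx gc + sg * ody gc)) = Dc * fc * odx gc + Dc * sg * fc * ody gc by ring.
  by rewrite W e1; ring.
have ab : (chart1 a * Y ^+ d) * fc + (chart1 b * Y ^+ d) * gc = X ^+ N * Y ^+ N.
  have := congr1 (@chart1 R K) Yab; rewrite rmorphXn rmorphD !rmorphM /= chart1_Y exprMn => ->.
  by rewrite (chart1_shift of_) (chart1_shift og) -/fc -/gc; ring.
have f0 i : fc i 0%N = if (i <= d)%N then (ip d f)`_(d - i) else 0 by exact: chart1_lead.
have g0 i : gc i 0%N = if (i <= d)%N then (ip d g)`_(d - i) else 0 by exact: chart1_lead.
have -> : (ip d f)`_d = fc 0%N 0%N by rewrite f0 /= subn0.
have -> : (ip d g)`_d = gc 0%N 0%N by rewrite g0 /= subn0.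
have nz (u : O) : ip d u != 0 -> exists2 i, (i <= d)%N & (ip d u)`_(d - i) != 0.
  move=> u0; exists (d - (size (ip d u)).-1)%N; first by rewrite leq_subr.
  rewrite subKn; last by have := size_ip d u; case: (size _).
  by rewrite -lead_coefE lead_coef_eq0.
have := @chart_no_base_point R K (cgval fc) (cgval gc) (cgval sg)
   (cgval (chart1 a * Y ^+ d)) (cgval (chart1 b * Y ^+ d)) N N; apply.
- by have := congr1 (@cgval R K) W'; rewrite !cgM !cgD !cgM !odxE !odyE.
- by have := congr1 (@cgval R K) ab; rewrite cgD !(cgM (_ * _)) !(cgM (X ^+ _)) !cgX.
(* If both strict transforms vanished on [X = 0], y would divide [f] and [g]. *)
- apply: contraT; rewrite negb_or !negbK => /andP[/eqP f00 /eqP g00].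
  have dv (u : O) : ordge d u -> cgval (oshy d (chart1 u)) 0%N = 0 -> exists q, u = Y * q.
    move=> ou u00; pose F : series2 K := fun i j => if j is 0%N then u i 0%N else 0.
    have oF : onlyX F by move=> i [].
    have uE : cgval u = F + gY * shy 1 u.
      apply: germP => i j; rewrite germD gYM /F /shy.
      by case: j => [|j]; rewrite ?addr0 // add0r addn1.
    have F0 : F = 0.
      have h : cgval (chart1 u) 0%N = 0.
        rewrite (chart1_shift ou) cgM fpsM0 u00 mulr0 //.
      have : cgval (chart1 u) = gcomp gY (X * Y : O) F + (gX * gY) * gcomp gY (X * Y : O) (shy 1 u).
        by rewrite /chart1 /= {1}uE rmorphD rmorphM /= compY cutE ?germM00 ?gXE ?mul0r.
      move/(congr1 (fun v : series2 K => v 0%N)); rewrite h fpsD -mulrA fpsM0 mul0r addr0 => F0.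
      apply: germP => i [|j] //; have := congr1 (fun v : fps K => v i) F0.
      by rewrite gcomp_onlyX_Y.
    by exists (oshy 1 u); apply: cgP; rewrite cgM -[cgval (oshy 1 u)]/(shy 1 u) {1}uE F0 add0r.
  have := cop Y (dv f of_ f00) (dv g og g00).
  by rewrite oY00 eqxx.
- right; split.
    by have [i le h] := nz f if_; exists i; rewrite f0 le.
  by have [i le h] := nz g ig; exists i; rewrite g0 le.
Qed.
End Charts.

(** * Leaves *)

Section Leaves.
Variables (R : realFieldType) (K : absField R).
Local Notation O := (cgerm K).
Local Notation X := (oX K).
Local Notation Y := (oY K).
Implicit Types A B f g L u v w : O.

(** Order and leading coefficient of a germ restricted to a leaf with parameter [X]; the value [c]
    may be 0, in which case only a lower bound on the order is recorded. *)
Definition lead n (c : K) u := exists2 w : O, u = X ^+ n * w & w 0%N 0%N = c.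

Lemma leadM n m c e u v : lead n c u -> lead m e v -> lead (n + m) (c * e) (u * v).
Proof.
move=> [w -> w0] [z -> z0]; exists (w * z); last by rewrite cgM germM00 w0 z0.
by rewrite exprD; ring.
Qed.
Lemma leadD n c e u v : lead n c u -> lead n e v -> lead n (c + e) (u + v).
Proof.
move=> [w -> w0] [z -> z0]; exists (w + z); last by rewrite cgD germD w0 z0.
by rewrite mulrDr.
Qed.
Lemma leadN n c u : lead n c u -> lead n (- c) (- u).
Proof. by move=> [w -> w0]; exists (- w); rewrite ?mulrN // cgN germN w0. Qed.
Lemma leadX n c k u : lead n c u -> lead (n * k) (c ^+ k) (u ^+ k).
Proof.
move=> h; elim: k => [|k IH]; last by rewrite mulnS !exprS; apply: leadM.
by rewrite muln0; exists 1 => //; rewrite mulr1.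
Qed.
Lemma lead_eq n c e u : lead n c u -> lead n e u -> c = e.
Proof.
move=> [w -> w0] [z E z0]; rewrite -w0 -z0; congr (cgval _ _ _).
by apply: mulfI E; rewrite expf_neq0 ?oX_neq0.
Qed.
Lemma leadW n m c u : (m < n)%N -> lead n c u -> lead m 0 u.
Proof.
move=> lt [w -> w0]; exists (X ^+ (n - m) * w).
  by rewrite mulrA -exprD subnKC // ltnW.
rewrite cgM germM00 (_ : (n - m)%N = (n - m).-1.+1); last by lia.
by rewrite exprS cgM germM00 oX00 !mul0r.
Qed.
Lemma lead0 n : lead n 0 0. Proof. by exists 0; rewrite ?mulr0. Qed.
Lemma lead_dx n c u : lead n c u -> lead n (n%:R * c) (X * odx u).
Proof.
move=> [w -> w0]; case: n => [|n].
  exists (X * odx w); first by rewrite !expr0 !mul1r.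
  by rewrite cgM germM00 oX00 !mul0r.
exists (n.+1%:R * w + X * odx w).
  by rewrite odxM odxXn odxX exprS; ring.
rewrite cgD germD !cgM !germM00 oX00 mul0r addr0 w0; congr (_ * _).
by rewrite -(rmorph_nat (@oC R K)).
Qed.
Lemma onlyX_lead u : onlyX u -> u != 0 -> exists n c, c != 0 /\ lead n c u.
Proof.
move=> ou u0; have u0' : cgval u != 0 by apply: contra u0 => /eqP e; apply/eqP/cgP.
have [n [un uz]] := fps_neq0P u0'; exists n, (u n 0%N); split.
  apply: contra un => /eqP e; apply/eqP; apply: fpsP => -[|j]; first by rewrite e fps0.
  by rewrite ou.
exists (oshx n u); last by rewrite /= /shx add0n.
by apply: cgP; rewrite cgM cgX; apply/esym/shxK => i j lt; rewrite uz.
Qed.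

(** Indicial equation on a leaf where the vector field is [e d/dX]. The hypothesis equates the
    logarithmic derivative of [G] with that of [k] plus [kap / e], and residues at the origin are
    [n2], [n1] and [k0 / e0]. *)
Lemma lead_ode a e0 k0 n1 n2 c1 c2 (G k e kap : O) :
  c1 != 0 -> c2 != 0 -> lead n2 c2 G -> lead n1 c1 k -> lead a.+1 e0 e -> lead a k0 kap ->
  G * (kap * k + e * odx k) = k * (e * odx G) -> k0 + e0 * n1%:R = e0 * n2%:R.
Proof.
move=> c10 c20 hG hk he hkap E.
have hX : lead 1 1 X by exists 1; rewrite ?mulr1.
have l1 : lead (n2 + (a.+1 + n1)) (c2 * (1 * k0 * c1 + e0 * (n1%:R * c1)))
    (G * (X * kap * k + e * (X * odx k))).
  by apply: leadM => //; apply: leadD; [apply: leadM => //; apply: (leadM hX)|apply: leadM => //; apply: lead_dx].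
have l2 : lead (n1 + (a.+1 + n2)) (c1 * (e0 * (n2%:R * c2))) (k * (e * (X * odx G))).
  by apply: leadM => //; apply: leadM => //; apply: lead_dx.
have E' : G * (X * kap * k + e * (X * odx k)) = k * (e * (X * odx G)).
  have -> : G * (X * kap * k + e * (X * odx k)) = X * (G * (kap * k + e * odx k)) by ring.
  by rewrite E; ring.
rewrite E' (_ : n2 + (a.+1 + n1) = n1 + (a.+1 + n2))%N in l1; last by lia.
have := lead_eq l1 l2 => e1; apply: (mulfI (mulf_neq0 c10 c20)).
have -> : c1 * c2 * (k0 + e0 * n1%:R) = c2 * (1 * k0 * c1 + e0 * (n1%:R * c1)) by ring.
by rewrite e1; ring.
Qed.

Lemma germM10 (f g : series2 K) :
  (f * g) 1%N 0%N = f 0%N 0%N * g 1%N 0%N + f 1%N 0%N * g 0%N 0%N.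
Proof. by rewrite germM big_ord_recl big_ord1 !big_ord1. Qed.

Lemma comp_id (f : series2 K) : gcomp gX gY f = f.
Proof.
apply: eq_ordge => n; have := @comp_trunc _ gX gY f n.
rewrite (cutE (gXE K 0 0)) (cutE (gYE K 0 0)) -toGE => h.
have abel (a b c : series2 K) : a - b = (a - c) - (b - c) by ring.
by rewrite (abel _ _ (toG (trunc n f))); apply: woB => //; apply: trunc_ord.
Qed.

Lemma gcomp_onlyY_X (p F : series2 K) i j : (forall a b, (0 < a)%N -> F a b = 0) ->
  gcomp p gX F i j = if j is 0%N then F 0%N i else 0.
Proof.
move=> hF; pose u : {poly K} := \poly_(k < (i + j).+1) F 0%N k.
have h : ordge (i + j).+1 (F - toG u%:P).
  apply/ordgeP => k l lt; rewrite germB /toG coefC.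
  case: k lt => [|k] lt /=; last by rewrite hF // coef0 subr0.
  by rewrite coef_poly lt subrr.
have := comp_ev p gX h (i := i) (j := j); rewrite !mul1n ltnSn => /(_ isT)/eqP.
rewrite germB subr_eq0 => /eqP ->.
have -> : evG (cut p) (cut gX) u%:P = toG (map_poly polyC u).
  rewrite toGE evC (cutE (gXE K 0 0)) /ev -map_poly_comp [LHS]/ev1; congr (_.[_]).
  by apply: eq_map_poly => c /=; rewrite ev1C.
rewrite /toG coef_map_id0 // coefC; case: j {h} @u => [|j] //=.
by rewrite coef_poly addn0 ltnSn.
Qed.

(* nu is a series in its first variable, so this is the curve x = nu(y). *)
Definition graph (nu : O) : O := X - ocmp Y 0 nu.

(** Division by [x - nu(y)] leaves a remainder in y alone, and restriction to the curve is injective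
    on such series. *)
Lemma graph_prime (nu : O) : onlyX nu -> nu 0%N 0%N = 0 ->
  ocmp nu X (graph nu) = 0 /\ forall f, ocmp nu X f = 0 -> exists q, f = graph nu * q.
Proof.
move=> on n0.
have e0 : (0 : O) 0%N 0%N = 0 by [].
have gl : ocmp nu X (graph nu) = 0.
  rewrite /graph rmorphB /= ocmpX // ocmp_assoc ocmpY ?oX00 //.
  apply/eqP; rewrite subr_eq0; apply/eqP; apply: cgP => /=.
  by rewrite (comp_onlyX _ _ gY on) comp_id.
split=> // f fE.
have lE i j : (0 < i)%N -> (ocmp Y 0 nu) i j = 0.
  by case: i => // i _; rewrite /= gcomp_onlyX_Y.
have [||q [r [E hr]]] := @weierstrass_division _ _ (graph nu) f 1.
- by case=> // _; rewrite /graph cgB germB oX00 /= comp00 n0 subr0.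
- by rewrite /graph cgB germB lE // subr0 /= gXE /= oner_eq0.
have r0 : r = 0.
  have : ocmp nu X r = 0.
    have -> : r = f - q * graph nu by rewrite E addrC addKr.
    by rewrite rmorphB rmorphM /= fE gl mulr0 subr0.
  move=> h; apply: cgP; apply: germP => -[|i] j; last by rewrite hr.
  have := congr1 (fun u : O => u j 0%N) h; rewrite /= gcomp_onlyY_X // => a b; exact: hr.
by exists q; rewrite E r0 addr0 mulrC.
Qed.

Lemma graph_ip (nu : O) : onlyX nu -> nu 0%N 0%N = 0 ->
  ordge 1 (graph nu) /\ ip 1 (graph nu) = 'X - (nu 1%N 0%N)%:P.
Proof.
move=> on n0; split.
  by apply/ordge1P; rewrite /graph cgB germB oX00 /= comp00 n0 subr0.
apply/polyP => i; rewrite coef_ip coefB coefX coefC /graph cgB !germB /=.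
rewrite gXE gcomp_onlyX_Y //.
by case: i => [|[|i]] //=; rewrite ?subr0.
Qed.

(** The leaf through the point [s] of the divisor solves [c' = - Dc / Bc] in the chart, by
    transversality, and blows down to [x = (s + c(y)) y]. *)
Lemma graph_leaf A B s : T1 A B -> exists nu : O,
  [/\ onlyX nu, nu 0%N 0%N = 0, nu 1%N 0%N = s, ocmp nu X A = odx nu * ocmp nu X B &
    forall n f, ordge n f -> lead n (ip n f).[s] (ocmp nu X f)].
Proof.
move=> T; have [oA oB iA iB [b b0 [oD iD]]] := T.
pose Bc := oshx 2 (chart2 s B); pose Dc := oshx 4 (chart2 s (Del A B)).
have B00 : Bc 0%N 0%N = 1 := chart2_B00 s T.
have uB : Bc \is a GRing.unit by rewrite ounitE B00 oner_eq0.
have [c [c0 oc dc]] := ode_solution (- (Dc / Bc)).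
pose nu := (oC s + c) * X.
have nu0 : nu 0%N 0%N = 0 by rewrite cgM germM00 oX00 mulr0.
have rhoE f : ocmp nu X f = ocmp X c (chart2 s f).
  rewrite /chart2 ocmp_assoc rmorphM rmorphD /= ocmpC ocmpX ?oX00 // ocmpY //.
have hD : odx c * ocmp X c Bc = - ocmp X c Dc.
  rewrite dc -rmorphM /= -rmorphN /= mulNr divrK //.
exists nu; split=> //.
- apply: onlyXM; last exact: onlyX_X.
  exact: onlyXD (onlyXC _) oc.
- by rewrite /nu mulrC cgM gXM cgD germD /= c0 addr0.
- have PB : chart2 s B = X ^+ 2 * Bc by exact: chart2_shift.
  have PD : chart2 s (Del A B) = X ^+ 4 * Dc by exact: chart2_shift.
  have PD' : X * ((oC s + Y) * chart2 s B - chart2 s A) = chart2 s (Del A B).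
    by rewrite /Del rmorphB !rmorphM /= chart2_X chart2_Y; ring.
  have E := congr1 (ocmp X c) PD'.
  rewrite PD [LHS]rmorphM [RHS]rmorphM rmorphB rmorphM rmorphD /= ocmpC rmorphXn /= ocmpX ?oX00 // ocmpY // -!rhoE in E.
  have rB : ocmp nu X B = X ^+ 2 * ocmp X c Bc.
    by rewrite rhoE PB rmorphM rmorphXn /= ocmpX ?oX00.
  apply: (mulfI (oX_neq0 K)); apply/eqP; rewrite -subr_eq0; apply/eqP.
  have -> : X * ocmp nu X A - X * (odx nu * ocmp nu X B)
     = - (X * ((oC s + c) * ocmp nu X B - ocmp nu X A)) - X * X * odx c * ocmp nu X B.
    by rewrite /nu odxM odxD odxC odxX; ring.
  rewrite E rB (_ : X * X * odx c * _ = X ^+ 4 * (odx c * ocmp X c Bc)); last by ring.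
  by rewrite hD; ring.
move=> n f of_; exists (ocmp X c (oshx n (chart2 s f))).
  by rewrite rhoE {1}(chart2_shift s of_) rmorphM rmorphXn /= ocmpX ?oX00.
by rewrite /= comp00 -[LHS]/(oshx n (chart2 s f) 0%N 0%N) chart2_lead // shiftpoly_0.
Qed.

Lemma leaf_vfield A B (p q e : O) f :
  ocmp p q A = e * odx p -> ocmp p q B = e * odx q ->
  ocmp p q (vfield A B f) = e * odx (ocmp p q f).
Proof. by move=> eA eB; rewrite /vfield rmorphD !rmorphM /= eA eB ocmp_dx; ring. Qed.

Lemma graph_vfield A B (nu : O) f : ocmp nu X A = odx nu * ocmp nu X B ->
  ocmp nu X (vfield A B f) = ocmp nu X B * odx (ocmp nu X f).
Proof. by move=> e; apply: leaf_vfield; rewrite ?odxX ?mulr1 // e mulrC. Qed.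

(** The leaf through the tangency is [Y = c(X)] with [c' = Ac / Dc], whose first term along it is
    [X / beta]; so [c] begins with [X^2 / (2 beta)]. Blown down it is the cusp [(c, X c)], with x of
    order 2 and y of order 3, and the vector field becomes [e d/dX] for [e = c^2 Dc]. *)
Lemma cusp_leaf A B beta : T1 A B -> beta != 0 -> ordge 4 (Del A B) -> ip 4 (Del A B) = beta *: 'X^4 ->
  exists (c e : O), [/\ onlyX c, lead 2 (2 * beta)^-1 c, lead 4 (4 * beta)^-1 e,
    ocmp c (X * c) A = e * odx c /\ ocmp c (X * c) B = e * odx (X * c) &
    forall n f, ordge n f -> lead (2 * n) ((2 * beta)^-1 ^+ n * (ip n f)`_n) (ocmp c (X * c) f)].
Proof.
move=> T b0 oD iD; have [oA oB iA iB _] := T.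
pose Ac := oshy 2 (chart1 A); pose Dc := oshy 4 (chart1 (Del A B)).
have D00 : Dc 0%N 0%N = beta := chart1_D00 oD iD.
have uD : Dc \is a GRing.unit by rewrite ounitE D00.
have A0 i : Ac i 0%N = if (i <= 2)%N then ('X : {poly K})`_(2 - i) else 0 by rewrite chart1_lead // iA.
have [sg sgE] : exists sg : O, Ac = sg * Dc by exists (Ac / Dc); rewrite divrK.
have [c [c0 oc dc]] := ode_solution sg.
have s00 : sg 0%N 0%N = 0.
  have := A0 0%N; rewrite sgE cgM germM00 D00 coefX /= => /eqP.
  by rewrite mulf_eq0 (negPf b0) orbF => /eqP.
have s10 : sg 1%N 0%N = beta^-1.
  have := A0 1%N; rewrite sgE cgM germM10 s00 mul0r add0r D00 coefX => e.
  by apply: (mulIf b0); rewrite e mulVf.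
have cE i : c i.+1 0%N *+ i.+1 = ocmp X c sg i 0%N.
  by rewrite -dc /= dxE.
have c1 : c 1%N 0%N = 0 by have := cE 0%N; rewrite mulr1n /= comp00 s00.
have c2 : c 2%N 0%N = (2 * beta)^-1.
  pose P : {poly {poly K}} := (sg 1%N 0%N)%:P%:P * 'X + (sg 0%N 1%N)%:P%:P * 'X%:P.
  have hP : ordge 2 (cgval sg - toG P).
    have -> : toG P = gC (sg 1%N 0%N) * gX + gC (sg 0%N 1%N) * gY.
      by rewrite toGE rmorphD !rmorphM /= evX !evC !ev1C ev1X.
    apply/ordgeP => i j lt; rewrite germB germD !gCM gXE gYE.
    case: i j lt => [|[|i]] [|[|j]] //= _; rewrite ?mulr0 ?mulr1 ?addr0 ?add0r ?s00 ?subrr //.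
  have := comp_ev gX c hP (i := 1%N) (j := 0%N) isT; rewrite germB.
  rewrite rmorphD !rmorphM /= evX !evC !ev1C ev1X (cutE (gXE K 0 0)) cutE // germD !gCM gXE c1 mulr0 addr0 mulr1.
  move/eqP; rewrite subr_eq0 s10 => /eqP e.
  have := cE 1%N; rewrite -[ocmp X c sg 1%N 0%N]/(gcomp gX c sg 1%N 0%N) e => e2.
  by apply: (mulfI (natK_neq0 K 1)); rewrite [LHS]mulr_natl e2 invfM mulVKf // natK_neq0.
have gamE f : ocmp c (X * c) f = ocmp X c (chart1 f).
  by rewrite /chart1 ocmp_assoc rmorphM /= ocmpX ?oX00 // ocmpY.
have lc : lead 2 (2 * beta)^-1 c.
  exists (oshx 2 c); last by rewrite -c2.
  apply: cgP; rewrite cgM cgX; apply/esym/shxK => i [|j] lt; last by rewrite oc.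
  by case: i lt => [|[|i]].
have hD : odx c * ocmp X c Dc = ocmp X c Ac by rewrite dc -rmorphM /= -sgE.
pose e := c ^+ 2 * ocmp X c Dc.
have gY : ocmp X c Y = c by rewrite ocmpY.
have gA : ocmp c (X * c) A = e * odx c.
  rewrite gamE (chart1_shift oA) rmorphM rmorphXn /= gY -/Ac -hD /e; ring.
have gD : ocmp c (X * c) (Del A B) = c ^+ 4 * ocmp X c Dc.
  by rewrite gamE (chart1_shift oD) rmorphM rmorphXn /= gY.
have cn0 : c != 0.
  by apply/eqP => e0; move: c2; rewrite e0 /= => /esym/eqP; rewrite invr_eq0 mulf_eq0 (negPf b0) (negPf (natK_neq0 K 1)).
exists c, e; split=> //.
- have := leadM (leadX 2 lc) (_ : lead 0 beta (ocmp X c Dc)).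
  have -> : (2 * beta)^-1 ^+ 2 * beta = (4 * beta)^-1.
    rewrite -[4%:R]/((2 * 2)%:R) natrM; field.
    by rewrite ?b0 ?(natK_neq0 K 1) ?(natK_neq0 K 3).
  by apply; exists (ocmp X c Dc); rewrite ?mul1r // /= comp00 -D00.
- split=> //; apply: (mulfI cn0).
  have := gD; rewrite /Del rmorphB !rmorphM /= ocmpX // ocmpY; last by rewrite cgM germM00 oX00 mul0r.
  rewrite gA => /eqP; rewrite subr_eq => /eqP ->.
  by rewrite odxM odxX /e; ring.
move=> n f of_; rewrite gamE (chart1_shift of_) rmorphM rmorphXn /= gY.
have := leadM (leadX n lc) (_ : lead 0 ((ip n f)`_n) (ocmp X c (oshy n (chart1 f)))).
rewrite addn0; apply; exists (ocmp X c (oshy n (chart1 f))); rewrite ?mul1r //.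
by rewrite /= comp00 -[LHS]/(oshy n (chart1 f) 0%N 0%N) chart1_lead //= subn0.
Qed.
End Leaves.

(** * The cuspidal leaf and the degree of the Wronskian *)

Lemma coefM_top (A : nzRingType) (p q : {poly A}) a b :
  (size p <= a.+1)%N -> (size q <= b.+1)%N -> (p * q)`_(a + b) = p`_a * q`_b.
Proof.
move=> sp sq; rewrite coefM; have lt : (a < (a + b).+1)%N by rewrite ltnS leq_addr.
rewrite (bigD1 (Ordinal lt)) //= addKn big1 ?addr0 // => i; rewrite -val_eqE /= neq_ltn => /orP[l|l].
  by rewrite [q`__]nth_default ?mulr0 // (leq_trans sq) //; have := ltn_ord i; lia.
by rewrite [p`__]nth_default ?mul0r // (leq_trans sp).
Qed.

Section Cusp.
Variables (R : realFieldType) (K : absField R).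
Local Notation O := (cgerm K).
Local Notation X := (oX K).
Local Notation Y := (oY K).
Implicit Types A B f g L u v w : O.

(** Euler's relation, dehomogenized at y = 1. *)
Lemma ip_dy n (f : series2 K) : ip n (dy f) = n.+1%:R *: ip n.+1 f - 'X * (ip n.+1 f)^`().
Proof.
apply/polyP => i; rewrite coefB coefZ coefXM coef_deriv !coef_ip dyE.
case: i => [|i] /=; first by rewrite !subn0 subr0 mulr_natl.
case: (ltnP i n) => [lt|ge].
  rewrite ltnW // (_ : (n - i.+1).+1 = n.+1 - i.+1)%N; last by lia.
  by rewrite mulr_natl -mulrnBr ?subSS //; lia.
case: ltnP => [lt|]; last by rewrite mulr0 mul0rn subr0.
by rewrite (_ : i = n) ?mulr_natl ?subrr //; lia.
Qed.

Lemma ord_uniq n m (f : series2 K) : ordge n f -> ip n f != 0 -> ordge m f -> ip m f != 0 -> n = m.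
Proof.
move=> on in_ om im; case: (ltngtP n m) => // lt.
  by case/negP: in_; apply/eqP; apply: ip_ordgeS; apply: woW om.
by case/negP: im; apply/eqP; apply: ip_ordgeS; apply: woW on.
Qed.

Lemma comp_onlyY (p p' q : series2 K) (F : series2 K) : (forall a b, (0 < a)%N -> F a b = 0) ->
  gcomp p q F = gcomp p' q F.
Proof.
move=> hF; apply: eq_ordge => n; pose P := trunc n F.
have e : evG (cut p) (cut q) P = evG (cut p') (cut q) P.
  have S1 : (size P <= n)%N by exact: size_poly.
  have S2 i : (size (P`_i)%R <= n)%N.
    by rewrite coef_poly; case: ifP => _; rewrite ?size_poly ?size_poly0.
  rewrite (@ev_sum _ _ _ (cut p) (cut q) _ _ S1 S2) (@ev_sum _ _ _ (cut p') (cut q) _ _ S1 S2).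
  apply: eq_bigr => -[[|i] lti] _; first by rewrite !expr0.
  apply: eq_bigr => j _; rewrite -[val (Ordinal lti)]/i.+1.
  have cP : P`_i.+1`_j = 0 by rewrite -[LHS]/(toG P i.+1 j) toG_trunc hF // if_same.
  have z (u : series2 K) : gC 0 * u = 0 by apply: germP => a b; rewrite gCM mul0r.
  by rewrite cP [LHS]z [RHS]z.
have abel (a b x : series2 K) : a - b = (a - x) - (b - x) by ring.
rewrite (abel _ _ (evG (cut p) (cut q) P)); apply: woB; first exact: comp_trunc.
by rewrite e; apply: comp_trunc.
Qed.

(* Hence the separatrix tangent to the exceptional divisor has multiplicity at most 2. *)
Lemma cusp_equation (c : O) : onlyX c -> c 0%N 0%N = 0 -> c 1%N 0%N = 0 -> c 2%N 0%N != 0 ->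
  exists2 Q : O, ocmp c (X * c) Q = 0 & Q 0%N 2%N = 1.
Proof.
move=> oc c0 c1 c2; pose D := Y - c.
have Xc0 : (X * c : O) 0%N 0%N = 0 by rewrite cgM germM00 oX00 mul0r.
have cc : ocmp X c c = c.
  by apply: cgP => /=; rewrite (comp_onlyX _ _ gY oc) comp_id.
have Y0 i : Y i 0%N = 0 by rewrite -[cgval Y]/gY gYE andbF.
have [||q [r [E hr]]] := @weierstrass_division _ _ D (X ^+ 2) 2.
- by case=> [|[]] // _; rewrite /D cgB germB Y0 ?c0 ?c1 subr0.
- by rewrite /D cgB germB Y0 sub0r oppr_eq0.
have er : X ^+ 2 = ocmp X c r.
  have := congr1 (ocmp X c) E; rewrite rmorphXn rmorphD rmorphM /= ocmpX ?oX00 //.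
  by rewrite /D rmorphB /= ocmpY // cc subrr mulr0 add0r.
pose R1 := oshx 1 r; pose R0 := r - X * R1.
have h1 a b : (0 < a)%N -> R1 a b = 0 by move=> lt; rewrite /= /shx hr // addn1.
have h0 a b : (0 < a)%N -> R0 a b = 0.
  case: a => // a _; rewrite /R0 cgB germB cgM gXM.
  by rewrite -[cgval R1 a b]/(cgval r (a + 1)%N b) addn1 subrr.
have sw (F : O) : (forall a b, (0 < a)%N -> F a b = 0) ->
    ocmp c (X * c) (ocmp 0 X F) = ocmp X c F.
  move=> hF; rewrite ocmp_assoc rmorph0 ocmpX //; apply: cgP => /=.
  exact: comp_onlyY.
exists (Y ^+ 2 - X * (Y * ocmp 0 X R1 + X * ocmp 0 X R0)).
  rewrite rmorphB rmorphXn rmorphM rmorphD !rmorphM /= ocmpX // ocmpY // !sw //.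
  have -> : (X * c) ^+ 2 - c * (X * c * ocmp X c R1 + c * ocmp X c R0)
     = c ^+ 2 * (X ^+ 2 - (X * ocmp X c R1 + ocmp X c R0)) by ring.
  rewrite {1}er /R0 rmorphB rmorphM /= ocmpX ?oX00 //; ring.
rewrite cgB germB cgM gXM subr0 cgX -[cgval Y]/gY -[gY ^+ 2]mulr1 gYnM germ1E //.
Qed.

(** The top coefficient of the Wronskian tests the direction y = 0, the one missed by x/y. The data
    there are obtained from orders of vanishing along the cusp. *)
Lemma cusp_wronskian A B f g h k kap m c :
  T1 A B -> FI A B f g -> ocoprime f g -> f != 0 -> g != 0 ->
  oirreducible h -> vfield A B h = h * kap ->
  ordge m h -> ip m h = c%:P -> c != 0 ->
  f = h * k -> ~ (exists q, f = h * h * q) ->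
  exists d, [/\ ordge d.+2 f, ordge d.+2 g, ip d.+2 f != 0, ip d.+2 g != 0 &
    (ip d.+2 g * (ip d.+2 f)^`() - ip d.+2 f * (ip d.+2 g)^`())`_((d + d).+1) != 0].
Proof.
move=> T E cop f_neq0 g_neq0 irr vh oh ih c_neq0 fE nh2.
have [h_neq0 h00 _] := irr.
have m0 : (0 < m)%N.
  rewrite lt0n; apply/eqP => m0; move: ih; rewrite m0 ip_0 h00 => /polyC_inj e.
  by rewrite -e eqxx in c_neq0.
have [oA oB iA iB [beta b0 [oD iD]]] := T.
have [x [e [ox lx le [eA eB] lf]]] := cusp_leaf T b0 oD iD.
pose gam := ocmp x (X * x).
have x00 : x 0%N 0%N = 0.
  by case: lx => w -> _; rewrite cgM cgX -[cgval X]/gX gXnM.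
have x1 : x 1%N 0%N = 0.
  by case: lx => w -> _; rewrite cgM cgX -[cgval X]/gX gXnM.
have b2 : (2 * beta)^-1 != 0 by rewrite invr_eq0 mulf_neq0 // (natK_neq0 K 1).
have b4 : (4 * beta)^-1 != 0 by rewrite invr_eq0 mulf_neq0 // (natK_neq0 K 3).
have b24 : (2 * beta)^-1 = 2 * (4 * beta)^-1.
  by field; rewrite ?b0 ?(natK_neq0 K 1) ?(natK_neq0 K 3).
have x2 : x 2%N 0%N != 0.
  by case: lx => w -> w0; rewrite cgM cgX -[cgval X]/gX gXnM /= subnn w0.
have Xx0 : (X * x : O) 0%N 0%N = 0 by rewrite cgM germM00 oX00 mul0r.
have gamX : gam X = x by rewrite /gam ocmpX.
have gamY : gam Y = X * x by rewrite /gam ocmpY.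
have gamC a : gam (oC a) = oC a by rewrite /gam ocmpC.
have ogam u : onlyX (gam u).
  by apply: onlyX_comp => //; apply: onlyXM => //; apply: onlyX_X.
have gv u : gam (vfield A B u) = e * odx (gam u) by apply: leaf_vfield.
have lX : lead 1 1 X by exists 1; rewrite ?mulr1.
(* The vector field begins with y times the Euler field and [h] with [c y^m], so the cofactor of [h]
   begins with [m y]. *)
have [ok ik] : ordge 1 kap /\ ip 1 kap = m%:R%:P.
  have ih_neq0 : ip m h != 0 by rewrite ih polyC_eq0.
  have ov : ordge (m + 1) (vfield A B h).
    rewrite cgD !cgM !odxE !odyE; apply: woD.
      by apply: woW (woM oA (ordge_dx oh)); lia.
    by apply: woW (woM oB (ordge_dy oh)); lia.
  have ok : ordge 1 kap by apply: (ordge_cancel oh) => //; rewrite -cgM -vh.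
  split=> //; apply: (mulfI ih_neq0); rewrite -ipM // -cgM -vh cgD !cgM !odxE !odyE ipD.
  have e1 : (m + 1 = 2 + m.-1)%N by lia.
  rewrite e1 !ipM //; try exact: ordge_dx; try exact: ordge_dy.
  rewrite iA iB ip_dx ip_dy prednK // ih derivC !mulr0 mul1r add0r subr0 -mul_polyC.
  by rewrite mulrC.
have lk : lead 3 (m%:R * (2 * beta)^-1) (gam kap).
  have -> : kap = oC m%:R * Y + (kap - oC m%:R * Y) by rewrite addrC subrK.
  rewrite /gam rmorphD rmorphM /= -/(gam _) -/(gam _) -/(gam (kap - _)) gamC gamY.
  rewrite -[_ * _^-1]addr0; apply: leadD.
    rewrite -[3%N]/(0 + (1 + 2))%N; apply: leadM.
      by exists (oC m%:R); rewrite ?mul1r.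
    by rewrite -[(2 * beta)^-1]mul1r; apply: leadM.
  have o2 : ordge 2 (kap - oC m%:R * Y).
    apply: ip_eq0.
      rewrite cgB cgM; apply: woB => //; apply: woMl; apply/ordge1P; exact: oY00.
    rewrite cgB cgM ipB ik; apply/eqP; rewrite subr_eq0; apply/eqP.
    apply/polyP => i; rewrite coefC coef_ip gCM -[cgval Y]/gY gYE.
    by case: i => [|[|i]] //=; rewrite ?mulr1 ?mulr0.
  by apply: leadW (lf 2%N _ o2).
have l1 : lead 0 1 (1 : O) by exists 1; rewrite ?mulr1.
(* Otherwise the cofactor would force order exactly [2 m] on [h] along the cusp. But [y^m] has order
   [3 m] and the other terms order at least [2 (m + 1)], all above [2 m]. *)
have gh0 : gam h = 0.
  apply/eqP; apply: contraT => gh; have [n [c' [c'0 ln]]] := onlyX_lead (ogam h) gh.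
  have lk' : lead 3 (- (m%:R * (2 * beta)^-1)) (- gam kap).
    exact: leadN.
  have EE : 1 * (- gam kap * gam h + e * odx (gam h)) = gam h * (e * odx 1).
    rewrite -gv vh /gam rmorphM /= -(rmorph1 (@oC R K)) odxC; ring.
  have := lead_ode c'0 (oner_neq0 K) l1 ln le lk' EE.
  rewrite mulr0 b24 (_ : - (m%:R * (2 * (4 * beta)^-1)) = (4 * beta)^-1 * - (m%:R * 2)); last by ring.
  rewrite -mulrDr => /eqP; rewrite mulf_eq0 (negPf b4) /= addrC subr_eq0 -natrM => /eqP/natK_inj nE.
  have : lead (2 * m) 0 (gam h).
    have -> : h = oC c * Y ^+ m + (h - oC c * Y ^+ m) by rewrite addrC subrK.
    rewrite /gam rmorphD rmorphM /= rmorphXn /= -/(gam _) -/(gam _) -/(gam (h - _)) gamC gamY.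
    rewrite -[0]addr0; apply: leadD.
      apply: (leadW (n := (3 * m)%N) (c := c * (2 * beta)^-1 ^+ m)); first by lia.
      rewrite -[(3 * m)%N]/(0 + (1 + 2) * m)%N; apply: leadM.
        by exists (oC c); rewrite ?mul1r.
      by apply: leadX; rewrite -[(2 * beta)^-1]mul1r; apply: leadM.
    have o2 : ordge m.+1 (h - oC c * Y ^+ m).
      have oY' : ordge m (cgval Y ^+ m).
        by rewrite -[m in ordge m]mul1n; apply: woX; apply/ordge1P; exact: oY00.
      apply: ip_eq0.
        by rewrite cgB cgM cgX; apply: woB => //; apply: woMl.
      rewrite cgB cgM cgX ipB ih; apply/eqP; rewrite subr_eq0; apply/eqP.
      apply/polyP => i; rewrite coefC coef_ip gCM -[cgval Y]/gY.
      rewrite -[gY ^+ m]mulr1 gYnM germ1E.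
      case: i => [|i] /=; first by rewrite subn0 ltnn subnn mulr1.
      by case: leqP => // lt; rewrite ifT ?mulr0 //; lia.
    by apply: leadW (lf _ _ o2); lia.
  by rewrite mulnC -nE => /(lead_eq ln) /eqP; rewrite (negPf c'0).
have gY0 : gam Y != 0.
  rewrite gamY mulf_neq0 ?oX_neq0 //; apply/eqP => x0; move: x2; rewrite x0 /= => /eqP; by [].
have ker := kernel_generator (phi := gam) gY0 gh0 irr.
have m2 : (m <= 2)%N.
  have [Q gQ Q2] := cusp_equation ox x00 x1 x2.
  have [q QE] := ker Q gQ; rewrite leqNgt; apply/negP => lt.
  move: Q2; rewrite QE cgM (woMr _ oh) // => /esym/eqP.
  by rewrite oner_eq0.
(* Simple vanishing of [f] enters here: [k = f / h] does not vanish on the cusp. *)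
have gk0 : gam k != 0.
  apply/eqP => gk; have [q kE] := ker k gk; apply: nh2; exists q.
  by rewrite fE kE mulrA.
have cg0 (u : O) : u != 0 -> cgval u != 0 by apply: contra => /eqP e0; apply/eqP/cgP.
have [d [of_ if_]] := ord_exists (cg0 _ f_neq0).
have [d' [og ig]] := ord_exists (cg0 _ g_neq0).
have ed := FI_order T E of_ if_ og ig; rewrite -{}ed {d'} in og ig.
have gf0 : gam f = 0 by rewrite fE /gam rmorphM /= -/(gam h) gh0 mul0r.
have fd : (ip d f)`_d = 0.
  have := lf _ _ of_; rewrite -/(gam f) gf0 => /(lead_eq (lead0 K _))/esym/eqP.
  by rewrite mulf_eq0 expf_eq0 (negPf b2) andbF /= => /eqP.
have gd : (ip d g)`_d != 0.
  by case: (FI_no_common_root_y T E cop of_ og if_ ig) => //; rewrite fd eqxx.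
have lG : lead (2 * d) ((2 * beta)^-1 ^+ d * (ip d g)`_d) (gam g) by exact: lf.
have [n1 [c1 [c10 lK]]] := onlyX_lead (ogam k) gk0.
have EK : gam g * (gam kap * gam k + e * odx (gam k)) = gam k * (e * odx (gam g)).
  rewrite -!gv /gam -!rmorphM -rmorphD -!rmorphM /=; congr (ocmp _ _ _).
  apply: (mulfI h_neq0).
  have -> : h * (k * vfield A B g) = f * vfield A B g by rewrite fE; ring.
  rewrite -E fE.
  have -> : vfield A B (h * k) = vfield A B h * k + h * vfield A B k.
    by rewrite /vfield odxM odyM; ring.
  by rewrite vh; ring.
(* The residue of [kap / e] is [m / (2 beta)] divided by [1 / (4 beta)], that is [2 m]. *)
have n1E : (2 * m + n1 = 2 * d)%N.
  have := lead_ode c10 (mulf_neq0 (expf_neq0 d b2) gd) lG lK le lk EK.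
  rewrite b24 (_ : m%:R * (2 * (4 * beta)^-1) = (4 * beta)^-1 * (2 * m%:R)); last by ring.
  rewrite -mulrDr => /(mulfI b4); rewrite -natrM -natrD; exact: natK_inj.
have k_neq0 : k != 0 by apply/eqP => k0; rewrite fE k0 mulr0 eqxx in f_neq0.
have [dk [okk ikk]] := ord_exists (cg0 _ k_neq0).
have ih_neq0 : ip m h != 0 by rewrite ih polyC_eq0.
have dE : d = (m + dk)%N.
  apply: (ord_uniq of_ if_); first by rewrite fE cgM; apply: woM.
  by rewrite fE cgM ipM // mulf_neq0.
(* The order of [k] along the cusp is [2 dk], the least compatible with its order [dk] at the
   origin, so its initial form contains [x^dk]. *)
have kd : (ip dk k)`_dk != 0.
  have lK' := lf _ _ okk; have n2 : n1 = (2 * dk)%N by clear -n1E dE; lia.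
  rewrite -/(gam k) -n2 in lK'; have ec := lead_eq lK lK'.
  by apply: contraNneq c10 => k0; rewrite ec k0 mulr0.
have f0E : ip d f = c *: ip dk k by rewrite fE dE cgM ipM // ih mul_polyC.
pose W := ip d g * (ip d f)^`() - ip d f * (ip d g)^`().
(* The initial forms of [f] and [g] have degrees [dk] and [d] in x; the two leading terms of the
   Wronskian do not cancel, since these degrees differ by [m]. *)
have WE : W`_(d + dk).-1 = - (m%:R * (c * (ip dk k)`_dk * (ip d g)`_d)).
  have sg : (size (ip d g) <= d.+1)%N by exact: size_ip.
  have sf : (size (ip d f) <= dk.+1)%N by rewrite f0E (leq_trans (size_scale_leq _ _)) ?size_ip.
  have fdk : (ip d f)`_dk = c * (ip dk k)`_dk by rewrite f0E coefZ.
  have ds (p : {poly K}) n : (size p <= n.+2)%N -> (size p^`() <= n.+1)%N.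
    move=> sp; apply/leq_sizeP => j lj; rewrite coef_deriv nth_default ?mul0rn //.
    by apply: leq_trans sp _.
  have t2 : (ip d f * (ip d g)^`())`_(d + dk).-1 = c * (ip dk k)`_dk * ((ip d g)`_d *+ d).
    have d0 : (0 < d)%N by clear -dE m0; lia.
    rewrite (_ : (d + dk).-1 = dk + d.-1)%N; last by clear -d0; lia.
    rewrite coefM_top ?fdk //; last by apply: ds; rewrite prednK.
    by rewrite coef_deriv prednK.
  have t1 : (ip d g * (ip d f)^`())`_(d + dk).-1 = (ip d g)`_d * (c * (ip dk k)`_dk *+ dk).
    case: dk {okk ikk n1E} dE kd f0E sf fdk t2 => [|dk] dE' kd' f0E' sf fdk t2.
      have -> : (ip d f)^`() = 0.
        by apply/polyP => i; rewrite coef_deriv coef0 nth_default ?mul0rn // (leq_trans sf).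
      by rewrite mulr0 coef0 mulr0n mulr0.
    rewrite addnS /= coefM_top //; last exact: ds.
    by rewrite coef_deriv fdk.
  have dR : d%:R = m%:R + dk%:R :> K by rewrite {1}dE natrD.
  rewrite /W coefB t1 t2 -[_ *+ dk]mulr_natr -[_ *+ d]mulr_natr dR; ring.
have W0 : W`_(d + dk).-1 != 0.
  rewrite WE oppr_eq0 !mulf_neq0 //.
  by case: (m) m0 => // m' _; apply: natK_neq0.
have [L [EU _]] := FI_factor T E.
have d2 : (1 < d)%N.
  rewrite ltnNge; apply/negP => d1; have {}d1 : d = 1%N by clear -d1 dE m0; lia.
  case/negP: W0; apply/eqP.
  suff -> : W = 0 by rewrite coef0.
  have : ip (1 + 0) (g * odx f - f * odx g) = 0.
    by rewrite EU ip_ordgeS // cgM; apply: woW (woMl _ oB).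
  rewrite d1 in of_ og; rewrite cgB !cgM !odxE ipB !ipM ?ip_dx //; try exact: (@ordge_dx _ 1).
  by rewrite /W d1.
have [d' d'E] : exists d', d = d'.+2 by exists d.-2; clear -d2; lia.
rewrite {}d'E in of_ og if_ ig W dE W0 d2 n1E WE f0E gd fd lG *.
have [oL LE] := FI_wronskian T of_ og EU.
exists d'; split=> //.
suff <- : (d'.+2 + dk).-1 = (d' + d').+1 by [].
(* With [m = 1] the Wronskian would have degree [2 d' + 2], above the order [2 d' + 1] of the form
   it represents; so the separatrix is indeed a cusp. *)
suff mE : m = 2 by clear -mE dE; lia.
apply/eqP; rewrite eqn_leq m2 ltnNge; apply/negP => m1.
have eN : ((d'.+2 + dk).-1 = (d' + d').+2)%N by clear -dE m0 m1; lia.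
by case/negP: W0; apply/eqP; rewrite /W -LE eN coef_ip ltnn.
Qed.
End Cusp.

(** * Products of prime powers *)

Section PrimePowers.
Variables (D E : idomainType).
Implicit Types l u v q : D.

Lemma prime_power_cancel (phi : {rmorphism D -> E}) l u v j :
  (forall w, phi w = 0 -> exists q, w = l * q) -> l != 0 -> phi l = 0 -> phi v != 0 ->
  (exists q, u * v = l ^+ j * q) -> exists q, u = l ^+ j * q.
Proof.
move=> pr l0 pl pv; elim: j u => [|j IH] u [q e]; first by exists u; rewrite mul1r.
have /pr[u' uE] : phi u = 0.
  have : phi (u * v) = 0 by rewrite e exprS !rmorphM pl !mul0r.
  by rewrite rmorphM => /eqP; rewrite mulf_eq0 (negPf pv) orbF => /eqP.
have [|w wE] := IH u'.
  by exists q; apply: (mulfI l0); rewrite mulrA -uE e exprS mulrA.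
by exists w; rewrite uE wE exprS mulrA.
Qed.

(** Each [l s] generates the kernel of a restriction morphism [phi s], and is prime to the others
    because their restrictions are nonzero. The abstract form applies to leaves among germs and to
    model curves among polynomials. *)
Lemma prime_powers_prod (I : eqType) (S : seq I) (l : I -> D) (n : I -> nat)
    (phi : I -> {rmorphism D -> E}) u : uniq S ->
  (forall s, s \in S -> [/\ l s != 0, phi s (l s) = 0 & forall w, phi s w = 0 -> exists q, w = l s * q]) ->
  (forall s t, s \in S -> t \in S -> s != t -> phi s (l t) != 0) ->
  (forall s, s \in S -> exists q, u = l s ^+ n s * q) ->
  exists q, u = (\prod_(s <- S) l s ^+ n s) * q.
Proof.
elim: S => [|s S IH] /= US pr cop dv; first by exists u; rewrite big_nil mul1r.
case/andP: US => sS US.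
have [|||q qE] := IH US.
- by move=> t tS; apply: pr; rewrite inE tS orbT.
- by move=> t t' tS t'S; apply: cop; rewrite inE ?tS ?t'S orbT.
- by move=> t tS; apply: dv; rewrite inE tS orbT.
have [ls0 pls prs] := pr s (mem_head _ _).
have [||p pE] := @prime_power_cancel (phi s) (l s) q (\prod_(t <- S) l t ^+ n t) (n s) prs ls0 pls.
- rewrite rmorph_prod /= prodf_seq_neq0; apply/allP => t tS /=; rewrite rmorphXn expf_neq0 //.
  apply: cop; rewrite ?inE ?eqxx ?tS ?orbT //; apply: contraNneq sS => ->; exact: tS.
- by rewrite mulrC -qE; apply: dv; rewrite inE eqxx.
by exists p; rewrite big_cons qE pE mulrCA mulrA.
Qed.
End PrimePowers.

Section PolyMult.
Variable K : fieldType.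
Implicit Types p q b : {poly K}.

Lemma XsubC_mult_uniq (s : K) a a' b b' : b.[s] != 0 -> b'.[s] != 0 ->
  ('X - s%:P) ^+ a * b = ('X - s%:P) ^+ a' * b' -> a = a'.
Proof.
wlog le : a a' b b' / (a <= a')%N => [hw|] hb hb' E.
  by case/orP: (leq_total a a') => le; [apply: (hw _ _ b b')|apply/esym/(hw _ _ b' b)].
have := E; rewrite -(subnKC le) exprD -mulrA => /mulfI.
rewrite expf_neq0 ?polyXsubC_eq0 // => /(_ isT) bE.
case en : (a' - a)%N => [|n]; first by rewrite addn0.
by case/negP: hb; rewrite bE en exprS -mulrA hornerM hornerXsubC subrr mul0r.
Qed.

Lemma size_prod_XsubC_exp (S : seq K) (n : K -> nat) :
  size (\prod_(s <- S) ('X - s%:P) ^+ n s) = (\sum_(s <- S) n s).+1.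
Proof.
elim: S => [|s S IH]; first by rewrite !big_nil size_poly1.
rewrite !big_cons size_monicM ?monic_exp ?monicXsubC //.
  by rewrite size_exp_XsubC IH addSn /= addnS.
by rewrite -size_poly_eq0 IH.
Qed.
End PolyMult.

(** * Critical leaves *)

Section Critical.
Variables (R : realFieldType) (K : absField R).
Local Notation O := (cgerm K).
Local Notation X := (oX K).
Local Notation Y := (oY K).
Implicit Types A B f g L u v w : O.

Lemma ordge1_exp n (u : series2 K) : ordge 1 u -> ordge n (u ^+ n).
Proof. by move=> h; have := woX (k := n) h; rewrite mul1n. Qed.
Lemma ip1_exp n (u : series2 K) : ordge 1 u -> ip n (u ^+ n) = ip 1 u ^+ n.
Proof. by move=> h; rewrite -(ipX n h) mul1n. Qed.

Lemma odx0 : odx (0 : O) = 0. Proof. by have := odxC (0 : K); rewrite rmorph0. Qed.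

Lemma nat_avoid (S : seq K) : exists n : nat, n%:R \notin S.
Proof.
apply: contrapT => /forallNP h.
have U : uniq [seq (n%:R : K) | n <- iota 0 (size S).+1].
  by rewrite map_inj_uniq ?iota_uniq // => a b; apply: natK_inj.
have : {subset [seq (n%:R : K) | n <- iota 0 (size S).+1] <= S}.
  by move=> x /mapP[n _ ->]; apply: contrapT => /negP; apply: h.
by move=> /(uniq_leq_size U); rewrite size_map size_iota ltnn.
Qed.

Lemma vfieldM A B f g : vfield A B (f * g) = vfield A B f * g + f * vfield A B g.
Proof. by rewrite /vfield odxM odyM; ring. Qed.
Lemma vfieldC A B c f : vfield A B (oC c * f) = oC c * vfield A B f.
Proof. by rewrite /vfield odxM odyM odxC odyC; ring. Qed.
Lemma vfieldD A B f g : vfield A B (f + g) = vfield A B f + vfield A B g.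
Proof. by rewrite /vfield odxD odyD; ring. Qed.
Lemma vfieldN A B f : vfield A B (- f) = - vfield A B f.
Proof. by rewrite /vfield odxN odyN; ring. Qed.

Lemma FI_scale A B f g c : FI A B f g -> FI A B (f - oC c * g) g.
Proof.
by rewrite /FI vfieldD vfieldN vfieldC => E; rewrite mulrBr E; ring.
Qed.

(** The quotient [f / g] is constant on every leaf transverse to the divisor, with value [c] read on
    the divisor. The contact order minus one is the multiplicity of [s] as a root of the Wronskian;
    ordinary leaves have [m = 0]. *)
Lemma critical_leaf A B f g L d s : T1 A B -> FI A B f g ->
  g * odx f - f * odx g = L * B ->
  ordge d f -> ordge d g -> (ip d g).[s] != 0 ->
  let W := ip d g * (ip d f)^`() - ip d f * (ip d g)^`() in W != 0 ->
  exists (nu : O) (c : K) (m : nat) (k : O), [/\ onlyX nu, nu 0%N 0%N = 0, nu 1%N 0%N = s,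
    f - oC c * g = graph nu ^+ m.+1 * k &
    [/\ exists2 b : {poly K}, b.[s] != 0 & W = ('X - s%:P) ^+ m * b,
      exists q, L = graph nu ^+ m * q &
      forall n u, ordge n u -> lead n (ip n u).[s] (ocmp nu X u)]].
Proof.
move=> T E EU of_ og gs W W0; have [nu [on nu0 nu1 nuA lnu]] := graph_leaf s T.
have [oA oB iA iB _] := T.
pose rho := ocmp nu X; pose c := (ip d f).[s] / (ip d g).[s]; pose p := f - oC c * g.
have [rl pr] := graph_prime on nu0; have [ol il] := graph_ip on nu0.
set l := graph nu in rl pr ol il *; rewrite nu1 in il.
have rv u : rho (vfield A B u) = rho B * odx (rho u) by exact: graph_vfield.
have lB : lead 2 1 (rho B) by have := lnu _ _ oB; rewrite iB hornerC.
have lg : lead d (ip d g).[s] (rho g) by exact: lnu.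
have Ep : FI A B p g by exact: FI_scale.
have ipp : ip d p = ip d f - c *: ip d g.
  rewrite /p cgB cgM ipB; congr (_ - _); apply/polyP => i; rewrite coefZ !coef_ip gCM.
  by case: ifP; rewrite ?mulr0.
have op : ordge d p by rewrite /p cgB cgM; apply: woB => //; apply: woMl.
have orho u : onlyX (rho u) by apply: onlyX_comp => //; apply: onlyX_X.
(* If nonzero, the restriction of [p] would have the same order [d] along the leaf as that of [g],
   by constancy of [p / g]; but its coefficient of degree [d] vanishes by the choice of [c]. *)
have rp : rho p = 0.
  apply/eqP; apply: contraT => rp; have [n [c' [c'0 ln]]] := onlyX_lead (orho p) rp.
  have EE : rho g * (0 * rho p + rho B * odx (rho p)) = rho p * (rho B * odx (rho g)).
    by rewrite mul0r add0r -!rv /rho -!rmorphM /=; congr (ocmp _ _ _).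
  have := lead_ode c'0 gs lg ln lB (lead0 K 1) EE; rewrite add0r !mul1r => /natK_inj nd.
  have := lnu _ _ op; rewrite ipp hornerD hornerN hornerZ /c divfK // subrr -/(rho p) -nd.
  by move=> /(lead_eq ln)/eqP; rewrite (negPf c'0).
have WE : W = ip d g * (ip d p)^`() - ip d p * (ip d g)^`().
  by rewrite /W ipp derivB derivZ -mul_polyC -[c *: ip d g]mul_polyC; ring.
have p_neq0 : p != 0.
  have z : ip d (0 : O) = 0 by exact: ip_ordgeS.
  by apply: contraNneq W0 => p0; rewrite WE p0 z deriv0 mulr0 mul0r subr0.
have l0 : cgval l != 0 by apply: (@ip_neq0 _ 1); rewrite il polyXsubC_eq0.
have l_neq0 : l != 0 by apply: contraNneq l0 => ->.
have [m [k [pE rk]]] : exists m k, p = l ^+ m.+1 * k /\ rho k != 0.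
  have p_neq0' : cgval p != 0 by apply: contra p_neq0 => /eqP e; apply/eqP/cgP.
  have [dp [odp idp]] := ord_exists p_neq0'.
  pose P n := `[< exists k, p = l ^+ n * k >].
  have ex : exists n, P n by exists 0%N; apply/asboolP; exists p; rewrite mul1r.
  have bd n : P n -> (n <= dp)%N.
    move=> /asboolP[k pk]; rewrite leqNgt; apply/negP => lt; case/negP: idp; apply/eqP.
    apply: ip_ordgeS; rewrite pk cgM cgX; apply: woMr.
    by apply: woW lt _; apply: ordge1_exp.
  case: (ex_maxnP ex bd) => m /asboolP[k pk] mx.
  have nk : rho k != 0.
    apply/eqP => /pr[k' kE]; suff : (m.+1 <= m)%N by rewrite ltnn.
    by apply: mx; apply/asboolP; exists k'; rewrite pk kE exprSr mulrA.
  case: m pk mx => [|m] pk _; last by exists m, k.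
  by move: nk; rewrite -[k]mul1r -pk rp eqxx.
have [n1 [c1 [c10 lk]]] := onlyX_lead (orho k) rk.
have [kap vl] : exists kap, vfield A B l = l * kap.
  by apply: pr; rewrite -/rho rv /rho rl odx0 mulr0.
have [okap ikap] : ordge 1 kap /\ ip 1 kap = 1.
  have il0 : ip 1 l != 0 by rewrite il polyXsubC_eq0.
  have ov : ordge (1 + 1) (vfield A B l).
    rewrite cgD !cgM !odxE !odyE; apply: woD.
      by apply: woW (woM oA (ordge_dx ol)).
    by apply: woW (woM oB (ordge_dy ol)).
  have ok : ordge 1 kap by apply: (ordge_cancel ol) => //; rewrite -cgM -vl.
  split=> //; apply: (mulfI il0); rewrite -ipM // -cgM -vl cgD !cgM !odxE !odyE ipD.
  rewrite -[(1 + 1)%N]/(2 + 0)%N !ipM //; try exact: (@ordge_dx _ 1); try exact: (@ordge_dy _ 1).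
  rewrite iA iB ip_dx ip_dy il derivXsubC scale1r !mulr1 mul1r; ring.
have lkap : lead 1 (m.+1%:R * 1) (oC m.+1%:R * rho kap).
  apply: (@leadM R K 0 1); first by exists (oC m.+1%:R); rewrite ?mul1r.
  by have := lnu _ _ okap; rewrite ikap hornerC.
have EK : rho g * (oC m.+1%:R * rho kap * rho k + rho B * odx (rho k)) = rho k * (rho B * odx (rho g)).
  rewrite -!rv -[oC _ in LHS](ocmpC nu X) /rho -!rmorphM -rmorphD -!rmorphM /=; congr (ocmp _ _ _).
  have nz : l ^+ m.+1 != 0 by rewrite expf_neq0.
  apply: (mulfI nz).
  have -> : l ^+ m.+1 * (k * vfield A B g) = p * vfield A B g by rewrite pE; ring.
  rewrite -Ep pE vfieldM.
  have -> : vfield A B (l ^+ m.+1) = l ^+ m.+1 * (oC m.+1%:R * kap).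
    rewrite /vfield odxXn odyXn rmorph_nat.
    have -> : A * (m.+1%:R * l ^+ m * odx l) + B * (m.+1%:R * l ^+ m * ody l)
      = m.+1%:R * l ^+ m * vfield A B l by rewrite /vfield; ring.
    by rewrite vl exprS; ring.
  by ring.
(* The cofactor of [l^(m + 1)] contributes the residue [m + 1]. Hence [k] has order [d - (m + 1)]
   along the leaf as well as at the origin, and its initial form is nonzero at [s]. *)
have n1E : (m.+1 + n1 = d)%N.
  have := lead_ode c10 gs lg lk lB lkap EK; rewrite !mulr1 !mul1r -natrD; exact: natK_inj.
have ok : ordge n1 k.
  apply: (@ordge_cancel _ m.+1 n1 (cgval (l ^+ m.+1))).
  - by rewrite cgX; apply: ordge1_exp.
  - by rewrite cgX ip1_exp // il expf_neq0 // polyXsubC_eq0.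
  - by rewrite -cgM -pE n1E.
have ks : (ip n1 k).[s] != 0 by rewrite (lead_eq (lnu _ _ ok) lk).
have p0E : ip d p = ('X - s%:P) ^+ m.+1 * ip n1 k.
  rewrite pE -n1E cgM ipM //; last by rewrite cgX; apply: ordge1_exp.
  by rewrite cgX ip1_exp // il.
exists nu, c, m, k; split=> //; split=> //.
  exists (m.+1%:R%:P * ip n1 k * ip d g
     + ('X - s%:P) * ((ip n1 k)^`() * ip d g - ip n1 k * (ip d g)^`())).
    rewrite hornerD !hornerM hornerC hornerXsubC subrr mul0r addr0.
    by rewrite !mulf_neq0 // natK_neq0.
  rewrite WE p0E derivM deriv_exp derivXsubC mul1r /= -[_ *+ m.+1]mulr_natl -polyC_natr.
  by rewrite exprS; ring.
have [q qE] : exists q, L * B = l ^+ m * q.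
  rewrite -EU.
  have -> : g * odx f - f * odx g = g * odx p - p * odx g.
    by rewrite /p odxD odxN odxM odxC; ring.
  by rewrite pE odxM odxXn exprS; exists (g * (m.+1%:R * odx l * k + l * odx k) - l * k * odx g); ring.
apply: (@prime_power_cancel _ _ (ocmp nu X) l L B m pr l_neq0 rl); last by exists q.
by apply/eqP => rB0; have := lead_eq lB; rewrite /rho rB0 => /(_ _ (lead0 K 2))/eqP; rewrite oner_eq0.
Qed.
End Critical.

(** * Factorization of g df - f dg along the critical leaves *)

Section CriticalData.
Variables (R : realFieldType) (K : absField R).
Local Notation O := (cgerm K).
Local Notation X := (oX K).
Local Notation Y := (oY K).
Implicit Types A B f g L u v w : O.

Definition leaves (S : seq K) (nu : K -> O) :=
  forall s, s \in S -> [/\ onlyX (nu s), nu s 0%N 0%N = 0 & nu s 1%N 0%N = s].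

(* The pencil together with its critical leaves graph (nu s), along which f - c s g
   vanishes to order m s + 1. *)
Definition critical_data A B f g (S : seq K) (nu : K -> O) (c : K -> K) (m : K -> nat)
    (k : K -> O) (e : O) :=
  [/\ uniq S, leaves S nu,
      forall s, s \in S -> f - oC (c s) * g = graph (nu s) ^+ (m s).+1 * k s,
      e 0%N 0%N != 0 &
      g * odx f - f * odx g = e * (\prod_(s <- S) graph (nu s) ^+ m s) * B /\
      g * ody f - f * ody g = - (e * (\prod_(s <- S) graph (nu s) ^+ m s) * A)].

Lemma graph_neq0 (nu : O) : onlyX nu -> nu 0%N 0%N = 0 -> graph nu != 0.
Proof.
move=> on n0; have [_ il] := graph_ip on n0.
have l0 : cgval (graph nu) != 0 by apply: (@ip_neq0 _ 1); rewrite il polyXsubC_eq0.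
by apply: contraNneq l0 => ->.
Qed.

Lemma graph_on_graph (nu mu : O) : onlyX nu -> nu 0%N 0%N = 0 -> onlyX mu -> mu 0%N 0%N = 0 ->
  nu 1%N 0%N != mu 1%N 0%N -> ocmp nu X (graph mu) != 0.
Proof.
move=> on n0 om m0 ne; apply/eqP => e.
have : (ocmp nu X (graph mu)) 1%N 0%N = nu 1%N 0%N - mu 1%N 0%N.
  have h : ocmp X (ocmp nu X 0) mu = mu.
    by apply: cgP => /=; rewrite (comp_onlyX _ _ gY om) comp_id.
  have -> : ocmp nu X (graph mu) = nu - mu.
    by rewrite /graph rmorphB /= ocmpX // ocmp_assoc ocmpY ?oX00 // h.
  by rewrite cgB germB.
by rewrite e /= => /esym/eqP; rewrite subr_eq0 (negPf ne).
Qed.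

Lemma leaves_prod (S : seq K) (nu : K -> O) (n : K -> nat) u : uniq S -> leaves S nu ->
  (forall s, s \in S -> exists q, u = graph (nu s) ^+ n s * q) ->
  exists q, u = (\prod_(s <- S) graph (nu s) ^+ n s) * q.
Proof.
move=> US lv dv; pose phi s : {rmorphism O -> O} := ocmp (nu s) X.
apply: (@prime_powers_prod _ _ _ S (fun s => graph (nu s)) n phi u US) => [s sS|s t sS tS ne|]; last exact: dv.
  have [on n0 _] := lv s sS; have [rl pr] := graph_prime on n0.
  by split=> //; apply: graph_neq0.
have [on n0 n1] := lv s sS; have [om m0 m1] := lv t tS.
by apply: graph_on_graph; rewrite ?n1 ?m1.
Qed.

(** The product of the [l_s^(m_s)] divides [L]. Its order is the number of roots of the Wronskian,
    which is [2 d + 1] by the hypothesis on the top coefficient, the order of [L]; so the quotient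
    is a unit. *)
Lemma critical_data_exists A B f g d : T1 A B -> FI A B f g -> ocoprime f g ->
  ordge d.+2 f -> ordge d.+2 g -> ip d.+2 f != 0 -> ip d.+2 g != 0 ->
  (ip d.+2 g * (ip d.+2 f)^`() - ip d.+2 f * (ip d.+2 g)^`())`_((d + d).+1) != 0 ->
  exists g' S nu c m k e, critical_data A B f g' S nu c m k e /\ g' != 0.
Proof.
move=> T E cop of_ og if_ ig; set f0 := ip d.+2 f in if_ *; set g0 := ip d.+2 g in ig *.
set W := _ - _ => Wtop; have W0 : W != 0 by apply: contraNneq Wtop => ->; rewrite coef0.
have [L [EU EV]] := FI_factor T E.
have [oL LE] := FI_wronskian T of_ og EU; rewrite -/f0 -/g0 -/W in LE.
have [r rE] := closed_field_poly_normal W.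
pose S := undup r.
have sW : size W = (d + d).+2.
  apply/eqP; rewrite eqn_leq -{1}LE size_ip ltnNge; apply/negP => le.
  by rewrite nth_default ?eqxx in Wtop.
(* A critical value may be infinite. Replacing [g] by [g + n f] leaves [g df - f dg] unchanged and,
   for a suitable [n], makes the new initial form nonzero at every root of the Wronskian. *)
have [n nav] := nat_avoid [seq - (g0.[s] / f0.[s]) | s <- S].
pose g' := g + oC n%:R * f.
have g'E : ip d.+2 g' = g0 + n%:R *: f0.
  rewrite /g' cgD cgM ipD; congr (_ + _); apply/polyP => i; rewrite coefZ !coef_ip gCM.
  by case: ifP; rewrite ?mulr0.
have og' : ordge d.+2 g' by rewrite /g' cgD cgM; apply: woD => //; apply: woMl.
have gs s : s \in S -> (ip d.+2 g').[s] != 0.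
  move=> sS; rewrite g'E hornerD hornerZ.
  have [fs|fs] := eqVneq f0.[s] 0.
    rewrite fs mulr0 addr0; case: (FI_no_common_root s T E cop of_ og if_ ig) => //.
    by rewrite -/f0 fs eqxx.
  apply: contra nav => /eqP e; apply/mapP; exists s => //.
  by apply: (mulIf fs); rewrite mulNr divfK //; apply/eqP; rewrite -addr_eq0 addrC e.
have E' : FI A B f g'.
  by rewrite /FI /g' vfieldD vfieldC mulrDl E; ring.
have EU' : g' * odx f - f * odx g' = L * B.
  by rewrite -EU /g' odxD odxM odxC; ring.
have EV' : g' * ody f - f * ody g' = - (L * A).
  by rewrite -EV /g' odyD odyM odyC; ring.
have W'E : ip d.+2 g' * f0^`() - f0 * (ip d.+2 g')^`() = W.
  by rewrite g'E derivD derivZ -!mul_polyC /W; ring.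
pose Pr s (t : O * K * nat * O) := let: (nu, c, m, k) := t in
  [/\ onlyX nu, nu 0%N 0%N = 0, nu 1%N 0%N = s,
    f - oC c * g' = graph nu ^+ m.+1 * k &
    [/\ exists2 b : {poly K}, b.[s] != 0 & W = ('X - s%:P) ^+ m * b,
      exists q, L = graph nu ^+ m * q &
      forall n u, ordge n u -> lead n (ip n u).[s] (ocmp nu X u)]].
have ch s : exists t, s \in S -> Pr s t.
  case sS : (s \in S); last by exists (0, 0, 0%N, 0).
  have W'0 : ip d.+2 g' * (ip d.+2 f)^`() - ip d.+2 f * (ip d.+2 g')^`() != 0 by rewrite W'E.
  have [nu [c [m [k h]]]] := critical_leaf T E' EU' of_ og' (gs s sS) W'0.
  exists (nu, c, m, k) => _; rewrite /Pr; move: h; by rewrite W'E.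
have [t tP] := choice ch.
pose nu s := (t s).1.1.1; pose c s := (t s).1.1.2; pose m s := (t s).1.2; pose k s := (t s).2.
have PS s : s \in S -> Pr s (nu s, c s, m s, k s).
  by move=> /tP; rewrite /nu /c /m /k; case: (t s) => [[[]]].
have US : uniq S by exact: undup_uniq.
have lv : leaves S nu by move=> s /PS[].
have mE s : s \in S -> m s = count_mem s r.
  move=> sS; have [_ _ _ _ [[b bs WE] _ _]] := PS s sS.
  have := WE; rewrite {1}rE -(prodr_undup_exp_count r xpredT) -/S (bigD1_seq s) //=.
  rewrite scalerAr => /esym e'.
  apply: (XsubC_mult_uniq bs _ e').
  rewrite hornerZ mulf_neq0 ?lead_coef_eq0 // horner_prod prodf_seq_neq0.
  apply/allP => z zS; apply/implyP => zs; rewrite horner_exp hornerXsubC expf_neq0 // subr_eq0 eq_sym //.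
pose P := \prod_(s <- S) graph (nu s) ^+ m s.
have [e LPe] : exists e, L = P * e.
  by apply: leaves_prod => // s /PS[_ _ _ _ []].
have og1 s : s \in S -> ordge (m s) (cgval (graph (nu s) ^+ m s)).
  move=> /lv[on n0 _]; rewrite cgX; apply: ordge1_exp; by have [] := graph_ip on n0.
have iP : ip (\sum_(s <- S) m s) P = \prod_(s <- S) ('X - s%:P) ^+ m s.
  rewrite /P cg_prod ip_prod_seq //; apply: eq_big_seq => s sS.
  have [on n0 n1] := lv s sS; have [ol il] := graph_ip on n0.
  by rewrite cgX ip1_exp // il n1.
have oP : ordge (\sum_(s <- S) m s) P by rewrite /P cg_prod; apply: wo_prod_seq.
have WP : W = lead_coef W *: \prod_(s <- S) ('X - s%:P) ^+ m s.
  rewrite {1}rE -(prodr_undup_exp_count r xpredT) -/S; congr (_ *: _).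
  by apply: eq_big_seq => s sS; rewrite mE.
have sm : (\sum_(s <- S) m s)%N = (d + d).+1.
  by have := sW; rewrite {1}WP size_scale ?lead_coef_eq0 // size_prod_XsubC_exp => -[->].
exists g', S, nu, c, m, k, e; split; last first.
  have : ip d.+2 g' != 0.
    have : r != [::].
      apply/eqP => r0; have := sW; rewrite WP /S r0 big_nil size_scale ?lead_coef_eq0 // size_poly1; lia.
    case er : r => [//|s r'] _; have sS : s \in S by rewrite mem_undup er mem_head.
    by apply: contraNneq (gs s sS) => ->; rewrite horner0.
  by apply: contraNneq => ->; rewrite ip_ordgeS.
split=> //; first by move=> s /PS[].
  have : W = ip ((\sum_(s <- S) m s) + 0) (P * e).
    by rewrite addn0 sm -LPe LE.
  rewrite cgM ipM // ip_0 => We; apply: contraNneq W0 => e0.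
  by rewrite We e0 mulr0.
by rewrite -/P EU' EV' LPe (mulrC P e).
Qed.
End CriticalData.

(** * A polynomial pencil with prescribed critical curves *)

Section Model.
Variables (R : realFieldType) (K : absField R).
Local Notation O := (cgerm K).
Local Notation X := (oX K).
Local Notation Y := (oY K).
Local Notation PP := {poly {poly K}}.
Implicit Types (f g : O) (p q e : PP) (mu r : {poly K}).

Lemma toG_horner p mu : toG (p.[mu])%:P = evG (toG mu%:P) gY p.
Proof.
elim/poly2_ind: p => [c|||p q IHp IHq|p q IHp IHq].
- by rewrite hornerC evC ev1C toGE evC ev1C.
- by rewrite hornerX evX.
- by rewrite hornerC evC ev1X toGE evC ev1X.
- by rewrite hornerD polyCD toGD IHp IHq rmorphD.
- by rewrite hornerM polyCM toGM IHp IHq rmorphM.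
Qed.

Lemma poly_Xn_factor j (r : {poly K}) : (forall l, (l < j)%N -> r`_l = 0) -> exists q : {poly K}, r = 'X^j * q.
Proof.
move=> h; exists (drop_poly j r); rewrite -{1}(poly_take_drop j r) mulrC.
rewrite [take_poly j r](_ : _ = 0) ?add0r //.
by apply/polyP => l; rewrite coef_take_poly coef0; case: ifP => // /h.
Qed.

Lemma toGC mu i j : toG mu%:P i j = if i is 0%N then mu`_j else 0.
Proof. by rewrite /toG coefC; case: i => //= i; rewrite coef0. Qed.

Lemma toG_XsubC mu : toG ('X - mu%:P) = gX - toG mu%:P.
Proof. by rewrite toGD toGN [toG 'X]toGE evX. Qed.

Lemma toG_line mu : mu`_0 = 0 ->
  ordge 1 (toG ('X - mu%:P)) /\ ip 1 (toG ('X - mu%:P)) = 'X - (mu`_1)%:P.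
Proof.
move=> mu0; rewrite toG_XsubC; split.
  by apply/ordge1P; rewrite germB gXE toGC mu0 subr0.
apply/polyP => i; rewrite coef_ip coefB coefX coefC !germB gXE toGC.
by case: i => [|[|i]] //=; rewrite ?subr0.
Qed.

(** Repeated division by [x - mu(y)]: each quotient loses one order, and each remainder is a
    polynomial in y whose order is at least that of the dividend. After [M] steps a factor
    [y^(N - M)] is left in all remainders. *)
Lemma line_adic_expansion mu e N M : mu`_0 = 0 -> ordge N (toG e) -> (M <= N)%N ->
  exists a b, e = ('X - mu%:P) ^+ M * a + 'X%:P ^+ (N - M) * b.
Proof.
move=> mu0 oe leMN; set l := 'X - mu%:P; have [ol il] := toG_line mu0; rewrite -/l in ol il.
suff [a [b [E _]]] : exists a b, e = l ^+ M * a + 'X%:P ^+ (N - M) * b /\ ordge (N - M) (toG a).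
  by exists a, b.
elim: M leMN => [|M IH] le; first by exists e, 0; rewrite mul1r mulr0 addr0 subn0.
have [a [b [E oa]]] := IH (ltnW le).
have [q qE] : exists q, a - (a.[mu])%:P = q * l.
  by apply/factor_theorem; rewrite rootE hornerD hornerN hornerC subrr.
have or : ordge (N - M) (toG (a.[mu])%:P).
  rewrite toG_horner; apply: (@ev_wo _ 1 1 1 1) oa; last exact: ordgeY.
  by apply/ordge1P; rewrite toGC mu0.
have [r' rE] : exists r', a.[mu] = 'X^(N - M) * r'.
  apply: poly_Xn_factor => j lt; have := or 0%N j; rewrite toGC => -> //.
  by lia.
exists q, ('X%:P * (l ^+ M * r'%:P + b)); split.
  have aE : a = q * l + (a.[mu])%:P by rewrite -qE subrK.
  rewrite E {1}aE rE polyCM polyC_exp.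
  have -> : (N - M = (N - M.+1).+1)%N by lia.
  by rewrite !exprS; ring.
apply: (@ordge_cancel _ 1 _ (toG l)) => //; first by rewrite il polyXsubC_eq0.
have -> : (1 + (N - M.+1) = N - M)%N by lia.
by rewrite mulrC -toGM -qE toGD toGN; apply: woB.
Qed.

(** Let [w] be the value of [W] on the curve; [w - W] is divisible by [x - mu], so the truncated
    geometric series [Z] inverts [W] modulo the power [M], up to the factor [w^M]. *)
Lemma critical_correction (W : PP) mu M : exists Z q, W * Z = (W.[mu])%:P ^+ M - ('X - mu%:P) ^+ M * q.
Proof.
have [q qE] : exists q, W - (W.[mu])%:P = q * ('X - mu%:P).
  by apply/factor_theorem; rewrite rootE hornerD hornerN hornerC subrr.
pose w := (W.[mu])%:P; exists (\sum_(i < M) w ^+ (M.-1 - i) * (w - W) ^+ i), ((- q) ^+ M).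
rewrite -exprMn.
have -> : ('X - mu%:P) * - q = w - W by rewrite mulrN mulrC -qE opprB.
by rewrite subrXX; congr (_ * _); rewrite opprB addrC subrK.
Qed.

(** Truncation leaves on each curve an error that is a high power of y, modulo the required power of
    the curve. Chinese remaindering removes all these errors at once by changing [F] alone. *)
Lemma model_exists f g (S : seq K) (nu : K -> O) (c : K -> K) (m : K -> nat) (k : K -> O) N :
  uniq S -> leaves S nu ->
  (forall s, s \in S -> f - oC (c s) * g = graph (nu s) ^+ (m s).+1 * k s) ->
  exists (F G : PP) (mu : K -> {poly K}) (H : K -> PP) (rho : {poly K}),
  [/\ rho.[0] != 0, 
      forall s, s \in S -> F - (c s)%:P%:P * G = ('X - (mu s)%:P) ^+ (m s).+1 * H s,
      ordge N (toG F - toG rho%:P * f), ordge N (toG G - toG rho%:P * g) &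
      forall s j, s \in S -> (j <= N)%N -> (mu s)`_j = nu s j 0%N].
Proof.
move=> US lv crit; pose M s := (m s).+1.
pose n s := (\sum_(t <- S | t != s) M t)%N.
(* Orders spent on the curve [s]: [M s] in the adic expansion of the error, and [n s * M s] because
   the product of the other curves has order [n s] on it and is inverted modulo the power [M s]. *)
pose C := (\sum_(s <- S) (M s + n s * M s))%N; pose N' := (N + C)%N.
have leC s : s \in S -> (M s + n s * M s <= C)%N.
  by move=> sS; rewrite /C (bigD1_seq s) //= leq_addr.
pose d s : {poly K} := \poly_(i < N') nu s i.+1 0%N; pose mu s := 'X * d s.
have muE s j : s \in S -> (j <= N')%N -> (mu s)`_j = nu s j 0%N.
  move=> sS le; rewrite /mu coefXM; case: j le => [|j] le /=; first by have [_ ->] := lv s sS.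
  by rewrite coef_poly le.
have mu0 s : (mu s)`_0 = 0 by rewrite /mu coefXM.
pose l s : PP := 'X - (mu s)%:P.
pose f0 := trunc N' f; pose g0 := trunc N' g; pose k0 s := trunc N' (k s).
pose e s := f0 - (c s)%:P%:P * g0 - l s ^+ M s * k0 s.
have toC a : toG a%:P%:P = gC a by rewrite toGE evC ev1C.
have lE s : s \in S -> ordge N' (toG (l s) - graph (nu s)).
  move=> sS; have [on _ _] := lv s sS.
  have gE : cgval (graph (nu s)) = gX - cgval (ocmp Y 0 (nu s)) by [].
  rewrite /l toG_XsubC.
  have -> : gX - toG (mu s)%:P - cgval (graph (nu s)) = gX - toG (mu s)%:P - (gX - cgval (ocmp Y 0 (nu s))) by rewrite -gE.
  have -> : gX - toG (mu s)%:P - (gX - cgval (ocmp Y 0 (nu s))) = cgval (ocmp Y 0 (nu s)) - toG (mu s)%:P.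
    by ring.
  apply/ordgeP => i j lt; rewrite germB toGC /= gcomp_onlyX_Y //.
  case: i lt => [|i] lt; last by rewrite subrr.
  by rewrite muE ?subrr //; lia.
have expE n' (u v : series2 K) : ordge N' (u - v) -> ordge N' (u ^+ n' - v ^+ n').
  by move=> h; rewrite subrXX; apply: woMr.
have toGXn u n' : toG (u ^+ n') = toG u ^+ n' :> series2 K by rewrite !toGE rmorphXn.
have oe s : s \in S -> ordge N' (toG (e s)).
  move=> sS; have E : cgval (f - oC (c s) * g) = cgval (graph (nu s) ^+ M s * k s) by rewrite crit.
  rewrite cgB !cgM cgX in E.
  rewrite /e !toGD !toGN !toGM toC toGXn.
  have tr (u : series2 K) : ordge N' (toG (trunc N' u) - u) by rewrite -opprB; apply: woN; apply: trunc_ord.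
  set l' := cgval (graph (nu s)) in E.
  have abel (f1 f2 g1 g2 k1 k2 l1 l2 cc : series2 K) : f1 - cc * g1 - l1 * k1 =
    (f1 - f2) - cc * (g1 - g2) - ((l1 - l2) * k1 + l2 * (k1 - k2)) + (f2 - cc * g2 - l2 * k2) by ring.
  rewrite (abel _ (cgval f) _ (cgval g) _ (cgval (k s)) _ (l' ^+ M s)).
  have E' : cgval f - gC (c s) * cgval g - l' ^+ M s * cgval (k s) = 0.
    by apply/eqP; rewrite subr_eq0; apply/eqP; exact: E.
  rewrite E' addr0.
  apply: woB; last apply: woD.
  - by apply: woB; [|apply: woMl]; apply: tr.
  - by apply: woMr; apply: expE; apply: lE.
  - by apply: woMl; apply: tr.
pose W s := \prod_(t <- S | t != s) l t ^+ M t.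
(* On the curve [s] the equation of the curve [t] becomes [y (d s - d t)], where [d s - d t] takes
   at 0 the difference of the two slopes. Thus [rh s] is invertible as a series but not as a
   polynomial. *)
pose rh s := \prod_(t <- S | t != s) (d s - d t) ^+ M t.
have WE s : (W s).[mu s] = 'X^(n s) * rh s.
  rewrite /W horner_prod /rh /n.
  elim: (S) => [|t S' IH]; first by rewrite !big_nil mulr1.
  rewrite !big_cons; case: ifP => // _; rewrite IH exprD horner_exp hornerXsubC /mu -mulrBr exprMn.
  by ring.
have rh0 s : s \in S -> (rh s).[0] != 0.
  move=> sS; rewrite horner_prod big_seq_cond prodf_seq_neq0; apply/allP => t tS; apply/implyP => ts.
  rewrite horner_exp hornerD hornerN expf_neq0 // !horner_coef0 subr_eq0.
  have [_ _ n1] := lv s sS; have [_ _ n1'] := lv t tS.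
  have C0 : (0 < N')%N.
    have := leC s sS; rewrite /N' /M; lia.
  by rewrite !coef_poly C0 n1 n1' eq_sym; case/andP: ts.
have step s : exists t : PP * PP * PP * PP, s \in S ->
    e s = l s ^+ M s * t.1.1.1 + 'X%:P ^+ (N' - M s) * t.1.1.2 /\
    W s * t.1.2 = ((W s).[mu s])%:P ^+ M s - l s ^+ M s * t.2.
  case sS : (s \in S); last by exists (0, 0, 0, 0).
  have [|a [b ab]] := @line_adic_expansion (mu s) (e s) N' (M s) (mu0 s) (oe s sS).
    by have := leC s sS; rewrite /N'; lia.
  have [Z [q Zq]] := critical_correction (W s) (mu s) (M s).
  by exists (a, b, Z, q).
have [t tP] := choice step.
pose a s := (t s).1.1.1; pose b s := (t s).1.1.2; pose Z s := (t s).1.2; pose q s := (t s).2.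
have abE s : s \in S -> e s = l s ^+ M s * a s + 'X%:P ^+ (N' - M s) * b s by move=> /tP[].
have ZE s : s \in S -> W s * Z s = ((W s).[mu s])%:P ^+ M s - l s ^+ M s * q s by move=> /tP[].
(* The division by [rh s ^+ M s] is avoided by multiplying the whole pencil by all these powers;
   [cof s] supplies the missing ones. *)
pose rho := \prod_(s <- S) rh s ^+ M s.
pose cof s := \prod_(t <- S | t != s) rh t ^+ M t.
have rhoE s : s \in S -> rho = rh s ^+ M s * cof s by move=> sS; rewrite /rho (bigD1_seq s).
(* Through [W s] this is divisible by the powers of all other curves, while modulo [l s ^+ M s] it
   equals [rho] times the error on the curve [s]. *)
pose cor s := (cof s)%:P * 'X%:P ^+ (N' - M s - n s * M s) * b s * (W s * Z s).
pose F := rho%:P * f0 - \sum_(s <- S) cor s; pose G := rho%:P * g0.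
have fin s : s \in S -> exists H, F - (c s)%:P%:P * G = l s ^+ M s * H.
  move=> sS.
  have [H1 H1E] : exists H1, \sum_(t <- S | t != s) cor t = l s ^+ M s * H1.
    exists (\sum_(t <- S | t != s) ((cof t)%:P * 'X%:P ^+ (N' - M t - n t * M t) * b t * Z t) *
       (\prod_(t' <- rem s S | t' != t) l t' ^+ M t')).
    rewrite mulr_sumr; apply: eq_bigr => t' ts; rewrite /cor /W.
    rewrite (big_rem s) //= eq_sym ts; ring.
  have cs : cor s = rho%:P * ('X%:P ^+ (N' - M s) * b s)
      - l s ^+ M s * ((cof s)%:P * 'X%:P ^+ (N' - M s - n s * M s) * b s * q s).
    rewrite /cor ZE // WE (rhoE s sS) !(polyCM, polyC_exp) exprMn -exprM.
    have -> : (N' - M s = (N' - M s - n s * M s) + n s * M s)%N.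
      by rewrite subnK //; have := leC s sS; rewrite /N'; lia.
    by rewrite addnK exprD; ring.
  have eb : 'X%:P ^+ (N' - M s) * b s = f0 - (c s)%:P%:P * g0 - l s ^+ M s * k0 s - l s ^+ M s * a s.
    by rewrite -/(e s) abE // addrC addKr.
  exists (rho%:P * (k0 s + a s) + (cof s)%:P * 'X%:P ^+ (N' - M s - n s * M s) * b s * q s - H1).
  rewrite /F /G (bigD1_seq s) //= H1E cs eb; ring.
have [H HP] : exists H : K -> PP, forall s, s \in S -> F - (c s)%:P%:P * G = l s ^+ M s * H s.
  suff /choice[H HE] : forall s, exists H, s \in S -> F - (c s)%:P%:P * G = l s ^+ M s * H by exists H.
  move=> s; case sS : (s \in S); last by exists 0.
  by have [H HE] := fin s sS; exists H.
have tr (u : series2 K) : ordge N (toG (trunc N' u) - u).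
  by rewrite -opprB; apply: woN; apply: (woW (leq_addr C N)); apply: trunc_ord.
exists F, G, mu, H, rho; split=> //.
- rewrite /rho horner_prod big_seq prodf_seq_neq0; apply/allP => s sS; apply/implyP => _.
  by rewrite horner_exp expf_neq0 ?rh0.
- rewrite /F toGD toGN toGM.
  have -> : toG rho%:P * toG f0 - toG (\sum_(s <- S) cor s) - toG rho%:P * cgval f
    = toG rho%:P * (toG f0 - cgval f) - toG (\sum_(s <- S) cor s) by ring.
  apply: woB; first by apply: woMl; apply: tr.
  rewrite toGE rmorph_sum /= big_seq; apply: wo_sum => s sS.
  rewrite /cor -toGE !toGM; apply: woMr; apply: woMr; apply: woMl; rewrite toGXn.
  have -> : toG 'X%:P = gY :> series2 K by rewrite toGE evC ev1X.
  apply: (@woW _ _ _ _ (N' - M s - n s * M s)%N); last exact: ordge1_exp (ordgeY K).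
  by have := leC s sS; rewrite /N'; lia.
- rewrite /G toGM -mulrBr; apply: woMl; exact: tr.
- by move=> s j sS le; apply: muE => //; apply: leq_trans le _; rewrite leq_addr.
Qed.
End Model.

(** * Solving an implicit equation whose linear part is the form B dx - A dy *)

Section Implicit.
Variables (R : realFieldType) (K : absField R).
Local Notation O := (cgerm K).
Local Notation X := (oX K).
Local Notation Y := (oY K).
Implicit Types (f g h e : series2 K) (tau sig : series2 K -> series2 K) (A B : O).

(* Operators raising both the order of vanishing and the size on small polydiscs from 8 to k:
   an operator of grade 9 is a contraction of a small ball. *)
Definition graded k tau :=
  [/\ forall e, ordge 8 e -> ordge k (tau e),
      forall e e' p, ordge 8 e -> ordge 8 e' -> ordge (8 + p) (e - e') -> ordge (k + p) (tau e - tau e') &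
      exists C r0 : R, [/\ 0 <= C, 0 < r0 <= 1 &
        forall r e, 0 < r <= r0 -> bnd r r (r ^+ 8) e -> bnd r r (C * r ^+ k) (tau e)]].

Lemma graded_const k (f : O) : ordge k f -> graded k (fun=> cgval f).
Proof.
move=> of_; split=> // [e e' p _ _ _|]; first by rewrite subrr.
have [M [r [r0 h]]] := (convergentP _).1 (cg_conv f).
exists (M / r ^+ k), (Num.min r 1); split.
- by rewrite divr_ge0 ?(bnd_ge0 h) // exprn_ge0 // ltW.
- by rewrite lt_min r0 ltr01 ge_min lexx orbT.
- move=> t e /andP[t0]; rewrite le_min => /andP[tr _] _.
  by apply: bnd_ordge => //; rewrite t0.
Qed.

Lemma gradedD k tau sig : graded k tau -> graded k sig -> graded k (fun e => tau e + sig e).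
Proof.
move=> [a1 b1 [C1 [r1 [C10 /andP[r10 r11] c1]]]] [a2 b2 [C2 [r2 [C20 /andP[r20 r21] c2]]]]; split.
- by move=> e oe; apply: woD; [apply: a1|apply: a2].
- move=> e e' p oe oe' d.
  have -> : tau e + sig e - (tau e' + sig e') = (tau e - tau e') + (sig e - sig e') by ring.
  by apply: woD; [apply: b1|apply: b2].
- exists (C1 + C2), (Num.min r1 r2); split; first by rewrite addr_ge0.
    by rewrite lt_min r10 r20 ge_min r11.
  move=> r e /andP[r0]; rewrite le_min => /andP[l1 l2] he; rewrite mulrDl.
  by apply: bndD; rewrite ?(ltW r0) //; [apply: c1|apply: c2]; rewrite ?r0.
Qed.

Lemma gradedM k l tau sig : graded k tau -> graded l sig -> graded (k + l) (fun e => tau e * sig e).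
Proof.
move=> [a1 b1 [C1 [r1 [C10 /andP[r10 r11] c1]]]] [a2 b2 [C2 [r2 [C20 /andP[r20 r21] c2]]]]; split.
- by move=> e oe; apply: woM; [apply: a1|apply: a2].
- move=> e e' p oe oe' d.
  have -> : tau e * sig e - tau e' * sig e' = (tau e - tau e') * sig e + tau e' * (sig e - sig e') by ring.
  apply: woD; first by rewrite addnAC; apply: woM; [apply: b1|apply: a2].
  by rewrite -addnA; apply: woM; [apply: a1|apply: b2].
- exists (C1 * C2), (Num.min r1 r2); split; first by rewrite mulr_ge0.
    by rewrite lt_min r10 r20 ge_min r11.
  move=> r e /andP[r0]; rewrite le_min => /andP[l1 l2] he; rewrite exprD mulrACA.
  by apply: bndM; rewrite ?(ltW r0) //; [apply: c1|apply: c2]; rewrite ?r0.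
Qed.

Lemma gradedN k tau : graded k tau -> graded k (fun e => - tau e).
Proof.
move=> [a1 b1 [C1 [r1 [C10 r10 c1]]]]; split.
- by move=> e oe; apply: woN; apply: a1.
- move=> e e' p oe oe' d; rewrite -opprD; apply: woN; exact: b1.
- exists C1, r1; split=> // r e lr he; apply: bndN; exact: c1.
Qed.

Lemma gradedW k l tau : (k <= l)%N -> graded l tau -> graded k tau.
Proof.
move=> le [a1 b1 [C1 [r1 [C10 /andP[r10 r11] c1]]]]; split.
- by move=> e oe; apply: (woW le); apply: a1.
- by move=> e e' p oe oe' d; apply: (@woW _ _ _ _ (l + p)); [rewrite leq_add2r|apply: b1].
- exists C1, r1; split; rewrite ?r10 // => r e /andP[r0 l1] he.
  apply: bndW (c1 _ _ _ he); last by rewrite r0.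
  apply: ler_wpM2l => //; apply: ler_wiXn2l => //; first exact: ltW.
  exact: le_trans r11.
Qed.

Lemma graded_exp k tau n : graded k tau -> graded (k * n) (fun e => tau e ^+ n).
Proof.
move=> h; elim: n => [|n IH]; first by rewrite muln0; apply: (@graded_const 0 1).
by rewrite mulnS; under [fun e => _]funext => e do rewrite exprS; apply: gradedM.
Qed.

Lemma graded_sum k n (tau : nat -> series2 K -> series2 K) : (forall i, graded k (tau i)) ->
  graded k (fun e => \sum_(i < n) tau i e).
Proof.
move=> h; elim: n => [|n IH].
  under [fun e => _]funext => e do rewrite big_ord0.
  exact: (@graded_const k 0).
by under [fun e => _]funext => e do rewrite big_ord_recr /=; apply: gradedD.
Qed.

Lemma graded_linear k tau : (k <= 8)%N -> (forall e e', tau e - tau e' = tau (e - e')) ->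
  (forall n e, ordge (8 + n) e -> ordge (k + n) (tau e)) ->
  (forall r M e, 0 < r -> bnd r r M e -> bnd r r (M / r ^+ (8 - k)) (tau e)) -> graded k tau.
Proof.
move=> le8 lin o b; split.
- by move=> e oe; rewrite -[k]addn0; apply: o.
- by move=> e e' p _ _ d; rewrite lin; apply: o.
- exists 1, 1; split; rewrite ?ltr01 ?lexx // => r e /andP[r0 _] he; rewrite mul1r.
  have -> : r ^+ k = r ^+ 8 / r ^+ (8 - k).
    have -> : r ^+ 8 = r ^+ (8 - k) * r ^+ k by rewrite -exprD subnK.
    by rewrite mulrAC divff ?mul1r // expf_neq0 // gt_eqF.
  exact: b.
Qed.

Definition at_y0 f : series2 K := fun i j => if j is 0%N then f i 0%N else 0.

Lemma bnd_at_y0 r M f : 0 < r -> bnd r r M f -> bnd r r M (at_y0 f).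
Proof.
move=> r0 h; rewrite -[M]mul1r; apply: bnd_term h => // i [|j] /=; rewrite mul1r //.
by rewrite nrm0 !mul0r !mulr_ge0 ?nrm_ge0 // exprn_ge0 // ltW.
Qed.

(** Division by the monomials y^2, xy, x^4, the initial forms of [B], [A] and, up to [beta], [Del].
    Keeping only y-free quotients for the last two makes the decomposition unique, hence linear in
    [e]. *)
Definition quot_yy e := shy 2 e.
Definition quot_xy e := at_y0 (shx 1 (shy 1 e)).
Definition quot_x4 e := at_y0 (shx 4 e).

Lemma quot_split e : ordge 4 e ->
  e = gY ^+ 2 * quot_yy e + gX * gY * quot_xy e + gX ^+ 4 * quot_x4 e.
Proof.
move=> /ordgeP oe; apply: germP => i j; rewrite !germD -mulrA gYnM gXM gXnM.
rewrite /quot_yy /quot_xy /quot_x4 /at_y0 /shy /shx.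
case: j => [|[|j]] /=.
- have -> : (if i is k.+1 then (gY * fun i j => if j is 0%N then e (i + 1)%N (0 + 1)%N else 0) k 0%N else 0) = 0.
    by case: i => // i; rewrite gYM.
  by rewrite !add0r; case: ltnP => [lt|ge]; [rewrite oe ?addn0|rewrite subnK].
- rewrite add0r; case: i => [|i]; first by rewrite oe // add0r.
  by rewrite gYM addn1 -[LHS]addr0; congr (_ + _); case: ifP.
- have -> : (if i is k.+1 then (gY * fun i j => if j is 0%N then e (i + 1)%N (0 + 1)%N else 0) k j.+2 else 0) = 0.
    by case: i => // i; rewrite gYM.
  by rewrite if_same !addr0 subn2 addn2.
Qed.

Lemma graded_yy : graded 6 quot_yy.
Proof.
apply: graded_linear => // [n e /ordgeP oe|r M e r0 h].
  by apply/ordgeP => i j lt; rewrite /quot_yy /shy oe //; lia.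
by apply: bnd_shy => //; apply: ltW.
Qed.

Lemma graded_xy : graded 6 quot_xy.
Proof.
apply: graded_linear => // [e e'|n e /ordgeP oe|r M e r0 h].
- by apply: germP => i [|j]; rewrite germB /quot_xy /at_y0 ?subrr.
- by apply/ordgeP => i [|j] lt //; rewrite /quot_xy /at_y0 /shy /shx oe //; lia.
- apply: bnd_at_y0 => //; have -> : M / r ^+ (8 - 6) = M / r ^+ 1 / r ^+ 1 by field; rewrite gt_eqF.
  by apply: bnd_shx; rewrite ?(ltW r0) //; apply: bnd_shy; rewrite ?(ltW r0).
Qed.

Lemma graded_x4 : graded 4 quot_x4.
Proof.
apply: graded_linear => // [e e'|n e /ordgeP oe|r M e r0 h].
- by apply: germP => i [|j]; rewrite germB /quot_x4 /at_y0 ?subrr.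
- by apply/ordgeP => i [|j] lt //; rewrite /quot_x4 /at_y0 /shx oe //; lia.
- by apply: bnd_at_y0 => //; apply: bnd_shx; rewrite ?(ltW r0).
Qed.

Lemma sum_low (L : nat -> nat -> series2 K) p : (forall i j, (2 <= i + j)%N -> L i j = 0) ->
  \sum_(i < p.+2) \sum_(j < p.+2) L i j = L 0%N 0%N + L 1%N 0%N + L 0%N 1%N.
Proof.
move=> L0; rewrite big_ord_recl big_ord_recl [X in _ + (_ + X)]big1 => [|i _]; last first.
  by rewrite big1 // => j _; apply: L0.
rewrite addr0; have -> : \sum_(j < p.+2) L (lift ord0 (@ord0 p)) j = L 1%N 0%N.
  by rewrite big_ord_recl big1 ?addr0 // => j _; apply: L0.
rewrite big_ord_recl big_ord_recl big1 => [|j _]; last exact: L0.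
by rewrite addr0 addrAC.
Qed.

(** The unknown is replaced by a series [e] of order 8, from which [eta1], [eta2] are built so that
    [B eta1 - A eta2] equals [e] up to higher order; the x^4 part is reached through [X B - Y A].
    This costs three orders, so [eta1], [eta2] have order 5 and their products order at least 10. *)
Lemma implicit_solution A B (Gam : {poly {poly O}}) : T1 A B ->
  ordge 9 Gam`_0`_0 -> ordge 4 (cgval Gam`_1`_0 - cgval B) -> ordge 4 (cgval Gam`_0`_1 + cgval A) ->
  exists eta1 eta2 : O, [/\ ordge 5 eta1, ordge 5 eta2 & ev (idfun : {rmorphism O -> O}) eta1 eta2 Gam = 0].
Proof.
move=> [oA oB iA iB [beta b0 [oD iD]]] o00 o10 o01.
pose b := B - Y ^+ 2; pose a := A - X * Y; pose d := oC beta^-1 * Del A B - X ^+ 4.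
have ipXY : ip 2 (gX * gY : series2 K) = 'X.
  apply/polyP => i; rewrite coef_ip coefX gXM.
  by case: i => [|[|[|i]]] //=; rewrite gYE.
have ipYY : ip 2 (gY ^+ 2 : series2 K) = 1.
  apply/polyP => i; rewrite -[gY ^+ 2]mulr1 coef_ip coef1 gYnM germ1E.
  by case: i => [|[|[|i]]].
have ipX4 : ip 4 (gX ^+ 4 : series2 K) = 'X^4.
  apply/polyP => i; rewrite -[gX ^+ 4]mulr1 coef_ip coefXn gXnM germ1E.
  by case: i => [|[|[|[|[|i]]]]].
have ob : ordge 3 b.
  rewrite /b cgB cgX; apply: ip_eq0; last by rewrite ipB iB ipYY subrr.
  by apply: woB => //; apply: ordge1_exp; apply: ordgeY.
have oa : ordge 3 a.
  rewrite /a cgB cgM; apply: ip_eq0; last by rewrite ipB iA ipXY subrr.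
  by apply: woB => //; apply: (woM (ordgeX K) (ordgeY K)).
have od : ordge 5 d.
  rewrite /d cgB cgM cgX; apply: ip_eq0.
    by apply: woB; [apply: woMl|apply: ordge1_exp; apply: ordgeX].
  rewrite ipB ipX4 -[4%N]add0n (@ipM _ 0 4) // ip_0 add0n iD -[cgval (oC _) 0%N 0%N]/(beta^-1).
  by rewrite mul_polyC scalerA mulVf // scale1r subrr.
pose eta1 e := quot_yy e + gC beta^-1 * gX * quot_x4 e.
pose eta2 e := - quot_xy e + gC beta^-1 * gY * quot_x4 e.
pose n := (size Gam + \sum_(i < size Gam) size (Gam`_i)%R + 2)%N.
pose q i j e := if (2 <= i + j)%N then cgval (Gam`_i`_j) * (eta1 e ^+ i * eta2 e ^+ j) else 0.
pose Q e := \sum_(i < n) \sum_(j < n) q i j e.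
pose h1 : O := Gam`_1`_0 - B; pose h2 : O := Gam`_0`_1 + A.
(* The equation reads [e = T e]: the monomial parts of [B], [A] and [Del / beta] reproduce [e], and
   [T] collects their tails [b], [a], [d], the errors [h1], [h2] of the linear coefficients, the
   constant term and the terms of degree at least 2. The orders 3 + 6, 3 + 6, 5 + 4, 4 + 5, 9 and 10
   all give grade 9. *)
pose T e := - (cgval Gam`_0`_0 + cgval h1 * eta1 e + cgval h2 * eta2 e
   + cgval b * quot_yy e + cgval a * quot_xy e + cgval d * quot_x4 e + Q e).
have gXx : graded 5 (fun e => gC beta^-1 * gX * quot_x4 e).
  apply: (@gradedM 1 4 (fun=> gC beta^-1 * gX)); last exact: graded_x4.
  by apply: (@graded_const 1 (oC beta^-1 * X)); rewrite cgM; apply: woMl; apply: ordgeX.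
have gYx : graded 5 (fun e => gC beta^-1 * gY * quot_x4 e).
  apply: (@gradedM 1 4 (fun=> gC beta^-1 * gY)); last exact: graded_x4.
  by apply: (@graded_const 1 (oC beta^-1 * Y)); rewrite cgM; apply: woMl; apply: ordgeY.
have g1 : graded 5 eta1 by apply: gradedD => //; apply: gradedW graded_yy.
have g2 : graded 5 eta2 by apply: gradedD => //; apply: gradedN; apply: gradedW graded_xy.
have gq i j : graded 9 (q i j).
  have -> : q i j = fun e => if (2 <= i + j)%N then cgval (Gam`_i`_j) * (eta1 e ^+ i * eta2 e ^+ j) else 0 by [].
  case: (leqP 2 (i + j)) => [le|lt]; last by apply: (@graded_const 9 0); apply: wo0.
  apply: (@gradedW 9 (0 + (5 * i + 5 * j))); first by clear -le; lia.
  apply: gradedM; first exact: graded_const.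
  by apply: gradedM; apply: graded_exp.
have gQ : graded 9 Q by apply: (@graded_sum 9 n (fun i e => \sum_(j < n) q i j e)) => i; apply: (@graded_sum 9 n (q i)).
have gT : graded 9 T.
  apply: gradedN; apply: gradedD => //; apply: gradedD; last exact: gradedM (graded_const od) graded_x4.
  apply: gradedD; last exact: gradedM (graded_const oa) graded_xy.
  apply: gradedD; last exact: gradedM (graded_const ob) graded_yy.
  apply: gradedD; last exact: gradedM (graded_const (f := h2) o01) g2.
  by apply: gradedD; [apply: graded_const|exact: gradedM (graded_const (f := h1) o10) g1].
have [aT bT [C [r0 [C0 /andP[r00 r01] cT]]]] := gT.
have [r /andP[rp rr0] Cr] := small_radius C0 ltr01 r00.
have [e [be oe] eT] : exists2 e, bnd r r (r ^+ 8) e /\ ordge 8 e & e = T e.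
  apply: (@germ_fixpoint _ 1 1 T (fun e => bnd r r (r ^+ 8) e /\ ordge 8 e)).
  - move=> k f g [_ of_] [_ og] dfg; have [lt|ge] := ltnP k 8.
      by apply: (@woW _ _ _ _ 9); [clear -lt; lia|apply: woB; apply: aT].
    have -> : k.+1 = (9 + (k - 8))%N by clear -ge; lia.
    by apply: bT => //; rewrite subnKC.
  - by apply: pointwise_closedI; [apply: pointwise_closed_bnd|apply: pointwise_closed_wo].
  - split=> //; apply: bndW (bnd0 _ _ _); rewrite ?exprn_ge0 //; exact: ltW.
  - move=> f [bf of_]; split; last by apply: (@woW _ _ _ _ 9) => //; apply: aT.
    apply: bndW (cT _ _ _ bf); last by rewrite rp.
    by rewrite exprS mulrA -[leRHS]mul1r ler_wpM2r // exprn_ge0 // ltW.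
have conv tau : graded 5 tau -> exists2 t : O, cgval t = tau e & ordge 5 t.
  move=> [a1 _ [C1 [r1 [C10 /andP[r10 r11] c1]]]].
  pose e' := e.
  suff c : converges (tau e) by exists (mkO c) => //; apply: a1.
  have := bnd_ordge rp be oe (s := Num.min r r1); rewrite lt_min rp r10 ge_min lexx /= => /(_ isT).
  rewrite divff ?mul1r; last by rewrite expf_neq0 // gt_eqF.
  move=> /c1 h; apply: (bnd_convergent _ _ (h _)); rewrite ?lt_min ?rp ?r10 ?ge_min ?lexx ?orbT //.
have [t1 E1 ot1] := conv _ g1; have [t2 E2 ot2] := conv _ g2.
exists t1, t2; split=> //; apply: cgP; rewrite cg0.
have szn : (size Gam <= n)%N by rewrite /n -addnA leq_addr.
have szn' i : (size (Gam`_i)%R <= n)%N.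
  have [lt|ge] := ltnP i (size Gam); last by rewrite nth_default ?size_poly0.
  by rewrite /n (bigD1 (Ordinal lt)) //=; clear; lia.
rewrite (@ev_sum _ _ _ _ _ _ n) //= cg_sum.
under eq_bigr => i _ do rewrite cg_sum.
under eq_bigr => i _ do under eq_bigr => j _ do rewrite !cgM !cgX E1 E2.
pose G i j := cgval (Gam`_i`_j) * (eta1 e ^+ i * eta2 e ^+ j).
have -> : \sum_(i < n) \sum_(j < n) G i j =
    G 0%N 0%N + G 1%N 0%N + G 0%N 1%N + Q e.
  pose L i j := if (2 <= i + j)%N then 0 else G i j.
  have -> : \sum_(i < n) \sum_(j < n) G i j = \sum_(i < n) \sum_(j < n) L i j + Q e.
    rewrite /Q -big_split; apply: eq_bigr => i _; rewrite -big_split; apply: eq_bigr => j _.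
    by rewrite /L /q /=; case: ifP; rewrite ?add0r ?addr0.
  by congr (_ + _); rewrite /n addn2 sum_low // => i j le; rewrite /L le.
have e4 : e = gY ^+ 2 * quot_yy e + gX * gY * quot_xy e + gX ^+ 4 * quot_x4 e.
  by apply: quot_split; apply: woW oe.
have hb : cgval b = cgval B - gY ^+ 2 by rewrite /b cgB cgX.
have ha : cgval a = cgval A - gX * gY by [].
have hd : cgval d = gC beta^-1 * (gX * cgval B - gY * cgval A) - gX ^+ 4 by rewrite /d cgB cgX.
have hh1 : cgval h1 = cgval Gam`_1`_0 - cgval B by [].
have hh2 : cgval h2 = cgval Gam`_0`_1 + cgval A by [].
have : e - T e = 0 by rewrite -eT subrr.
rewrite {1}e4 /T hb ha hd hh1 hh2 => <-.
rewrite /G !expr0 !expr1 /eta1 /eta2.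
move: (cgval Gam`_0`_0) (cgval Gam`_1`_0) (cgval Gam`_0`_1) (cgval A) (cgval B) => c1 c2 c3 c4 c5.
move: (quot_yy e) (quot_xy e) (quot_x4 e) (gC beta^-1) (Q e) => c6 c7 c8 c9 c10.
ring.
Qed.
End Implicit.

(** * Conjugating the pencil to its polynomial model *)

Section Expansion.
Variables (K A : comNzRingType) (iota : {rmorphism K -> A}) (p0 q0 lam : A).
Implicit Types p q : {poly {poly K}}.

Lemma map_derivD p q : map_poly (@deriv K) (p + q) = map_poly (@deriv K) p + map_poly (@deriv K) q.
Proof. by apply/polyP => i; rewrite coefD !coef_map_id0 ?deriv0 // coefD derivD. Qed.
Lemma map_derivM p q :
  map_poly (@deriv K) (p * q) = map_poly (@deriv K) p * q + p * map_poly (@deriv K) q.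
Proof.
apply/polyP => i; rewrite coef_map_id0 ?deriv0 // coefD !coefM.
rewrite (big_morph _ (@derivD _) (@deriv0 _)) -big_split; apply: eq_bigr => j _.
by rewrite derivM !coef_map_id0 ?deriv0.
Qed.

(** Substitution of [(p0 + lam X, q0 + lam Y)] with formal unknowns [X], [Y]: divisibility can be
    settled coefficient by coefficient before the unknowns are solved for. *)
Definition expand p : {poly {poly A}} :=
  ev (polyC \o (polyC \o iota)) (p0%:P%:P + lam%:P%:P * 'X) (q0%:P%:P + lam%:P%:P * 'X%:P) p.

Lemma expandD p q : expand (p + q) = expand p + expand q. Proof. exact: rmorphD. Qed.
Lemma expandM p q : expand (p * q) = expand p * expand q. Proof. exact: evM. Qed.
Lemma expandC c : expand c%:P%:P = (iota c)%:P%:P. Proof. by rewrite /expand evC ev1C. Qed.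
Lemma expandX : expand 'X = p0%:P%:P + lam%:P%:P * 'X. Proof. by rewrite /expand evX. Qed.
Lemma expandY : expand 'X%:P = q0%:P%:P + lam%:P%:P * 'X%:P. Proof. by rewrite /expand evC ev1X. Qed.
Lemma expandB p q : expand (p - q) = expand p - expand q. Proof. exact: evB. Qed.
Lemma expand_exp p n : expand (p ^+ n) = expand p ^+ n. Proof. exact: rmorphXn. Qed.

Lemma expand_mod p : exists t, expand p = (ev iota p0 q0 p)%:P%:P + lam%:P%:P * t.
Proof.
elim/poly2_ind: p => [c|||p q [t1 e1] [t2 e2]|p q [t1 e1] [t2 e2]].
- by exists 0; rewrite expandC evC ev1C mulr0 addr0.
- by exists 'X; rewrite expandX evX.
- by exists 'X%:P; rewrite expandY evC ev1X.
- by exists (t1 + t2); rewrite expandD e1 e2 rmorphD /= !polyCD; ring.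
- exists ((ev iota p0 q0 p)%:P%:P * t2 + t1 * (ev iota p0 q0 q)%:P%:P + lam%:P%:P * t1 * t2).
  by rewrite expandM e1 e2 evM !polyCM; ring.
Qed.

Lemma expand_coef p : [/\ (expand p)`_0`_0 = ev iota p0 q0 p,
  (expand p)`_1`_0 = lam * ev iota p0 q0 p^`() &
  (expand p)`_0`_1 = lam * ev iota p0 q0 (map_poly (@deriv K) p)].
Proof.
elim/poly2_ind: p => [c|||p q [a0 a1 a2] [b0 b1 b2]|p q [a0 a1 a2] [b0 b1 b2]].
- rewrite expandC evC ev1C derivC map_polyC /= derivC polyC0 !(rmorph0 (ev iota p0 q0)) !mulr0 !coefC /=.
  by rewrite ?coefC ?coef0.
- rewrite expandX evX derivX (rmorph1 (ev iota p0 q0)) mulr1.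
  have -> : map_poly (@deriv K) 'X = 0.
    by apply/polyP => i; rewrite coef_map_id0 ?deriv0 // coefX coef0; case: (i == 1%N); rewrite ?derivC ?deriv0.
  rewrite (rmorph0 (ev iota p0 q0)) mulr0.
  by split; rewrite coefD coefCM coefX coefC /= ?mulr0 ?mulr1 ?addr0 ?add0r ?coefC ?coef0.
- rewrite expandY evC ev1X derivC (rmorph0 (ev iota p0 q0)) mulr0 map_polyC /= derivX.
  rewrite (rmorph1 (ev iota p0 q0)) mulr1 -polyCM -polyCD.
  by split; rewrite coefC /= ?coef0 // coefD coefCM coefX coefC /= ?mulr0 ?mulr1 ?addr0 ?add0r.
- rewrite expandD !coefD derivD a0 a1 a2 b0 b1 b2.
  by rewrite map_derivD !(rmorphD (ev iota p0 q0)) !mulrDr.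
- rewrite expandM; set Q1 := expand p in a0 a1 a2 *; set Q2 := expand q in b0 b1 b2 *.
  split; first by rewrite coefM big_ord1 coefM big_ord1 a0 b0 evM.
    rewrite coefM big_ord_recl big_ord1 /= subn0 coefD !coefM !big_ord1 /= a0 a1 b0 b1 derivM.
    by rewrite (rmorphD (ev iota p0 q0)) /= !evM; ring.
  rewrite coefM big_ord1 coefM big_ord_recl big_ord1 /= subn0 a0 a2 b0 b2.
  by rewrite map_derivM (rmorphD (ev iota p0 q0)) /= !evM; ring.
Qed.

Lemma expand_ev eta1 eta2 p : ev (idfun : {rmorphism A -> A}) eta1 eta2 (expand p) =
  ev iota (p0 + lam * eta1) (q0 + lam * eta2) p.
Proof.
set h := ev _ eta1 eta2; have hC u : h u%:P%:P = u by rewrite /h evC ev1C.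
have hD : {morph h : u v / u + v} by exact: rmorphD.
have hM : {morph h : u v / u * v} by exact: rmorphM.
elim/poly2_ind: p => [c|||p q IHp IHq|p q IHp IHq].
- by rewrite expandC evC ev1C hC.
- by rewrite expandX evX hD hM !hC /h evX.
- by rewrite expandY evC ev1X hD hM !hC /h evC ev1X.
- by rewrite expandD hD IHp IHq (rmorphD (ev iota _ _)).
- by rewrite expandM hM IHp IHq evM.
Qed.

Lemma coefCC (u : A) (Q : {poly {poly A}}) i j : (u%:P%:P * Q)`_i`_j = u * Q`_i`_j.
Proof. by rewrite !coefCM. Qed.

(** Both pencils have the same critical value: with [f = c g + l^m k] and [F = c G + L^m H] the
    terms in [c] cancel. As [l] divides [lam], the substituted [L] remains a multiple of [l]
    whatever the unknowns. *)
Lemma expand_divides (f g l w w' k c : A) m (F G L H : {poly {poly K}}) (c0 : K) : iota c0 = c ->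
  f - c * g = l ^+ m * k -> F - c0%:P%:P * G = L ^+ m * H ->
  ev iota p0 q0 L = l * w -> lam = l * w' ->
  exists Q, g%:P%:P * expand F - f%:P%:P * expand G = (l ^+ m)%:P%:P * Q.
Proof.
move=> <- crit fac adj lamE; have [t tE] := expand_mod L.
have lE : expand L = l%:P%:P * (w%:P%:P + w'%:P%:P * t) by rewrite tE adj lamE !polyCM; ring.
have FE : expand F = (iota c0)%:P%:P * expand G + (l ^+ m)%:P%:P * ((w%:P%:P + w'%:P%:P * t) ^+ m * expand H).
  by rewrite mulrA !polyC_exp -exprMn -lE -expand_exp -expandM -fac expandB expandM expandC addrC subrK.
have fE : f%:P%:P = (iota c0)%:P%:P * g%:P%:P + (l ^+ m)%:P%:P * k%:P%:P :> {poly {poly A}}.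
  by rewrite -!polyCM -!polyCD -crit addrC subrK.
exists (g%:P%:P * ((w%:P%:P + w'%:P%:P * t) ^+ m * expand H) - k%:P%:P * expand G).
by rewrite FE fE; ring.
Qed.
End Expansion.

(** * Moving the leaves onto the model curves *)

Section Conjugation.
Variables (R : realFieldType) (K : absField R).
Local Notation O := (cgerm K).
Local Notation X := (oX K).
Local Notation Y := (oY K).
Local Notation PP := {poly {poly K}}.
Local Notation PPO := {poly {poly O}}.
Local Notation evO := (ev (@oC R K)).
Implicit Types (A B f g : O) (p q : PP).

Lemma evO_val (a b : O) p : cgval (evO a b p) = evG (cgval a) (cgval b) p.
Proof.
elim/poly2_ind: p => [c|||p q IHp IHq|p q IHp IHq].
- by rewrite !evC !ev1C.
- by rewrite !evX.
- by rewrite !evC !ev1X.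
- by rewrite !rmorphD /= -IHp -IHq.
- by rewrite !rmorphM /= -IHp -IHq.
Qed.

Lemma graph_diff (nu mu : O) : onlyX nu -> nu 0%N 0%N = 0 -> onlyX mu -> mu 0%N 0%N = 0 ->
  nu 1%N 0%N != mu 1%N 0%N -> exists2 u : O, graph mu = graph nu + Y * u & u 0%N 0%N != 0.
Proof.
move=> on n0 om m0 ne; pose del := ocmp Y 0 nu - ocmp Y 0 mu.
have delE i j : del i j = if i is 0%N then nu j 0%N - mu j 0%N else 0.
  rewrite /del cgB germB /= !gcomp_onlyX_Y //; case: i => // i; exact: subrr.
exists (oshy 1 del).
  have -> : Y * oshy 1 del = del; last by rewrite /graph /del; ring.
  apply: cgP; rewrite cgM -[cgval Y]expr1; apply: shyK => i j; rewrite ltnS leqn0 => /eqP ->.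
  by rewrite delE n0 m0 subrr; case: i.
by rewrite -[X in X != _]/(del 0%N 1%N) delE subr_eq0.
Qed.

(** Lagrange interpolation on curves that all meet at the origin: on the leaf [s] the product of the
    others is a unit times [Y^(n s)], and the factor [Y^(N + size S)] pays for dividing by it while
    keeping order [N]. *)
Lemma leaves_interpolation (S : seq K) (nu : K -> O) N (E : K -> O) : uniq S -> leaves S nu ->
  exists2 xi : O, ordge N xi &
  forall s, s \in S -> exists w, xi - Y ^+ (N + size S) * E s = graph (nu s) * w.
Proof.
move=> US lv; pose n s := count (predC1 s) S; pose L s := \prod_(t <- S | t != s) graph (nu t).
have step s : exists Uw : O * O, s \in S ->
    L s = Y ^+ n s * Uw.1 + graph (nu s) * Uw.2 /\ Uw.1 0%N 0%N != 0.
  case sS : (s \in S); last by exists (0, 0).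
  suff [U [w [e U0]]] : exists U w : O, L s = Y ^+ n s * U + graph (nu s) * w /\ U 0%N 0%N != 0.
    by exists (U, w).
  rewrite /L /n; have : {subset S <= S} by [].
  elim: {1 3 4}S => [|t S' IH] sub.
    by exists 1, 0; rewrite big_nil mulr0 addr0 mul1r; split=> //; rewrite cg1 germ1_00 oner_eq0.
  have [U [w [e U0]]] := IH (fun x xS => sub x (mem_behead (s := t :: S') xS)).
  rewrite big_cons /=; case: eqP => [->|/eqP ts] /=; first by exists U, w.
  have [on n0 n1] := lv s sS; have [om m0 m1] := lv t (sub t (mem_head _ _)).
  have [|u uE u0] := graph_diff on n0 om m0; first by rewrite n1 m1 eq_sym.
  exists (u * U), (Y * u * w + \prod_(t <- S' | t != s) graph (nu t)); split.
    by rewrite {1}uE mulrDl -[X in _ + X]mulrA {2}e exprD expr1; ring.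
  by rewrite cgM germM00 mulf_neq0.
have [Uw UwP] := choice step.
exists (\sum_(s <- S) Y ^+ (N + size S - n s) * E s * (Uw s).1^-1 * L s).
  rewrite cg_sum; apply: wo_sum => s _; rewrite !cgM; do 3 apply: woMr; rewrite cgX.
  apply: (@woW _ _ _ _ (N + size S - n s)); last exact: ordge1_exp (ordgeY K).
  by have : (n s <= size S)%N := count_size _ _; move: (n s) => ns; lia.
move=> s sS; have [LE U0] := UwP s sS.
have [w wE] : exists w, \sum_(t <- S | t != s) Y ^+ (N + size S - n t) * E t * (Uw t).1^-1 * L t = graph (nu s) * w.
  exists (\sum_(t <- S | t != s) (Y ^+ (N + size S - n t) * E t * (Uw t).1^-1) *
      \prod_(t' <- rem s S | t' != t) graph (nu t')).
  rewrite mulr_sumr; apply: eq_bigr => t ts; rewrite /L (big_rem s) //= eq_sym ts; ring.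
exists (Y ^+ (N + size S - n s) * E s * (Uw s).1^-1 * (Uw s).2 + w).
rewrite (bigD1_seq s) //= wE LE.
have -> : Y ^+ (N + size S) = Y ^+ (N + size S - n s) * Y ^+ n s.
  by rewrite -exprD subnK //; have : (n s <= size S)%N := count_size _ _; move: (n s) => ns; lia.
move: (Y ^+ (N + size S - n s)) (Y ^+ n s) (graph (nu s)) => a b l.
have UV : (Uw s).1^-1 * (Uw s).1 = 1 by rewrite mulVr // ounitE.
move: ((Uw s).1^-1) UV => V; move: (Uw s).1 => U UV.
transitivity (a * E s * b * (V * U) + a * E s * V * l * (Uw s).2 + l * w - a * b * E s); first by ring.
by rewrite UV; ring.
Qed.

(** Only x is moved, by a germ equal to [mu_s(y) - nu_s(y)] on each leaf [s]; that difference is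
    divisible by a high power of y because the two curves agree to high order. *)
Lemma leaf_adjust (S : seq K) (nu : K -> O) (mu : K -> {poly K}) N : uniq S -> leaves S nu ->
  (forall s j, s \in S -> (j < N + size S)%N -> (mu s)`_j = nu s j 0%N) ->
  exists2 p0 : O, ordge N (cgval p0 - gX) &
  forall s, s \in S -> exists w, evO p0 Y ('X - (mu s)%:P) = graph (nu s) * w.
Proof.
move=> US lv muE; pose del s := evO X Y (mu s)%:P - ocmp Y 0 (nu s).
have [xi oxi xiP] := leaves_interpolation N (fun s => oshy (N + size S) (del s)) US lv.
exists (X + xi).
  by have -> : cgval (X + xi) - gX = cgval xi by rewrite cgD [LHS]addrAC subrr add0r.
move=> s sS; have [w wE] := xiP s sS; exists (1 + w).
have delE : del s = Y ^+ (N + size S) * oshy (N + size S) (del s).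
  apply: cgP; rewrite cgM cgX; apply/esym/shyK => i j lt; have [on _ _] := lv s sS.
  rewrite /del cgB germB evO_val -toGE toGC /= gcomp_onlyX_Y //.
  by case: i => [|i]; rewrite ?muE ?subrr.
rewrite -delE in wE; rewrite evB evX evC mulrDr -wE /graph /del evC; ring.
Qed.

(** The terms where the derivation falls on [r] cancel, as in any Wronskian; only derivatives of the
    errors remain, with a loss of one order. *)
Lemma derivation_ordge1 (D : series2 K -> series2 K) N (r f1 f2 g1 g2 : series2 K) :
  {morph D : x y / x + y} -> (forall x y, D (x * y) = D x * y + x * D y) ->
  (forall n u, ordge n u -> ordge n.-1 (D u)) ->
  ordge N (f1 - r * f2) -> ordge N (g1 - r * g2) ->
  ordge N.-1 (g2 * D f1 - f2 * D g1 - r * (g2 * D f2 - f2 * D g2)).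
Proof.
move=> DD DM Do; set h1 := f1 - _; set h2 := g1 - _ => o1 o2.
have [f1E g1E] : f1 = r * f2 + h1 /\ g1 = r * g2 + h2 by rewrite /h1 /h2; split; ring.
move: h1 h2 f1E g1E o1 o2 => h1 h2 -> -> o1 o2.
rewrite !DD !DM (_ : _ - _ - _ = g2 * D h1 - f2 * D h2); last by ring.
by apply: woB; apply: woMl; apply: Do.
Qed.

Lemma derivation_ordge2 (D : series2 K -> series2 K) N (r f1 f2 g1 g2 : series2 K) :
  {morph D : x y / x + y} -> (forall x y, D (x * y) = D x * y + x * D y) ->
  (forall n u, ordge n u -> ordge n.-1 (D u)) ->
  ordge N (f1 - r * f2) -> ordge N (g1 - r * g2) ->
  ordge N.-1 (g1 * D f1 - f1 * D g1 - r ^+ 2 * (g2 * D f2 - f2 * D g2)).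
Proof.
move=> DD DM Do o1 o2.
have h := derivation_ordge1 DD DM Do o1 o2.
have -> : g1 * D f1 - f1 * D g1 - r ^+ 2 * (g2 * D f2 - f2 * D g2)
  = (g1 - r * g2) * D f1 - (f1 - r * f2) * D g1
    + r * (g2 * D f1 - f2 * D g1 - r * (g2 * D f2 - f2 * D g2)) by ring.
apply: woD; last exact: woMl.
by apply: woB; apply: woMr; apply: (woW (leq_pred N)).
Qed.

(** Divisibility is tested on the coefficients of the formal unknowns, which are germs, and the
    quotients are reassembled into a polynomial. *)
Lemma pencil_quotient (S : seq K) nu c m k f g (p0 q0 Lam : O) (F G : PP) (mu : K -> {poly K}) (H : K -> PP) :
  uniq S -> leaves S nu ->
  (forall s, s \in S -> f - oC (c s) * g = graph (nu s) ^+ (m s).+1 * k s) ->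
  (forall s, s \in S -> F - (c s)%:P%:P * G = ('X - (mu s)%:P) ^+ (m s).+1 * H s) ->
  (forall s, s \in S -> exists w, evO p0 q0 ('X - (mu s)%:P) = graph (nu s) * w) ->
  (forall s, s \in S -> exists w, Lam = graph (nu s) * w) ->
  exists Gam : PPO, g%:P%:P * expand (@oC R K) p0 q0 Lam F - f%:P%:P * expand (@oC R K) p0 q0 Lam G
    = (\prod_(s <- S) graph (nu s) ^+ (m s).+1)%:P%:P * Gam.
Proof.
move=> US lv crit fac adj Lam_dvd; set Psi := _ - _; set W := \prod_(s <- S) _.
have dvd i j : exists u : O, Psi`_i`_j = W * u.
  apply: leaves_prod => // s sS.
  have [w wE] := adj s sS; have [w' wE'] := Lam_dvd s sS.
  have [Q QE] := expand_divides (erefl (oC (c s))) (crit s sS) (fac s sS) wE wE'.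
  by exists Q`_i`_j; rewrite /Psi QE coefCC.
have /choice[ga gaP] : forall ij : nat * nat, exists u : O, Psi`_ij.1`_ij.2 = W * u.
  by move=> [i j]; apply: dvd.
pose n := (size Psi + \sum_(i < size Psi) size (Psi`_i)%R)%N.
have szn : (size Psi <= n)%N by rewrite /n leq_addr.
have szn' i : (size (Psi`_i)%R <= n)%N.
  have [lt|ge] := ltnP i (size Psi); last by rewrite nth_default ?size_poly0.
  by rewrite /n (bigD1 (Ordinal lt)) //=; clear; lia.
exists (\poly_(i < n) \poly_(j < n) ga (i, j)); apply/polyP => i; apply/polyP => j; rewrite coefCC coef_poly.
case: ltnP => ii; last by rewrite coef0 mulr0 (nth_default _ (leq_trans szn ii)) coef0.
rewrite coef_poly; case: ltnP => jj; last by rewrite mulr0 (nth_default _ (leq_trans (szn' i) jj)).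
exact: (gaP (i, j)).
Qed.
End Conjugation.

Section PencilPoly.
Variable A : comNzRingType.
Implicit Types (f g u : A) (P Q : {poly {poly A}}).

Lemma pencil_coef f g P Q i j : (g%:P%:P * P - f%:P%:P * Q)`_i`_j = g * P`_i`_j - f * Q`_i`_j.
Proof. by rewrite !coefB !coefCC. Qed.

Lemma ev_id_scale eta1 eta2 u P : ev (idfun : {rmorphism A -> A}) eta1 eta2 (u%:P%:P * P)
  = u * ev (idfun : {rmorphism A -> A}) eta1 eta2 P.
Proof. by rewrite evM evC ev1C. Qed.

Lemma ev_id_pencil eta1 eta2 f g P Q : ev (idfun : {rmorphism A -> A}) eta1 eta2 (g%:P%:P * P - f%:P%:P * Q)
  = g * ev (idfun : {rmorphism A -> A}) eta1 eta2 P - f * ev (idfun : {rmorphism A -> A}) eta1 eta2 Q.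
Proof. by rewrite evB !ev_id_scale. Qed.
End PencilPoly.

(** * Existence of the conjugacy and of the polynomial form *)

Section Conjugation.
Variables (R : realFieldType) (K : absField R).
Local Notation O := (cgerm K).
Local Notation X := (oX K).
Local Notation Y := (oY K).
Local Notation PP := {poly {poly K}}.
Local Notation evO := (ev (@oC R K)).
Implicit Types (A B f g : O).

Lemma lines_ip (S : seq K) (l : K -> series2 K) (n : K -> nat) :
  (forall s, s \in S -> ordge 1 (l s) /\ ip 1 (l s) = 'X - s%:P) ->
  ordge (\sum_(s <- S) n s) (\prod_(s <- S) l s ^+ n s) /\
  ip (\sum_(s <- S) n s) (\prod_(s <- S) l s ^+ n s) = \prod_(s <- S) ('X - s%:P) ^+ n s.
Proof.
move=> h; have o s : s \in S -> ordge (n s) (l s ^+ n s) by move=> /h[o _]; apply: ordge1_exp.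
split; first exact: wo_prod_seq.
rewrite ip_prod_seq //; apply: eq_big_seq => s sS; have [os is_] := h s sS.
by rewrite ip1_exp // is_.
Qed.

Lemma lines_prod_neq0 (S : seq K) (n : K -> nat) : \prod_(s <- S) ('X - s%:P) ^+ n s != 0 :> {poly K}.
Proof. by rewrite prodf_seq_neq0; apply/allP => s _; rewrite expf_neq0 // polyXsubC_eq0. Qed.

Lemma leaves_ip (S : seq K) nu (n : K -> nat) : leaves S nu ->
  ordge (\sum_(s <- S) n s) (\prod_(s <- S) graph (nu s) ^+ n s : O) /\
  ip (\sum_(s <- S) n s) (\prod_(s <- S) graph (nu s) ^+ n s : O) = \prod_(s <- S) ('X - s%:P) ^+ n s.
Proof.
move=> lv; have -> : cgval (\prod_(s <- S) graph (nu s) ^+ n s) = \prod_(s <- S) cgval (graph (nu s)) ^+ n s.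
  by rewrite cg_prod; apply: eq_bigr => s _; rewrite cgX.
by apply: lines_ip => s sS; have [on n0 n1] := lv s sS; have := graph_ip on n0; rewrite n1.
Qed.

Lemma conjugation_exists A B f g S nu c m k e N : T1 A B -> critical_data A B f g S nu c m k e ->
  exists (F G : PP) (mu : K -> {poly K}) (H : K -> PP) (rho : {poly K}) (p q : O),
  [/\ rho.[0] != 0,
      forall s, s \in S -> (mu s)`_0 = 0 /\ (mu s)`_1 = s,
      forall s, s \in S -> F - (c s)%:P%:P * G = ('X - (mu s)%:P) ^+ (m s).+1 * H s,
      ordge N (toG F - toG rho%:P * f) /\ ordge N (toG G - toG rho%:P * g) &
      [/\ ordge 4 (cgval p - gX), ordge 4 (cgval q - gY) & g * evO p q F = f * evO p q G]].
Proof.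
move=> T [US lv crit e0 [Ex Ey]].
pose w := (\sum_(s <- S) (m s).+1)%N; pose d := (\sum_(s <- S) m s)%N.
have dw : (d <= w)%N by apply: leq_sum.
(* Division by [W] costs [w] orders and 9 must remain in the constant term; the linear coefficients
   lose one order to differentiation and at most [w] to [Pm], and need 4. The extra [size S] in [N1]
   is consumed by the interpolation on the leaves. *)
pose N2 := (N + w + 11)%N; pose N1 := (N2 + size S)%N.
have [F [G [mu [H [rho [rho0 fac oF oG muE]]]]]] := model_exists N1 US lv crit.
have [|p0 op0 adj] := @leaf_adjust _ _ S nu mu N2 US lv.
  by move=> s j sS lt; apply: muE => //; apply: ltnW.
pose Lam := \prod_(s <- S) graph (nu s).
pose Pm := \prod_(s <- S) graph (nu s) ^+ m s.
pose W := \prod_(s <- S) graph (nu s) ^+ (m s).+1.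
have WE : W = Lam * Pm by rewrite /W /Lam /Pm -big_split; apply: eq_bigr => s _; rewrite exprS.
have Lam0 : Lam != 0.
  rewrite prodf_seq_neq0; apply/allP => s sS; have [on n0 _] := lv s sS.
  exact: graph_neq0.
have Ld s : s \in S -> exists w, Lam = graph (nu s) * w.
  by move=> sS; exists (\prod_(t <- rem s S) graph (nu t)); rewrite /Lam (big_rem s).
have [Gam GamE] := pencil_quotient US lv crit fac adj Ld.
have [F00 F10 F01] := expand_coef (@oC R K) p0 Y Lam F.
have [G00 G10 G01] := expand_coef (@oC R K) p0 Y Lam G.
have coefE i j : W * Gam`_i`_j = g * (expand (@oC R K) p0 Y Lam F)`_i`_j - f * (expand (@oC R K) p0 Y Lam G)`_i`_j.
  by rewrite -pencil_coef GamE coefCC.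
have pen a1 a2 b1 b2 : a1 = a2 -> b1 = b2 -> g * a1 - f * b1 = g * a2 - f * b2 by move=> -> ->.
have E00 : W * Gam`_0`_0 = g * evO p0 Y F - f * evO p0 Y G := etrans (coefE _ _) (pen _ _ _ _ F00 G00).
have penL a b : g * (Lam * a) - f * (Lam * b) = Lam * (g * a - f * b) by ring.
(* A linear coefficient carries one factor [Lam]; cancelled against [W] it leaves [Pm], exactly the
   factor contained in [g df - f dg]. *)
have E10 : Pm * Gam`_1`_0 = g * evO p0 Y F^`() - f * evO p0 Y G^`().
  apply: (mulfI Lam0); rewrite mulrA -WE; apply: etrans (penL _ _).
  exact: etrans (coefE _ _) (pen _ _ _ _ F10 G10).
have E01 : Pm * Gam`_0`_1 = g * evO p0 Y (map_poly (@deriv K) F) - f * evO p0 Y (map_poly (@deriv K) G).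
  apply: (mulfI Lam0); rewrite mulrA -WE; apply: etrans (penL _ _).
  exact: etrans (coefE _ _) (pen _ _ _ _ F01 G01).
have cong P : ordge N2 (cgval (evO p0 Y P) - toG P).
  by rewrite evO_val toGE; apply: ev_congr => //; rewrite subrr.
pose r := evO X Y rho%:P; have rE : cgval r = toG rho%:P by rewrite /r evO_val -toGE.
have r00 : r 0%N 0%N = rho.[0] by rewrite rE toGC horner_coef0.
have NN : (N2 <= N1)%N by rewrite leq_addr.
have [oW iW] := leaves_ip (fun s => (m s).+1) lv; rewrite -/w -/W in oW iW.
have [oPm iPm] := leaves_ip m lv; rewrite -/d -/Pm in oPm iPm.
have abel (g1 f1 F1 F2 G1 G2 : series2 K) : g1 * F1 - f1 * G1
  = g1 * (F1 - F2) - f1 * (G1 - G2) + (g1 * F2 - f1 * G2) by ring.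
have o00 : ordge 9 Gam`_0`_0.
  apply: (ordge_cancel oW); first by rewrite iW lines_prod_neq0.
  apply: (@woW _ _ _ _ N2); first by rewrite /N2; clear; lia.
  rewrite -cgM E00 cgB !cgM (abel _ _ _ (toG F) _ (toG G)).
  apply: woD; first by apply: woB; apply: woMl.
  have -> : cgval g * toG F - cgval f * toG G
     = cgval g * (toG F - toG rho%:P * cgval f) - cgval f * (toG G - toG rho%:P * cgval g) by ring.
  by apply: (woW NN); apply: woB; apply: woMl.
(* Up to high order the model is [r] times the pencil, so dividing by [Pm] shows that the linear
   coefficients are [r e B] and [- r e A] to order 4. Division by the unit [r e] then gives the
   normalized equation. *)
have high (D : series2 K -> series2 K) (GD A' : O) (F1 G1 : PP) :
    {morph D : x y / x + y} -> (forall x y, D (x * y) = D x * y + x * D y) ->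
    (forall n u, ordge n u -> ordge n.-1 (D u)) ->
    toG F1 = D (toG F) -> toG G1 = D (toG G) ->
    cgval g * D f - cgval f * D g = cgval (e * Pm * A') ->
    Pm * GD = g * evO p0 Y F1 - f * evO p0 Y G1 ->
    ordge 4 (GD - r * e * A').
  move=> DD DM Do F1E G1E wr GE.
  apply: (ordge_cancel oPm); first by rewrite iPm lines_prod_neq0.
  apply: (@woW _ _ _ _ N2.-1); first by rewrite /N2; clear -dw; lia.
  have h := derivation_ordge1 DD DM Do oF oG.
  have -> : cgval Pm * cgval (GD - r * e * A')
      = cgval (Pm * GD) - cgval r * (cgval g * D f - cgval f * D g).
    by rewrite wr -!cgM -cgB; congr (cgval _); ring.
  rewrite GE cgB !cgM (abel g f (cgval (evO p0 Y F1)) (toG F1) (cgval (evO p0 Y G1)) (toG G1)) rE.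
  have -> (a b c' : series2 K) : a + b - c' = a + (b - c') by ring.
  apply: woD; first by apply: (woW (leq_pred N2)); apply: woB; apply: woMl; apply: cong.
  by rewrite F1E G1E; apply: woW h; rewrite /N1 /N2; clear; lia.
have o10 : ordge 4 (Gam`_1`_0 - r * e * B).
  apply: (high (@dx K)) E10; [exact: dxD|exact: dxM|exact: ordge_dx|exact: toG_dx|exact: toG_dx|].
  by rewrite -Ex.
have o01 : ordge 4 (Gam`_0`_1 - r * e * - A).
  apply: (high (@dy K)) E01; [exact: dyD|exact: dyM|exact: ordge_dy|exact: toG_dy|exact: toG_dy|].
  by rewrite mulrN -Ey.
have ure : r * e \is a GRing.unit by rewrite ounitE cgM germM00 r00 mulf_neq0.
pose V := (r * e)^-1; have VE : V * (r * e) = 1 by rewrite mulVr.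
have VB (x y : O) : V * (x - r * e * y) = V * x - y.
  by rewrite mulrBr [V * (r * e * y)]mulrA VE mul1r.
have [|||eta1 [eta2 [oe1 oe2 eta0]]] := @implicit_solution _ _ A B (V%:P%:P * Gam) T.
- have -> : cgval (V%:P%:P * Gam)`_0`_0 = cgval (V * Gam`_0`_0) by congr (cgval _); apply: coefCC.
  by rewrite cgM; apply: woMl.
- have -> : cgval (V%:P%:P * Gam)`_1`_0 - cgval B = cgval (V * (Gam`_1`_0 - r * e * B)).
    by rewrite VB cgB; congr (cgval _ - _); apply: coefCC.
  by rewrite cgM; apply: woMl.
- have -> : cgval (V%:P%:P * Gam)`_0`_1 + cgval A = cgval (V * (Gam`_0`_1 - r * e * - A)).
    by rewrite VB opprK cgD; congr (cgval _ + _); apply: coefCC.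
  by rewrite cgM; apply: woMl.
exists F, G, mu, H, rho, (p0 + Lam * eta1), (Y + Lam * eta2); split=> //.
- move=> s sS; have [_ n0 n1] := lv s sS.
  by rewrite !muE // /N1 /N2; clear; lia.
- by split; apply: (@woW _ _ _ _ N1) => //; rewrite /N1 /N2; clear; lia.
- split.
  + have -> : cgval (p0 + Lam * eta1) - gX = (cgval p0 - gX) + cgval Lam * cgval eta1.
      by rewrite cgD cgM; ring.
    apply: woD; first by apply: woW op0; rewrite /N2; clear; lia.
    by apply: woMl; apply: woW oe1.
  + have -> : cgval (Y + Lam * eta2) - gY = cgval Lam * cgval eta2.
      by rewrite cgD cgM -[cgval Y]/gY; ring.
    by apply: woMl; apply: woW oe2.
  + apply/eqP; rewrite -subr_eq0 -!expand_ev -ev_id_pencil GamE ev_id_scale.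
    rewrite ev_id_scale in eta0.
    have V0 : V != 0 by apply: contra_eq_neq VE => ->; rewrite mul0r eq_sym oner_eq0.
    by move/eqP: eta0; rewrite mulf_eq0 (negPf V0) /= => /eqP ->; rewrite mulr0.
Qed.

Lemma pencil_derivation (A0 : comNzRingType) (D : A0 -> A0) (F G H L c : A0) n :
  {morph D : x y / x + y} -> (forall x y, D (x * y) = D x * y + x * D y) -> D c = 0 ->
  F = c * G + L ^+ n.+1 * H -> exists q, G * D F - F * D G = L ^+ n * q.
Proof.
move=> DD DM Dc ->.
have DX k : exists t, D (L ^+ k.+1) = L ^+ k * t.
  elim: k => [|k [t tE]]; first by exists (D L); rewrite expr1 mul1r.
  by exists (t + D L); rewrite exprS DM tE exprS; ring.
have [t tE] := DX n.
exists (G * (t * H + L * D H) - L * H * D G).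
by rewrite DD !DM Dc tE exprS; ring.
Qed.

Lemma line_powers_prod (S : seq K) (mu : K -> {poly K}) (n : K -> nat) (P : PP) : uniq S ->
  (forall s, s \in S -> (mu s)`_1 = s) ->
  (forall s, s \in S -> exists q, P = ('X - (mu s)%:P) ^+ n s * q) ->
  exists q, P = (\prod_(s <- S) ('X - (mu s)%:P) ^+ n s) * q.
Proof.
move=> US mu1 dv; pose phi s : {rmorphism PP -> {poly K}} := horner_eval (mu s).
apply: (@prime_powers_prod _ _ _ S (fun s => 'X - (mu s)%:P) n phi P US) => [s sS|s t sS tS ne|]; last exact: dv.
  split; first by rewrite polyXsubC_eq0.
    by rewrite /phi /= /horner_eval hornerXsubC subrr.
  move=> u; rewrite /phi /= /horner_eval => u0.
  have /factor_theorem[q ->] : root u (mu s) by apply/rootP.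
  by exists q; rewrite mulrC.
rewrite /phi /= /horner_eval hornerXsubC subr_eq0; apply: contraNneq ne => E.
by rewrite -(mu1 s sS) -(mu1 t tS) E.
Qed.

Lemma evO_derivation (D : O -> O) p q (P : PP) :
  {morph D : x y / x + y} -> (forall x y, D (x * y) = D x * y + x * D y) ->
  (forall c, D (oC c) = 0) ->
  D (evO p q P) = evO p q P^`() * D p + evO p q (map_poly (@deriv K) P) * D q.
Proof. exact: ev_deriv. Qed.

Lemma FI_transfer A B f g f' g' : FI A B f g -> g != 0 -> g * f' = f * g' -> FI A B f' g'.
Proof.
rewrite /FI => E g0 h; have hv := congr1 (vfield A B) h; rewrite !vfieldM in hv.
apply: (mulfI (mulf_neq0 g0 g0)).
move: (vfield A B f) (vfield A B g) (vfield A B f') (vfield A B g') E hv => vf vg a b E hv.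
have aE : g * a = vf * g' + f * b - vg * f' by rewrite -hv; ring.
have -> : g * g * (g' * a) = g * g' * (g * a) by ring.
have -> : g * g * (f' * b) = g * b * (g * f') by ring.
rewrite aE; have -> : g * g' * (vf * g' + f * b - vg * f')
  = g' * g' * (g * vf) + g * g' * f * b - vg * g' * (g * f') by ring.
by rewrite E h; ring.
Qed.

(** Since [F(Phi) / G(Phi) = f / g], the pulled-back form kills the vector field and is a multiple
    [u] of [B dx - A dy] by the Koszul relation. The multiplier is a unit because the initial form
    of [P] is a nonzero constant times y^2. *)
Theorem polynomial_model A B f g S nu c m k e : T1 A B -> g != 0 -> critical_data A B f g S nu c m k e ->
  exists (P Q : PP) (p q u : O), [/\ ordge 2 (cgval p - gX), ordge 2 (cgval q - gY), u 0%N 0%N != 0,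
    evO p q P * odx p + evO p q Q * odx q = u * B & evO p q P * ody p + evO p q Q * ody q = - (u * A)].
Proof.
move=> T g0 cd; have [US lv crit e0 [Ex Ey]] := cd.
pose d := (\sum_(s <- S) m s)%N.
(* Precision [d + 4] drops to [d + 3] after differentiation; removing the curves, of total order
   [d], leaves an error of order 3, enough to see the quadratic part of [P]. *)
have [F [G [mu [H [rho [p [q [rho0 muE fac [oF oG] [op oq FG]]]]]]]]] := conjugation_exists (d + 4) T cd.
have FE s : s \in S -> F = (c s)%:P%:P * G + ('X - (mu s)%:P) ^+ (m s).+1 * H s.
  by move=> sS; rewrite -fac // addrC subrK.
pose Pi := \prod_(s <- S) ('X - (mu s)%:P) ^+ m s.
have mu1 s : s \in S -> (mu s)`_1 = s by move=> /muE[].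
have [P PE] : exists P, G * F^`() - F * G^`() = Pi * P.
  apply: line_powers_prod => // s sS; apply: pencil_derivation (FE s sS).
  - by move=> x y; rewrite derivD.
  - by move=> x y; rewrite derivM.
  - by rewrite derivC.
have [Q QE] : exists Q, G * map_poly (@deriv K) F - F * map_poly (@deriv K) G = Pi * Q.
  apply: line_powers_prod => // s sS; apply: pencil_derivation (FE s sS).
  - exact: map_derivD.
  - exact: map_derivM.
  - by rewrite map_polyC /= derivC.
pose Ft := evO p q F; pose Gt := evO p q G; pose Pit := evO p q Pi.
pose U := evO p q P * odx p + evO p q Q * odx q.
pose V := evO p q P * ody p + evO p q Q * ody q.
have PtE : Gt * evO p q F^`() - Ft * evO p q G^`() = Pit * evO p q P.
  by rewrite -!evM -evB PE.
have QtE : Gt * evO p q (map_poly (@deriv K) F) - Ft * evO p q (map_poly (@deriv K) G) = Pit * evO p q Q.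
  by rewrite -!evM -evB QE.
have wr (D : O -> O) : {morph D : x y / x + y} -> (forall x y, D (x * y) = D x * y + x * D y) ->
    (forall c, D (oC c) = 0) -> Gt * D Ft - Ft * D Gt = Pit * (evO p q P * D p + evO p q Q * D q).
  move=> DD DM DC; rewrite /Ft /Gt !evO_derivation // -/Ft -/Gt.
  have gen (a b F1 G1 F2 G2 t P1 Q1 x y : O) : a * F1 - b * G1 = t * P1 -> a * F2 - b * G2 = t * Q1 ->
      a * (F1 * x + F2 * y) - b * (G1 * x + G2 * y) = t * (P1 * x + Q1 * y).
    move=> h1 h2; transitivity ((a * F1 - b * G1) * x + (a * F2 - b * G2) * y); first by ring.
    by rewrite h1 h2; ring.
  exact: gen.
have wrx := wr _ (@odxD R K) (@odxM R K) (@odxC R K).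
have wry := wr _ (@odyD R K) (@odyM R K) (@odyC R K).
rewrite -/U in wrx; rewrite -/V in wry.
have line s : s \in S -> ordge 1 (toG ('X - (mu s)%:P)) /\ ip 1 (toG ('X - (mu s)%:P)) = 'X - s%:P.
  by move=> sS; have [m0 m1] := muE s sS; have := toG_line m0; rewrite m1.
have toPi : toG Pi = \prod_(s <- S) toG ('X - (mu s)%:P) ^+ m s.
  by rewrite toGE rmorph_prod; apply: eq_bigr => s _; rewrite rmorphXn /= -toGE.
have [oPi iPi] := lines_ip m line; rewrite -toPi -/d in oPi iPi.
have cong n (P' : PP) : (n <= 4)%N -> ordge n (cgval (evO p q P') - toG P').
  by move=> le; apply: (woW le); rewrite evO_val toGE; apply: ev_congr.
have Pit0 : Pit != 0.
  rewrite /Pit rmorph_prod prodf_seq_neq0; apply/allP => s sS; rewrite /= rmorphXn expf_neq0 //=.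
  have l0 : cgval (evO p q ('X - (mu s)%:P)) != 0.
    apply: (@ip_neq0 _ 1); rewrite (ip_sub (cong 2 _ _)) //; have [_ ->] := line s sS.
    by rewrite polyXsubC_eq0.
  by apply: contraNneq l0 => ->.
have fi : FI A B f g.
  apply/eqP; rewrite -subr_eq0 /FI /vfield.
  have -> : g * (A * odx f + B * ody f) - f * (A * odx g + B * ody g)
    = A * (g * odx f - f * odx g) + B * (g * ody f - f * ody g) by ring.
  by rewrite Ex Ey; apply/eqP; ring.
have UV : U * A + V * B = 0.
  have := FI_transfer fi g0 FG; rewrite -/Ft -/Gt /FI /vfield => E.
  apply: (mulfI Pit0); rewrite mulr0 mulrDr !mulrA -wrx -wry.
  transitivity (Gt * (A * odx Ft + B * ody Ft) - Ft * (A * odx Gt + B * ody Gt)); first by ring.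
  by rewrite E subrr.
have [u [UE VE]] := T1_koszul T UV.
exists P, Q, p, q, u; split; [by apply: woW op|by apply: woW oq| |exact: UE|exact: VE].
have [oA oB iA iB _] := T.
pose r := toG rho%:P; pose Pm : series2 K := \prod_(s <- S) graph (nu s) ^+ m s : O.
have [oPm iPm] := leaves_ip m lv; rewrite -/d -/Pm in oPm iPm.
have h := derivation_ordge2 (@dxD K) (@dxM K) (fun n u => @ordge_dx K n u) oF oG.
have wrG : cgval g * dx (cgval f) - cgval f * dx (cgval g) = cgval e * Pm * cgval B.
  by have := congr1 (@cgval R K) Ex.
rewrite wrG -!toG_dx -!toGM -toGN -toGD PE toGM addn4 /= in h.
have oM : ordge (d + 2) (r ^+ 2 * (cgval e * Pm * cgval B)).
  by rewrite -mulrA; apply: woMl; apply: woMl; apply: woM.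
have oP : ordge 2 (toG P).
  apply: (ordge_cancel oPi); first by rewrite iPi lines_prod_neq0.
  have -> : toG Pi * toG P = (toG Pi * toG P - r ^+ 2 * (cgval e * Pm * cgval B)) + r ^+ 2 * (cgval e * Pm * cgval B).
    by ring.
  by apply: woD => //; apply: woW h; rewrite addn2.
(* The products over the leaves and over the model curves have the same initial form, which cancels;
   [r ^+ 2 * e] contributes its value at the origin. *)
have iP : ip 2 (toG P) = (rho.[0] ^+ 2 * e 0%N 0%N)%:P.
  have E : ip (d + 2) (toG Pi * toG P) = ip (d + 2) (r ^+ 2 * (cgval e * Pm * cgval B)).
    by apply: ip_sub; rewrite addn2.
  have reassoc : r ^+ 2 * (cgval e * Pm * cgval B) = (r ^+ 2 * cgval e) * (Pm * cgval B) by ring.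
  have E0 : ip (d + 2) ((r ^+ 2 * cgval e) * (Pm * cgval B)) = ip 0 (r ^+ 2 * cgval e) * (ip d Pm * ip 2 B).
    by rewrite -[(d + 2)%N]add0n ipM // ?ipM //; apply: woM.
  rewrite reassoc E0 ipM // iPi iPm iB mulr1 ip_0 mulrC in E.
  have -> : rho.[0] ^+ 2 * e 0%N 0%N = (r ^+ 2 * cgval e) 0%N 0%N.
    by rewrite [r ^+ 2]expr2 !germM00 /r toGC horner_coef0 -expr2.
  exact: (mulIf (lines_prod_neq0 S m) E).
(* The Jacobian matrix of [Phi] is the identity up to order 3, so the quadratic part of [U] is that
   of [P]. *)
have oU : ordge 3 (cgval U - toG P).
  have dp : ordge 3 (dx (cgval p) - 1).
    rewrite -(dxX K) (_ : _ - _ = dx (cgval p - gX)); first exact: (@ordge_dx _ 4).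
    by rewrite dxD; congr (_ + _); apply: germP => i j; rewrite germN !dxE germN mulNrn.
  have dq : ordge 3 (dx (cgval q)).
    rewrite (_ : dx _ = dx (cgval q - gY)); first exact: (@ordge_dx _ 4).
    by rewrite dxD -[LHS]addr0; congr (_ + _); apply: germP => i j; rewrite dxE germN gYE /= oppr0 mul0rn.
  have -> : cgval U - toG P = (cgval (evO p q P) - toG P) * dx (cgval p)
      + (toG P * (dx (cgval p) - 1) + cgval (evO p q Q) * dx (cgval q)).
    by rewrite /U cgD !cgM !odxE; ring.
  apply: woD; first by apply: woMr; apply: cong.
  by apply: woD; apply: woMl.
have := ip_sub oU; rewrite iP -/U [U]UE cgM -[2%N]add0n ipM // ip_0 add0n iB mulr1 => /polyC_inj ->.
by rewrite mulf_neq0 // expf_neq0.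
Qed.



End Conjugation.

(** * Complex numbers and germs as pairs and arrays of real numbers *)

Local Notation RR := Rdefinitions.R.

Lemma normc_ge0 (z : RR[i]) : 0 <= Normc.normc z.
Proof. by case: z => a b; apply: sqrtr_ge0. Qed.
Lemma normcN_complex (z : RR[i]) : Normc.normc (- z) = Normc.normc z.
Proof. exact: (@normcN RR z). Qed.
Lemma normcD_complex (z w : RR[i]) : Normc.normc (z + w) <= Normc.normc z + Normc.normc w.
Proof. exact: (@le_normcD RR z w). Qed.
Lemma normc_nat n : Normc.normc (n%:R : RR[i]) = n%:R.
Proof.
transitivity (Normc.normc (1 : RR[i]) *+ n); first exact: (@normcMn RR 1 n).
by rewrite Normc.normc1.
Qed.

Definition CK : absField RR := AbsField normc_ge0 (@Normc.normc0 RR) (@Normc.normcM RR)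
  normcN_complex normcD_complex normc_nat.

Definition toC (z : Defs.C) : CK := Complex (fst z) (snd z).
Definition ofC (z : CK) : Defs.C := let: Complex a b := z in (a, b).

Lemma ofCK z : toC (ofC z) = z. Proof. by case: z. Qed.
Lemma toC_inj : injective toC. Proof. by move=> [a b] [c d] [-> ->]. Qed.
Lemma toC0 : toC C0 = 0. Proof. by []. Qed.
Lemma toC1 : toC C1 = 1. Proof. by []. Qed.
Lemma toCD z w : toC (Cplus z w) = toC z + toC w. Proof. by []. Qed.
Lemma toCM z w : toC (Cmult z w) = toC z * toC w. Proof. by []. Qed.
Lemma toCB z w : toC (Cminus z w) = toC z - toC w. Proof. by []. Qed.
Lemma toC_nat n : toC (INC n) = n%:R.
Proof.
elim: n => [|n IH]; first by [].
rewrite -[n.+1]addn1 natrD -IH -toC1 -toCD /INC /toC /Cplus /=; congr Complex; first by rewrite addn1 RIneq.S_INR.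
by rewrite RplusE addr0.
Qed.
Lemma toC_sum n F : toC (sumC n F) = \sum_(i < n) toC (F i).
Proof. by elim: n => [|n IH] /=; rewrite ?big_ord0 // big_ord_recr toCD IH. Qed.
Lemma nrm_toC z : nrm (toC z) = Cnorm z.
Proof. by rewrite /Cnorm RsqrtE !RpowE. Qed.
Lemma toC_eq0 z : (toC z == 0) = `[< z = C0 >].
Proof.
by apply/eqP/asboolP => [|-> //]; rewrite -toC0; apply: toC_inj.
Qed.

Local Notation G2 := (series2 CK).
Local Notation O := (cgerm CK).
Implicit Types (f g h : Defs.germ).

Definition lift f : G2 := fun i j => toC (f i j).
Definition lower (s : G2) : Defs.germ := fun i j => ofC (s i j).

Lemma lowerK s : lift (lower s) = s. Proof. by apply: germP => i j; apply: ofCK. Qed.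
Lemma liftD f g : lift (gadd f g) = lift f + lift g. Proof. by apply: germP. Qed.
Lemma liftN f : lift (gopp f) = - lift f. Proof. by apply: germP. Qed.
Lemma liftB f g : lift (gsub f g) = lift f - lift g. Proof. by apply: germP. Qed.
Lemma liftM f g : lift (gmul f g) = lift f * lift g.
Proof.
apply: germP => i j; rewrite /lift /gmul toC_sum germM; apply: eq_bigr => a _.
by rewrite toC_sum; apply: eq_bigr => b _.
Qed.
Lemma liftZ c f : lift (gscal c f) = gC (toC c) * lift f.
Proof. by apply: germP => i j; rewrite gCM. Qed.
Lemma lift_exp f n : lift (gpow f n) = lift f ^+ n.
Proof.
elim: n => [|n IH] /=; last by rewrite liftM IH exprS.
by apply: germP => i j; rewrite expr0 germ1E /lift /gone; case: i; case: j.
Qed.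
Lemma lift_dx f : lift (gdx f) = dx (lift f).
Proof. by apply: germP => i j; rewrite dxE /lift /gdx toCM toC_nat mulr_natl. Qed.
Lemma lift_dy f : lift (gdy f) = dy (lift f).
Proof. by apply: germP => i j; rewrite dyE /lift /gdy toCM toC_nat mulr_natl. Qed.
Lemma lift_eq f g : germ_eq f g <-> lift f = lift g.
Proof.
split=> [e|e i j]; first by apply: germP => i j; rewrite /lift e.
by apply: toC_inj; rewrite -[LHS]/(lift f i j) e.
Qed.
Lemma lift_converges f : Defs.convergent f <-> converges (lift f).
Proof.
split=> [[M [r [r0 h]]]|[M [r [r0 h]]]]; exists M, r; split.
- exact/RltP.
- by move=> i j; rewrite nrm_toC -RpowE -RdivE; apply/RleP; apply: h.
- exact/RltP.
- by move=> i j; apply/RleP; rewrite -nrm_toC RdivE RpowE; apply: h.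
Qed.

Lemma liftO f : Defs.convergent f -> exists F : O, cgval F = lift f.
Proof. by move=> /lift_converges cf; exists (mkO cf). Qed.
Lemma lower_conv (F : O) : Defs.convergent (lower F).
Proof. by apply/lift_converges; rewrite lowerK; apply: cg_conv. Qed.

Lemma lift_unit f : is_unit f <-> lift f 0%N 0%N != 0.
Proof. by rewrite /lift toC_eq0; split=> [/asboolPn|/asboolPn]. Qed.

Lemma lift_divides (d f : O) h k : cgval d = lift h -> cgval f = lift k ->
  divides h k <-> exists q, f = d * q.
Proof.
move=> dE fE; split=> [[q [/liftO[q' qE] /lift_eq e]]|[q e]].
  by exists q'; apply: cgP; rewrite cgM fE e liftM dE qE.
exists (lower q); split; first exact: lower_conv.
by apply/lift_eq; rewrite liftM lowerK -dE -fE e.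
Qed.

Lemma lift_vf A B f (A' B' F : O) : cgval A' = lift A -> cgval B' = lift B -> cgval F = lift f ->
  cgval (vfield A' B' F) = lift (vf A B f).
Proof. by move=> eA eB eF; rewrite cgD !cgM odxE odyE eA eB eF /vf liftD !liftM lift_dx lift_dy. Qed.

Lemma lift_T1 A B (A' B' : O) : cgval A' = lift A -> cgval B' = lift B -> in_T1 A B -> T1 A' B'.
Proof.
move=> eA eB [_ [_ [low [a20 [a11 [a02 [b20 [b11 [b02 [beta [b0 D4]]]]]]]]]]].
have zA i j : (i + j <= 1)%N -> A' i j = 0.
  by move=> /ssrnat.leP lt; rewrite eA; have [h _] := low i j lt; rewrite /lift h.
have zB i j : (i + j <= 1)%N -> B' i j = 0.
  by move=> /ssrnat.leP lt; rewrite eB; have [_ h] := low i j lt; rewrite /lift h.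
have A20 : A' 2%N 0%N = 0 by rewrite eA /lift a20.
have A11 : A' 1%N 1%N = 1 by rewrite eA /lift a11.
have A02 : A' 0%N 2%N = 0 by rewrite eA /lift a02.
have B20 : B' 2%N 0%N = 0 by rewrite eB /lift b20.
have B11 : B' 1%N 1%N = 0 by rewrite eB /lift b11.
have B02 : B' 0%N 2%N = 1 by rewrite eB /lift b02.
have DE i j : Del A' B' i j = (if i is i'.+1 then B' i' j else 0) - (if j is j'.+1 then A' i j' else 0).
  by rewrite /Del cgB !cgM germB gXM gYM.
split.
- by apply/ordgeP => i j; rewrite ltnS => /zA.
- by apply/ordgeP => i j; rewrite ltnS => /zB.
- by apply/polyP => i; rewrite coef_ip coefX; case: i => [|[|[|i]]] //=; rewrite ?A20 ?A11 ?A02.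
- by apply/polyP => i; rewrite coef_ip coef1; case: i => [|[|[|i]]] //=; rewrite ?B20 ?B11 ?B02.
exists (toC beta); first by rewrite toC_eq0; apply/asboolPn.
split.
  apply/ordgeP => i j lt; rewrite DE.
  case: i lt => [|[|[|[|i]]]] //; case: j => [|[|[|[|j]]]] //= _;
    by rewrite ?A20 ?A11 ?A02 ?B20 ?B11 ?B02 ?zA ?zB ?subrr.
apply/polyP => i; rewrite coef_ip coefZ coefXn; case: leqP => [le|lt]; last first.
  by rewrite gtn_eqF // mulr0.
have := congr1 toC (D4 i (4 - i)%N (subnKC le)); rewrite toCB DE.
have -> : toC (if Nat.eqb i 4 then beta else C0) = toC beta * (i == 4%N)%:R.
  by case: i le => [|[|[|[|[|i]]]]] //= _; rewrite ?mulr0 ?mulr1.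
move=> <-; congr (_ - _); first by case: i {le} => // i; rewrite eB.
by case: (4 - i)%N => // j; rewrite eA.
Qed.

Lemma lift_peval N (P : {poly {poly CK}}) (p q : O) : (size P <= N.+1)%N ->
  (forall i, (size (P`_i)%R <= N.+1)%N) ->
  lift (peval N (lower (toG P)) (lower p) (lower q)) = cgval (ev (@oC RR CK) p q P).
Proof.
move=> s1 s2; rewrite evO_val (@ev_sum _ _ _ _ _ _ N.+1) //.
have -> : lift (peval N (lower (toG P)) (lower p) (lower q)) = \sum_(i < N.+1) \sum_(j < N.+1)
   lift (gscal (lower (toG P) i j) (gmul (gpow (lower p) i) (gpow (lower q) j))).
  apply: germP => i j; rewrite /lift /peval toC_sum fps_sum fps_sum; apply: eq_bigr => a _.
  by rewrite toC_sum fps_sum fps_sum.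
apply: eq_bigr => i _; apply: eq_bigr => j _.
by rewrite liftZ liftM !lift_exp !lowerK ofCK.
Qed.

Lemma poly2_bounded (P : {poly {poly CK}}) : exists N, forall M, (N <= M)%N ->
  [/\ (size P <= M.+1)%N, forall i, (size (P`_i)%R <= M.+1)%N & poly_bounded M (lower (toG P))].
Proof.
exists (size P + \sum_(i < size P) size (P`_i)%R)%N => M le.
have szP : (size P <= M.+1)%N by apply: leqW; apply: leq_trans le; rewrite leq_addr.
have szP' i : (size (P`_i)%R <= M.+1)%N.
  have [lt|ge] := ltnP i (size P); last by rewrite nth_default ?size_poly0.
  apply: leqW; apply: leq_trans le; rewrite (bigD1 (Ordinal lt)) //=; clear; lia.
split=> // i j h; apply: toC_inj; rewrite -[LHS]/(lift (lower (toG P)) i j) lowerK toC0 /toG.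
case: h => /ssrnat.ltP lt; last by rewrite nth_default // (leq_trans (szP' i)).
by rewrite [P`_i]nth_default ?coef0 // (leq_trans szP).
Qed.

Theorem theorem2 (A B : germ) :
  in_T1 A B ->
  (exists f g h : germ,
      mero_first_integral A B f g /\
      separatrix A B h /\ tangent_cone_y h /\
      divides h f /\ ~ divides (gmul h h) f) ->
  exists (phi1 phi2 u P Q : germ) (N : nat),
    convergent phi1 /\ convergent phi2 /\
    phi1 0%nat 0%nat = C0 /\ phi2 0%nat 0%nat = C0 /\
    Cminus (Cmult (phi1 1%nat 0%nat) (phi2 0%nat 1%nat))
           (Cmult (phi1 0%nat 1%nat) (phi2 1%nat 0%nat)) <> C0 /\
    convergent u /\ is_unit u /\
    poly_bounded N P /\ poly_bounded N Q /\
    (* Phi^* (P dx + Q dy) = u (B dx - A dy) *)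
    germ_eq (gadd (gmul (peval N P phi1 phi2) (gdx phi1))
                  (gmul (peval N Q phi1 phi2) (gdx phi2)))
            (gmul u B) /\
    germ_eq (gadd (gmul (peval N P phi1 phi2) (gdy phi1))
                  (gmul (peval N Q phi1 phi2) (gdy phi2)))
            (gopp (gmul u A)).
Proof.
move=> inT [f [g [h [[cf [cg [g0 [cop [_ fi]]]]] [[[ch [h0 [nuh irr]]] dvh] [[m [c [c0 [lowh iph]]]] [hf nhhf]]]]]]].
have [cA [cB _]] := inT.
have [A' eA] := liftO cA; have [B' eB] := liftO cB.
have [F eF] := liftO cf; have [G eG] := liftO cg; have [H eH] := liftO ch.
have T := lift_T1 eA eB inT.
have [K hK] := (lift_divides eH eF).1 hf.
have ev' := lift_vf eA eB eH.
have [kap hkap] := (lift_divides eH ev').1 dvh.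
have FIfg : FI A' B' F G.
  apply: cgP; apply/eqP; rewrite -subr_eq0; apply/eqP.
  rewrite !cgM (lift_vf eA eB eF) (lift_vf eA eB eG) eF eG -!liftM -liftB.
  by rewrite ((lift_eq _ _).1 fi); apply: germP.
have nz d (D : O) : cgval D = lift d -> germ_nonzero d -> D != 0.
  move=> eD [i [j dij]]; apply/eqP => D0; case: dij; apply: toC_inj.
  by rewrite -[LHS]/(lift d i j) -eD D0.
have coFG : ocoprime F G.
  move=> D dF dG; have eD := esym (lowerK D).
  have := cop (lower D) (lower_conv D) ((lift_divides eD eF).2 dF) ((lift_divides eD eG).2 dG).
  by move/lift_unit; rewrite lowerK.
have nHH : ~ (exists q, F = H * H * q).
  by move=> /(lift_divides (_ : cgval (H * H) = lift (gmul h h)) eF) hh; apply: nhhf; apply: hh; rewrite liftM -eH.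
have F0 : F != 0 by apply/eqP => F0; apply: nHH; exists 0; rewrite F0 mulr0.
have irrH : oirreducible H.
  split; first exact: nz eH h0.
    by apply/eqP; apply: contra_notT nuh => h00; apply/lift_unit; rewrite -eH.
  move=> a b hab; have := irr (lower a) (lower b) (lower_conv a) (lower_conv b).
  rewrite lift_eq liftM !lowerK -eH hab => /(_ erefl).
  by case=> /lift_unit; rewrite lowerK; [left|right].
have oH : ordge m H.
  by apply/ordgeP => i j lt; rewrite eH /lift lowh //; apply/ssrnat.ltP.
have iH : ip m H = (toC c)%:P.
  apply/polyP => i; rewrite coef_ip coefC eH /lift; case: leqP => le.
    by rewrite (iph _ _ (subnKC le)); case: i {le}.
  by case: i le.
have c0' : toC c != 0 by rewrite toC_eq0; apply/asboolPn.
have [d [oF oG iF iG top]] := cusp_wronskian T FIfg coFG F0 (nz _ _ eG g0) irrH hkap oH iH c0' hK nHH.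
have [G' [S [nu [c' [m' [k [e [cd G'0]]]]]]]] := critical_data_exists T FIfg coFG oF oG iF iG top.
have [P [Q [p [q [u [op oq u0 Ex Ey]]]]]] := polynomial_model T G'0 cd.
have [N1 hN1] := poly2_bounded P; have [N2 hN2] := poly2_bounded Q.
have [P1 P2 P3] := hN1 (N1 + N2)%N (leq_addr _ _); have [Q1 Q2 Q3] := hN2 (N1 + N2)%N (leq_addl _ _).
(* [Phi] is tangent to the identity, so its Jacobian at the origin is 1. *)
have pE i j : (i + j < 2)%N -> p i j = gX i j.
  by move=> lt; apply/eqP; rewrite -subr_eq0 -germB; apply/eqP; apply: op; rewrite !mul1n.
have qE i j : (i + j < 2)%N -> q i j = gY i j.
  by move=> lt; apply/eqP; rewrite -subr_eq0 -germB; apply/eqP; apply: oq; rewrite !mul1n.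
exists (lower p), (lower q), (lower u), (lower (toG P)), (lower (toG Q)), (N1 + N2)%N.
do 2 (split; first exact: lower_conv).
split; first by apply: toC_inj; rewrite ofCK pE // gXE.
split; first by apply: toC_inj; rewrite ofCK qE // gYE.
split.
  move=> /(congr1 toC); rewrite toCB !toCM !ofCK !pE // !qE // !gXE !gYE /= => /eqP.
  by rewrite mulr1 mulr0 subr0 oner_eq0.
split; first exact: lower_conv.
split; first by apply/lift_unit; rewrite lowerK.
split; first exact: P3.
split; first exact: Q3.
split; apply/lift_eq.
  by rewrite liftD !liftM !lift_peval // !lift_dx !lowerK -eB -cgM -Ex.
by rewrite liftD liftN !liftM !lift_peval // !lift_dy !lowerK -eA -cgM -cgN -Ey.
Qed.
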